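(* Let $G$ be a graph that is not $3$-connected and is minor-minimal with respect to having maximum matching width at least $3$. Then $G$ is obtained from a $3$-connected graph on $4$, $5$ or $6$ vertices by good-subdividing some of its edges.
   Context: All graphs are finite and simple. A graph is $k$-connected if it has at least $k$ vertices and remains connected after deleting any fewer than $k$ vertices. Minor-minimal with respect to having maximum matching width at least $3$ means $\operatorname{mmw}(G)\ge3$ while every proper minor $H$ of $G$ (obtained by deleting vertices/edges and contracting edges) has $\operatorname{mmw}(H)\le 2$. $\operatorname{mmw}(G)$ is the maximum matching width: the minimum, over branch-decompositions $(T,\mathcal{L})$ of $V(G)$ (with $T$ a tree all of whose vertices have degree $1$ or $3$ and $\mathcal{L}$ a bijection from its leaves to $V(G)$), of the maximum over edges $e$ of $T$ of the size of a maximum matching in $G$ among edges crossing the vertex partition induced by $e$. Good-subdividing an edge $ab$ means replacing it by one of the following, using new vertices $c,d$ adjacent to no other vertices: a path $acb$ ($1$-subdivision), a path $acdb$ ($2$-subdivision), or the two paths $acb$ and $adb$ ($11$-subdivision); in each case the edge $ab$ itself is removed. *)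

(* Defs.v *)
From mathcomp Require Import all_boot.
From mathcomp Require Import boolp.

Set Implicit Arguments.
Unset Strict Implicit.
Unset Printing Implicit Defensive.

Record sgraph := SGraph {
  vertex :> finType;
  adj : rel vertex;
  adj_sym : symmetric adj;
  adj_irr : irreflexive adj }.

Definition isomorphic (G H : sgraph) : Prop :=
  exists2 f : G -> H, bijective f & forall x y : G, adj (f x) (f y) = adj x y.

Definition edges (G : sgraph) : {set {set G}} :=
  [set [set p.1; p.2] | p : G * G & adj p.1 p.2].

Definition degree (G : sgraph) (x : G) : nat := #|[set y | adj x y]|.

Definition connected_outside (G : sgraph) (S : {set G}) : Prop :=
  forall x y : G, x \notin S -> y \notin S ->
    connect (fun u v : G => [&& u \notin S, v \notin S & adj u v]) x y.

Definition k_connected (k : nat) (G : sgraph) : Prop :=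
  k <= #|G| /\ forall S : {set G}, #|S| < k -> connected_outside S.

Section Minors.
Variables (G : sgraph) (x y : G).

Definition del_vertex_adj : rel {z : G | z != x} :=
  fun u v => adj (val u) (val v).

Lemma del_vertex_sym : symmetric del_vertex_adj.
Proof. by move=> u v; rewrite /del_vertex_adj adj_sym. Qed.

Lemma del_vertex_irr : irreflexive del_vertex_adj.
Proof. by move=> u; rewrite /del_vertex_adj adj_irr. Qed.

Definition del_vertex : sgraph := SGraph del_vertex_sym del_vertex_irr.

Definition del_edge_adj : rel G :=
  fun u v => adj u v && ([set u; v] != [set x; y]).

Lemma del_edge_sym : symmetric del_edge_adj.
Proof. by move=> u v; rewrite /del_edge_adj adj_sym setUC. Qed.

Lemma del_edge_irr : irreflexive del_edge_adj.
Proof. by move=> u; rewrite /del_edge_adj adj_irr. Qed.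

Definition del_edge : sgraph := SGraph del_edge_sym del_edge_irr.

(* x plays the role of the vertex obtained by identifying x and y; loops and
   parallel edges disappear. *)
Definition contract_adj : rel {z : G | z != y} :=
  fun u v => (u != v) &&
    [|| adj (val u) (val v),
        (val u == x) && adj y (val v) | (val v == x) && adj y (val u)].

Lemma contract_sym : symmetric contract_adj.
Proof.
by move=> u v; rewrite /contract_adj eq_sym adj_sym;
  congr (_ && (_ || _)); rewrite orbC.
Qed.

Lemma contract_irr : irreflexive contract_adj.
Proof. by move=> u; rewrite /contract_adj eqxx. Qed.

Definition contract : sgraph := SGraph contract_sym contract_irr.

End Minors.

Inductive minor_step (G : sgraph) : sgraph -> Prop :=
| MinorDelVertex (x : G) : minor_step G (del_vertex x)
| MinorDelEdge (x y : G) : adj x y -> minor_step G (del_edge x y)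
| MinorContract (x y : G) : adj x y -> minor_step G (contract x y).

Inductive minor_steps (G : sgraph) : sgraph -> Prop :=
| MinorOne (H : sgraph) : minor_step G H -> minor_steps G H
| MinorMore (H K : sgraph) :
    minor_steps G H -> minor_step H K -> minor_steps G K.

Definition proper_minor (H G : sgraph) : Prop :=
  exists2 K : sgraph, minor_steps G K & isomorphic K H.

Definition is_tree (T : sgraph) : Prop :=
  [/\ 0 < #|T|,
      forall x y : T, connect (@adj T) x y
    & forall c : seq T, 2 < size c -> ~~ ucycleb (@adj T) c].

Definition leaf (T : sgraph) (t : T) : bool := degree t == 1.

Definition is_branch_decomposition (V : finType) (T : sgraph)
    (L : {t : T | leaf t} -> V) : Prop :=
  [/\ is_tree T,
      forall t : T, degree t = 1 \/ degree t = 3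
    & bijective L].

(* For an edge rs of T: the part of V labelled by the leaves of the component
   of T - rs that contains r. *)
Definition branch_side (V : finType) (T : sgraph)
    (L : {t : T | leaf t} -> V) (r s : T) : {set V} :=
  L @: [set t | connect (del_edge_adj r s) r (val t)].

Definition crossing_matching (G : sgraph) (A : {set G}) (M : {set {set G}}) : bool :=
  [&& M \subset edges G, trivIset M
    & [forall E in M, (E :&: A != set0) && (E :\: A != set0)]].

Definition max_crossing_matching (G : sgraph) (A : {set G}) : nat :=
  \max_(M : {set {set G}} | crossing_matching A M) #|M|.

Definition branch_width (G T : sgraph) (L : {t : T | leaf t} -> G) : nat :=
  \max_(p : T * T | adj p.1 p.2) max_crossing_matching (branch_side L p.1 p.2).

Definition has_branch_width (G : sgraph) (k : nat) : Prop :=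
  exists (T : sgraph) (L : {t : T | leaf t} -> G),
    is_branch_decomposition L /\ branch_width L = k.

(* Graphs with at most one vertex are exactly those without a branch
   decomposition; they are given width 0. *)
Definition mmw (G : sgraph) : nat :=
  match pselect (exists k, `[< has_branch_width G k >]) with
  | left ex_k => ex_minn ex_k
  | right _ => 0
  end.

Definition minor_minimal_mmw_ge3 (G : sgraph) : Prop :=
  3 <= mmw G /\ forall H : sgraph, proper_minor H G -> mmw H <= 2.

Variant subdivision := Keep | Sub1 | Sub2 | Sub11.

Section GoodSubdivision.
Variables (G : sgraph) (k : {set G} -> subdivision).

(* The new vertex of a 1-subdivided edge E is (E, None); those of a
   2-subdivided or 11-subdivided edge E = ab are (E, Some a) and (E, Some b).
   In the path acdb, c is (E, Some a) and d is (E, Some b). *)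
Definition new_vertex (n : {set G} * option G) : bool :=
  (n.1 \in edges G) &&
  match k n.1, n.2 with
  | Sub1, None => true
  | Sub2, Some x | Sub11, Some x => x \in n.1
  | _, _ => false
  end.

Definition kept (E : {set G}) : bool := if k E is Keep then true else false.

Definition old_new_adj (a : G) (n : {set G} * option G) : bool :=
  match k n.1 with
  | Keep => false
  | Sub2 => n.2 == Some a
  | Sub1 | Sub11 => a \in n.1
  end.

Definition new_new_adj (m n : {set G} * option G) : bool :=
  if k m.1 is Sub2 then (m.1 == n.1) && (m.2 != n.2) else false.

Definition good_subdivide_adj : rel (G + {n | new_vertex n}) :=
  fun u v => match u, v with
  | inl a, inl b => adj a b && kept [set a; b]
  | inl a, inr n | inr n, inl a => old_new_adj a (val n)
  | inr m, inr n => new_new_adj (val m) (val n)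
  end.

Lemma good_subdivide_sym : symmetric good_subdivide_adj.
Proof.
move=> [a|m] [b|n] //=; first by rewrite adj_sym setUC.
rewrite /new_new_adj eq_sym [(val m).2 == _]eq_sym.
by case: eqP => [->|_] //=; case: (k _); case: (k _).
Qed.

Lemma good_subdivide_irr : irreflexive good_subdivide_adj.
Proof.
move=> [a|m] /=; first by rewrite adj_irr.
by rewrite /new_new_adj !eqxx; case: (k _).
Qed.

Definition good_subdivide : sgraph :=
  SGraph good_subdivide_sym good_subdivide_irr.

End GoodSubdivision.

(* Main.v *)
Require Import Defs.
From mathcomp Require Import all_boot.
From mathcomp Require Import zify.
From mathcomp Require Import boolp.

Set Implicit Arguments.
Unset Strict Implicit.
Unset Printing Implicit Defensive.

(** By Koenig's theorem and uncrossing, mmw(G) <= 2 holds if and only if the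
    vertices of G can be represented by subtrees with at least one edge of a
    subcubic tree such that adjacent vertices get intersecting subtrees and each
    tree edge lies in at most two subtrees.  Such representations pass to minors
    by uniting subtrees, and can be glued along a tree edge carrying {a, b}.

    Let G be minimal with mmw >= 3.  Gluing shows that G has at least 7 vertices
    and no cut vertex, and that for every 2-separation with separator {a, b} one
    side has no representation in which a and b share a tree edge.  The key step
    is that adding to such a side a path a c d b, or two paths a c b and a d b,
    leaves no representation at all; as the other side contracts onto one of
    these as soon as it has two inner vertices, minimality forces it to be one
    of the three good subdivisions of ab.  So every 2-separation cuts off
    vertices of degree 2 only; suppressing them yields a 3-connected graph, whose
    own representation forces it to be the bag of one node, hence to have at most
    6 vertices. *)

(** * Tree representations *)

(** The number six has a single source: a node has three tree edges, each with room for two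
    vertices. Any six vertices therefore fit around one node, so that a set of at most four vertices
    attached to the rest only at [a] and [b] is always representable with [a] and [b] on its root
    edge. Such a piece is forced to be a good subdivision without inspection of the rest of the
    graph; this excludes three consecutive vertices of degree 2, and three of them between the same
    two ends. A side with a single inner vertex contains none of the two patterns. There only the
    edge [ab] has to be excluded, by adding it to a representation of the graph without it. The
    3-connected graph is not bounded through [G], which has no representation, but through the
    contraction of one edge at a vertex of degree 2: this proper minor still contains it as a minor.
    It has at least four vertices because otherwise [G] would have too few vertices or would be a
    triangle of small pieces, which can be glued. The predicate [rep] is rooted while the arguments
    are about all edges of the tree, so roots have to be moved. *)

Ltac bcases := repeat match goal with
  |- context [?x \in ?A] => case: (x \in A) => //= end.

Section Rep.
Variable V : finType.
Implicit Types (e : rel V) (W S U X Z A B : {set V}).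

Definition sep e W S :=
  forall u v, u \in W -> u \notin S -> v \notin W -> ~~ e u v.

(* [rep e W S]: the part of a tree representation on one side of a tree edge
   that carries S, where W collects the vertices whose subtrees meet this part.
   The bag of a node is S1 u S2 u S.  No condition on edges is needed beyond
   [sep]: an edge leaving W1 - S1 or W2 - S2 is excluded, so every edge not
   inside W1 or W2 lies in the bag. *)
Inductive rep e : {set V} -> {set V} -> Prop :=
| RepLeaf S : #|S| <= 2 -> rep e S S
| RepNode W S W1 S1 W2 S2 : rep e W1 S1 -> rep e W2 S2 ->
    #|S| <= 2 -> sep e W S ->
    (forall x, (x \in W) = [|| x \in W1, x \in W2 | x \in S]) ->
    (forall x, x \in W1 -> x \in W2 -> (x \in S1) && (x \in S2)) ->
    (forall x, x \in S -> x \in W1 -> x \in S1) ->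
    (forall x, x \in S -> x \in W2 -> x \in S2) ->
    rep e W S.

(* C induces a connected graph, stated through e-closed subsets so that it
   transfers along contractions without paths. *)
Definition conn e (C : {set V}) :=
  forall X, (forall x y, x \in C -> y \in C -> x \in X -> e x y -> y \in X) ->
  forall x y, x \in C -> y \in C -> x \in X -> y \in X.

Lemma rep_sub e W S : rep e W S -> forall x, x \in S -> x \in W.
Proof. by case=> // {}W {}S W1 S1 W2 S2 _ _ _ _ eW _ _ _ x xS; rewrite eW xS !orbT. Qed.

Lemma rep_card e W S : rep e W S -> #|S| <= 2.
Proof. by case. Qed.

Lemma rep_sep e W S : rep e W S -> sep e W S.
Proof. by case=> // {}S _ u v uS /negP. Qed.

(** The hypothesis only constrains edges starting in [W] outside [S], so edges between two vertices
    of [S] may be new. This is how the edge [ab] is restored once [a] and [b] share the root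
    edge. *)
Lemma rep_mono e e' W S : rep e W S ->
  (forall u v, u \in W -> u \notin S -> e' u v -> e u v) -> rep e' W S.
Proof.
elim=> {W S} [S hS _|W S W1 S1 W2 S2 _ IH1 _ IH2 hS hs eW h12 h1 h2 ee']; first exact: RepLeaf.
apply: (RepNode (W1 := W1) (S1 := S1) (W2 := W2) (S2 := S2)) => //.
- apply: IH1 => u v uW uS; apply: ee'; first by rewrite eW uW.
  by apply: contra uS => uS; apply: h1.
- apply: IH2 => u v uW uS; apply: ee'; first by rewrite eW uW orbT.
  by apply: contra uS => uS; apply: h2.
- by move=> u v uW uS vW; apply: contra (hs u v uW uS vW); apply: ee'.
Qed.

Lemma rep_leaf0 e : rep e set0 set0.
Proof. by apply: RepLeaf; rewrite cards0. Qed.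

(** A node with an empty third branch is inserted on the root edge, and the subtrees of the vertices
    in [S'] but not in [S] end there. *)
Lemma rep_shrink e W S S' : rep e W S' -> (forall x, x \in S -> x \in S') ->
  sep e W S -> rep e W S.
Proof.
move=> r SS hs.
have cS : #|S| <= 2 by apply: leq_trans (rep_card r); apply: subset_leq_card; apply/subsetP.
apply: (RepNode r (rep_leaf0 e)) => // x; rewrite ?inE //.
- by case xW: (x \in W) => //=; case xS: (x \in S) => //; rewrite (rep_sub r (SS _ xS)) in xW.
- by move/SS.
Qed.

Lemma rep_union e W1 S1 W2 S2 W : rep e W1 S1 -> rep e W2 S2 -> sep e W set0 ->
  (forall x, (x \in W) = (x \in W1) || (x \in W2)) ->
  (forall x, x \in W1 -> x \in W2 -> (x \in S1) && (x \in S2)) -> rep e W set0.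
Proof.
move=> r1 r2 hs eW h; apply: (RepNode r1 r2) => //; rewrite ?cards0 // => x; rewrite ?inE //.
by rewrite eW orbF.
Qed.

Lemma rep_edge e W1 W2 S W : rep e W1 S -> rep e W2 S -> sep e W set0 ->
  (forall x, (x \in W) = (x \in W1) || (x \in W2)) ->
  (forall x, x \in W1 -> x \in W2 -> x \in S) -> rep e W S.
Proof.
move=> r1 r2 hs eW h; apply: (RepNode r1 r2) => //; first exact: rep_card r1.
- by move=> u v uW _; apply: hs => //; rewrite inE.
- move=> x; rewrite eW; case xS: (x \in S); last by rewrite orbF.
  by rewrite (rep_sub r1 xS).
- by move=> x a b; rewrite (h x a b).
Qed.

(** The new node has bag [a], [v], [b], and its tree edges carry the three pairs. *)
Lemma rep_series e W1 W2 W a b v : rep e W1 [set a; v] -> rep e W2 [set v; b] ->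
  sep e W [set a; b] -> (forall x, (x \in W) = (x \in W1) || (x \in W2)) ->
  (forall x, x \in W1 -> x \in W2 -> x = v) -> (a \in W2 -> a = v) -> (b \in W1 -> b = v) ->
  rep e W [set a; b].
Proof.
move=> r1 r2 hs eW h ha hb; apply: (RepNode r1 r2) => //.
- by rewrite cards2; case: eqP.
- move=> x; rewrite eW orbA; case xS: (x \in [set a; b]); rewrite ?orbT ?orbF //.
  case/set2P: xS => ->; first by rewrite (rep_sub r1) // !inE eqxx.
  by rewrite (rep_sub r2) ?orbT // !inE eqxx orbT.
- by move=> x x1 x2; rewrite (h x x1 x2) !inE !eqxx /= ?orbT.
- by move=> x; case/set2P=> ->; rewrite !inE ?eqxx // => /hb ->; rewrite eqxx orbT.
- by move=> x; case/set2P=> ->; rewrite !inE ?eqxx ?orbT // => /ha ->; rewrite eqxx.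
Qed.

Lemma split_card4 X : #|X| <= 4 -> exists X1 X2, [/\ #|X1| <= 2, #|X2| <= 2,
  X1 :|: X2 = X & forall x, x \in X1 -> x \notin X2].
Proof.
move=> h; pose s := enum X.
have us : uniq (take 2 s ++ drop 2 s) by rewrite cat_take_drop enum_uniq.
have ss : size s <= 4 by rewrite -cardE.
exists [set x in take 2 s], [set x in drop 2 s]; split.
- rewrite cardsE; apply: leq_trans (card_size _) _; rewrite size_take; case: ifP => // /negbT; lia.
- rewrite cardsE; apply: leq_trans (card_size _) _; rewrite size_drop; lia.
- by apply/setP=> x; rewrite !inE -mem_cat cat_take_drop mem_enum.
- move=> x; rewrite !inE => x1; move: us; rewrite cat_uniq => /and3P[_ /hasPn h2 _].
  by apply/negP=> /h2; rewrite x1.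
Qed.

(** Besides the root edge a single node has two tree edges, each with room for two vertices. *)
Lemma rep_small e W S : (forall x, x \in S -> x \in W) -> #|S| <= 2 -> sep e W S ->
  #|W :\: S| <= 4 -> rep e W S.
Proof.
move=> SW cS hs /split_card4[X1 [X2 [c1 c2 eX d]]].
have eX' x : (x \in X1) || (x \in X2) = (x \notin S) && (x \in W) by rewrite -in_setU eX !inE.
apply: (RepNode (RepLeaf e c1) (RepLeaf e c2)) => // x.
- rewrite orbA eX'; case xS: (x \in S); rewrite ?orbT ?orbF //; exact: SW.
- by move=> x1; rewrite (negbTE (d _ x1)).
Qed.

(** * Moving the root of a representation *)

Section Unrooted.
Variables (e : rel V) (U : {set V}).
Hypothesis (e_sym : symmetric e) (sepU : sep e U set0).

(* The vertices on the other side of the tree edge cutting off W and carrying S. *)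
Definition opp W S := U :\: (W :\: S).

Lemma in_opp W S x : (x \in opp W S) = (x \in U) && ((x \in S) || (x \notin W)).
Proof. by rewrite !inE negb_and negbK andbC. Qed.

Lemma sep_opp W S : sep e W S -> (forall x, x \in W -> x \in U) -> sep e (opp W S) S.
Proof.
move=> hs WU u v; rewrite !in_opp negb_and => /andP[uU /orP[->//|uW]] uS.
case vU: (v \in U) => /=; last by move=> _; apply: sepU => //; rewrite ?inE ?vU.
by rewrite negb_or negbK => /andP[vS vW]; rewrite e_sym; apply: hs.
Qed.

Lemma rep_both W S : rep e W S -> rep e (opp W S) S -> (forall x, x \in W -> x \in U) ->
  rep e U S.
Proof.
move=> r r' WU; apply: (rep_edge r r') => // x; rewrite in_opp.
- by have := WU x; have := rep_sub r (x := x); bcases; do ?[by move=> *; exfalso; auto].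
- by move=> ->; rewrite orbF => /andP[].
Qed.

(** Seen from the first child, the rest of the tree is again a node: its branches are the second
    child and everything beyond the root edge. *)
Lemma rep_opp W S W1 S1 W2 S2 : rep e W1 S1 -> rep e W2 S2 -> rep e (opp W S) S ->
  (forall x, x \in W -> x \in U) ->
  (forall x, (x \in W) = [|| x \in W1, x \in W2 | x \in S]) ->
  (forall x, x \in W1 -> x \in W2 -> (x \in S1) && (x \in S2)) ->
  (forall x, x \in S -> x \in W1 -> x \in S1) ->
  (forall x, x \in S -> x \in W2 -> x \in S2) -> rep e (opp W1 S1) S1.
Proof.
move=> r1 r2 r WU eW h12 h1 h2.
have W1U x : x \in W1 -> x \in U by move=> xW; apply: WU; rewrite eW xW.
apply: (RepNode r2 r) => //; first exact: rep_card r1.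
- exact/sep_opp/W1U/rep_sep.
- move=> x; rewrite !in_opp; have := WU x; have := h12 x; have := h1 x; have := h2 x; have := eW x.
  have := rep_sub r1 (x := x); have := rep_sub r2 (x := x).
  by bcases; do ?[by move=> *; exfalso; auto].
- move=> x; rewrite !in_opp; have := WU x; have := h12 x; have := h1 x; have := h2 x; have := eW x.
  have := rep_sub r1 (x := x); have := rep_sub r2 (x := x).
  by bcases; do ?[by move=> *; exfalso; auto].
- move=> x; rewrite ?in_opp; have := WU x; have := h12 x; have := h1 x; have := h2 x; have := eW x.
  have := rep_sub r1 (x := x); have := rep_sub r2 (x := x).
  by bcases; do ?[by move=> *; exfalso; auto].
- move=> x; rewrite ?in_opp; have := WU x; have := h12 x; have := h1 x; have := h2 x; have := eW x.
  have := rep_sub r1 (x := x); have := rep_sub r2 (x := x).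
  by bcases; do ?[by move=> *; exfalso; auto].
Qed.
End Unrooted.
End Rep.

(** * Transport along minor models *)

Section Push.
Variables (V V' : finType) (e : rel V) (e' : rel V') (beta : V -> {set V'}).
Hypothesis beta_inj : forall u v x, x \in beta u -> x \in beta v -> u = v.
Hypothesis beta_conn : forall v, conn e' (beta v).
Hypothesis beta_edge : forall u v, e u v ->
  exists x y, [/\ x \in beta u, y \in beta v & e' x y].

(** The new subtree of [v] is the union of the subtrees of its branch set, so it meets a part
    exactly when [beta v] does. An empty branch set discards [v]. *)
Definition trace (W : {set V'}) : {set V} := [set v | [exists x in beta v, x \in W]].

Lemma traceP (W : {set V'}) v : reflect (exists2 x, x \in beta v & x \in W) (v \in trace W).
Proof. by rewrite inE; apply: (iffP exists_inP). Qed.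

Lemma card_trace (S : {set V'}) : #|trace S| <= #|S|.
Proof.
rewrite -(card_imset (trace S) Some_inj).
apply: leq_trans (leq_imset_card (fun s => [pick v | s \in beta v]) S).
apply: subset_leq_card; apply/subsetP=> _ /imsetP[v /traceP[x xv xS] ->].
apply/imsetP; exists x => //; case: pickP => [w xw|/(_ v)]; last by rewrite xv.
by rewrite (beta_inj xv xw).
Qed.

Lemma trace_inside (W S : {set V'}) v x : sep e' W S -> x \in beta v -> x \in W -> v \notin trace S ->
  forall y, y \in beta v -> (y \in W) && (y \notin S).
Proof.
move=> hs xv xW vS y yv.
have nS z : z \in beta v -> z \notin S by move=> zv; apply: contra vS => zS; apply/traceP; exists z.
have /setDP[-> ->] // : y \in W :\: S.
apply: (beta_conn (v := v) _ xv yv) => [p q pv qv|]; last by rewrite inE xW nS.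
rewrite !inE !nS //= => pW epq; apply: contraT => qW.
by move: (hs _ _ pW (nS _ pv) qW); rewrite epq.
Qed.

(** If a branch set avoids a tree edge, then by [trace_inside] it lies entirely on one side of it.
    Each condition on traces follows by playing this against a second element of the branch set
    found on the other side. *)
Lemma rep_push W S : rep e' W S -> rep e (trace W) (trace S).
Proof.
elim=> {W S} [S hS|W S W1 S1 W2 S2 r1 IH1 r2 IH2 hS hs eW h12 h1 h2].
  by apply: RepLeaf; apply: leq_trans (card_trace S) hS.
apply: (RepNode IH1 IH2) => //.
- exact: leq_trans (card_trace S) hS.
- move=> u v /traceP[x xu xW] uS /traceP vW; apply/negP=> /beta_edge[y [z [yu zv eyz]]].
  have /andP[yW yS] := trace_inside hs xu xW uS yu.
  have : z \notin W by apply/negP=> zW; apply: vW; exists z.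
  by move/(hs _ _ yW yS); rewrite eyz.
- move=> v; apply/traceP/or3P => [[x xv]|[]/traceP[x xv xW]].
  + by rewrite eW => /or3P[xW|xW|xW]; [apply: Or31|apply: Or32|apply: Or33]; apply/traceP; exists x.
  + by exists x; rewrite // eW xW.
  + by exists x; rewrite // eW xW orbT.
  + by exists x; rewrite // eW xW !orbT.
- move=> v /traceP[x xv x1] /traceP[y yv y2]; apply/andP; split; apply: contraT => vS.
  + have /andP[y1 yS] := trace_inside (rep_sep r1) xv x1 vS yv.
    by have := h12 y y1 y2; rewrite (negbTE yS).
  + have /andP[x2 xS] := trace_inside (rep_sep r2) yv y2 vS xv.
    by have := h12 x x1 x2; rewrite (negbTE xS) andbF.
- move=> v /traceP[x xv xS] /traceP[y yv y1]; apply: contraT => vS.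
  have /andP[x1 xS1] := trace_inside (rep_sep r1) yv y1 vS xv.
  by rewrite (h1 _ xS x1) in xS1.
- move=> v /traceP[x xv xS] /traceP[y yv y1]; apply: contraT => vS.
  have /andP[x1 xS1] := trace_inside (rep_sep r2) yv y1 vS xv.
  by rewrite (h2 _ xS x1) in xS1.
Qed.
End Push.

Section Conn.
Variables (V : finType) (e : rel V).
Hypothesis e_sym : symmetric e.

Lemma conn0 : conn e set0.
Proof. by move=> X _ x y; rewrite inE. Qed.

Lemma conn1 x : conn e [set x].
Proof. by move=> X _ y z /set1P-> /set1P->. Qed.

Lemma conn_add x y C : conn e C -> y \in C -> e x y -> conn e (x |: C).
Proof.
move=> cC yC exy X hX.
have hX' : forall u v, u \in C -> v \in C -> u \in X -> v \in X.
  by apply: cC => u v uC vC; apply: hX; rewrite inE ?uC ?vC orbT.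
have h1 : x \in X -> y \in X by move=> xX; apply: (hX x) => //; rewrite !in_setU1 ?eqxx ?yC ?orbT.
have h2 : y \in X -> x \in X.
  by move=> yX; apply: (hX y); rewrite ?in_setU1 ?eqxx ?yC ?orbT // e_sym.
move=> u v; rewrite !inE => /predU1P[->|uC] /predU1P[->|vC] //.
- by move/h1; apply: hX'.
- by move=> uX; apply: h2; apply: (hX' u).
- exact: hX'.
Qed.

Lemma conn2 x y : e x y -> conn e [set x; y].
Proof. by move=> exy; apply: (@conn_add x y [set y] (@conn1 y)); rewrite ?inE. Qed.
End Conn.

(** * The position of two subtrees relative to each other *)

Section Walk.
Variables (V : finType) (e : rel V) (U : {set V}).
Hypothesis (e_sym : symmetric e) (sepU : sep e U set0).

(** The three branches at a node, none of them singled out as the one of the root. *)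
Definition tri (W1 S1 W2 S2 W3 S3 : {set V}) :=
  [/\ [/\ rep e W1 S1, rep e W2 S2 & rep e W3 S3],
      forall x, (x \in U) = [|| x \in W1, x \in W2 | x \in W3],
      forall x, x \in W1 -> x \in W2 -> (x \in S1) && (x \in S2),
      forall x, x \in W1 -> x \in W3 -> (x \in S1) && (x \in S3)
    & forall x, x \in W2 -> x \in W3 -> (x \in S2) && (x \in S3)].

Lemma tri_rot W1 S1 W2 S2 W3 S3 : tri W1 S1 W2 S2 W3 S3 -> tri W2 S2 W3 S3 W1 S1.
Proof.
case=> [[r1 r2 r3] eU h12 h13 h23]; split=> // x; first by rewrite eU orbC -orbA.
  by move=> x2 x1; rewrite andbC h12.
by move=> x3 x1; rewrite andbC h13.
Qed.

Lemma rep_tri W1 S1 W2 S2 W3 S3 : tri W1 S1 W2 S2 W3 S3 -> rep e U S3.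
Proof.
case=> [[r1 r2 r3] eU h12 h13 h23].
have W3U x : x \in W3 -> x \in U by rewrite eU => ->; rewrite !orbT.
apply: (rep_both sepU r3) => //.
apply: (RepNode r1 r2); first exact: rep_card r3.
- exact/sep_opp/W3U/rep_sep.
- move=> x; rewrite in_opp eU; have := h12 x; have := h13 x; have := h23 x; have := rep_sub r3 (x := x).
  by bcases; do ?[by move=> *; exfalso; auto].
- exact: h12.
- by move=> x xS x1; case/andP: (h13 _ x1 (rep_sub r3 xS)).
- by move=> x xS x2; case/andP: (h23 _ x2 (rep_sub r3 xS)).
Qed.

Definition edge_with a b := exists2 S : {set V}, (a \in S) && (b \in S) & rep e U S.
Definition edge_between a b := exists W1 W2 S : {set V}, [/\ rep e W1 S, rep e W2 S,
  forall x, (x \in U) = (x \in W1) || (x \in W2),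
  forall x, x \in W1 -> x \in W2 -> x \in S
  & [&& a \in W1, b \in W2, a \notin S & b \notin S]].
Definition node_with a b := exists W1 S1 W2 S2 W3 S3 : {set V}, tri W1 S1 W2 S2 W3 S3 /\
  (a \in S1 :|: S2 :|: S3) && (b \in S1 :|: S2 :|: S3).

Lemma edge_betweenC a b : edge_between a b -> edge_between b a.
Proof.
case=> W1 [W2 [S [r1 r2 eU h /and4P[h1 h2 h3 h4]]]]; exists W2, W1, S; split=> //.
- by move=> x; rewrite orbC.
- by move=> x x2 x1; apply: h.
- by rewrite h1 h2 h4.
Qed.

Lemma opp_cover (W S : {set V}) x : rep e W S -> (forall x, x \in W -> x \in U) ->
  (x \in U) = (x \in W) || (x \in opp U W S).
Proof.
move=> r WU; rewrite in_opp; have := WU x; have := rep_sub r (x := x).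
by bcases; do ?[by move=> *; exfalso; auto].
Qed.

(** Descend into a child as long as it contains both vertices. When neither child does, a vertex
    outside the bag of the current node lies strictly inside a child that misses the other vertex,
    so the tree edge of that child separates the two. *)
Lemma walk a b W S : rep e W S -> (forall x, x \in W -> x \in U) -> rep e (opp U W S) S ->
  a \in W -> b \in W -> [\/ edge_with a b, edge_between a b | node_with a b].
Proof.
elim=> {W S} [S hS WU r aS bS|W S W1 S1 W2 S2 r1 IH1 r2 IH2 hS hs eW h12 h1 h2 WU r aW bW].
  by apply: Or31; exists S; [rewrite aS|apply: (rep_both sepU (RepLeaf e hS) r WU)].
have W1U x : x \in W1 -> x \in U by move=> xW; apply: WU; rewrite eW xW.
have W2U x : x \in W2 -> x \in U by move=> xW; apply: WU; rewrite eW xW orbT.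
have r1' : rep e (opp U W1 S1) S1 by apply: (rep_opp e_sym sepU r1 r2 r WU).
have r2' : rep e (opp U W2 S2) S2.
  apply: (rep_opp e_sym sepU r2 r1 r WU) => // x; first by rewrite eW orbCA.
  by move=> x2 x1; rewrite andbC h12.
have between Wi Si x y : rep e Wi Si -> rep e (opp U Wi Si) Si -> (forall x, x \in Wi -> x \in U) ->
    y \in W -> x \in Wi -> x \notin Si -> y \notin Wi -> edge_between x y.
  move=> ri ri' WiU yW xi xSi yi; exists Wi, (opp U Wi Si), Si; split=> // [z|z zi|].
  - exact: opp_cover.
  - by rewrite in_opp zi orbF => /andP[].
  - rewrite xi xSi in_opp WU //= yi orbT /=; apply: contra yi; exact: rep_sub ri _.
case ab1: ((a \in W1) && (b \in W1)); first by case/andP: ab1 => a1 b1; apply: IH1.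
case ab2: ((a \in W2) && (b \in W2)); first by case/andP: ab2 => a1 b1; apply: IH2.
have inbag x y : x \in W -> y \in W -> (x \in W1) && (y \in W1) = false ->
    (x \in W2) && (y \in W2) = false -> edge_between x y \/ x \in S1 :|: S2 :|: S.
  move=> xW yW xy1 xy2; case xB: (x \in _); [by right|left].
  move: xB; rewrite !inE => /norP[/norP[n1 n2] n3].
  move: xW xy1 xy2; rewrite eW (negbTE n3) orbF => /orP[x1|x2].
    by rewrite x1 /= => y1 _; apply: (between W1 S1); rewrite ?y1.
  by rewrite x2 /= => _ y1; apply: (between W2 S2); rewrite ?y1.
have [|aB] := inbag a b aW bW ab1 ab2; first by move=> ?; apply: Or32.
have [|bB] := inbag b a bW aW (etrans (andbC _ _) ab1) (etrans (andbC _ _) ab2).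
  by move/edge_betweenC=> ?; apply: Or32.
apply: Or33; exists W1, S1, W2, S2, (opp U W S), S; split; last by rewrite aB.
split=> // x; rewrite ?in_opp.
- have := WU x; have := h1 x; have := h2 x; have := eW x; have := h12 x.
  by bcases; do ?[by move=> *; exfalso; auto].
- by move=> x1; rewrite eW x1 /= orbF => /andP[_ xS]; rewrite xS h1.
- by move=> x1; rewrite eW x1 /= orbT orbF => /andP[_ xS]; rewrite xS h2.
Qed.

Lemma rep_opp0 : rep e (opp U U set0) set0.
Proof.
have -> : opp U U set0 = set0 by apply/setP=> x; rewrite in_opp !inE /= andbN.
exact: rep_leaf0.
Qed.

Lemma walk_root a b : rep e U set0 -> a \in U -> b \in U ->
  [\/ edge_with a b, edge_between a b | node_with a b].
Proof. by move=> r aU bU; apply: (walk r) => //; apply: rep_opp0. Qed.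

(** Walking from [s] to itself finds a tree edge carrying [s]: the separated case is contradictory,
    and a node with [s] in its bag has such an edge. That edge becomes the root and is shrunk to
    [s]. *)
Lemma rep_vertex s : rep e U set0 -> s \in U -> rep e U [set s].
Proof.
move=> r sU.
have fin S : rep e U S -> s \in S -> rep e U [set s].
  move=> r' sS; apply: (rep_shrink r') => [x /set1P->//|u v uU _ vU].
  by apply: sepU; rewrite ?inE.
have [[S /andP[sS _] rS]|[W1 [W2 [S [_ _ _ h /and4P[s1 s2 /negP[]]]]]]|] := walk_root r sU sU.
- exact: fin sS.
- exact: h.
case=> W1 [S1 [W2 [S2 [W3 [S3 [T]]]]]]; rewrite andbb !inE -orbA => /or3P[] sS.
- by apply: fin sS; apply: rep_tri (tri_rot T).
- by apply: fin sS; apply: rep_tri (tri_rot (tri_rot T)).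
- by apply: fin sS; apply: rep_tri T.
Qed.
End Walk.

(** * Subdividing an edge twice *)

Section Merge.
Variables (V : finType) (e eA : rel V) (A : {set V}) (a b : V).
Hypothesis eA_sub : forall u v, eA u v -> [&& u \in A, v \in A & e u v].
Hypotheses (aA : a \in A) (bA : b \in A).

(** Branch sets of a minor on [A]: the sets [Qa] and [Qb] are merged into [a] and [b], and the
    remaining vertices outside [A] disappear. *)
Definition merge_set (Qa Qb : {set V}) v : {set V} :=
  if v == a then Qa else if v == b then Qb else if v \in A then [set v] else set0.

Section One.
Variables Qa Qb : {set V}.
Hypotheses (aQ : a \in Qa) (bQ : b \in Qb).
Hypotheses (cQa : conn e Qa) (cQb : conn e Qb).
Hypothesis QaA : forall x, x \in Qa -> (x == a) || (x \notin A).
Hypothesis QbA : forall x, x \in Qb -> (x == b) || (x \notin A).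
Hypothesis QaQb : forall x, x \in Qa -> x \notin Qb.

Lemma merge_rep W S : rep e W S ->
  rep eA (trace (merge_set Qa Qb) W) (trace (merge_set Qa Qb) S).
Proof.
have own x : x \in A -> x \in merge_set Qa Qb x.
  by rewrite /merge_set; do 2?[case: eqP => [-> //|_]]; move=> ->; rewrite inE.
apply: rep_push.
- move=> u v x; rewrite /merge_set.
  have nQ y z : y \in A -> y != a -> y != b -> z \in [set y] -> (z \notin Qa) && (z \notin Qb).
    move=> yA ya yb /set1P->; apply/andP; split; apply/negP.
      by move/QaA; rewrite (negbTE ya) yA.
    by move/QbA; rewrite (negbTE yb) yA.
  case: (u =P a) => [->|/eqP ua]; case: (v =P a) => [->|/eqP va] //; last 1 first.
  + case: (u =P b) => [->|/eqP ub]; case: (v =P b) => [->|/eqP vb] //.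
    * move=> xQ; case: ifP => [vA xv|]; last by rewrite inE.
      by case/andP: (nQ _ _ vA va vb xv) => _; rewrite xQ.
    * case: ifP => [uA xu|]; last by rewrite inE.
      by case/andP: (nQ _ _ uA ua ub xu) => _ /negP.
    * by case: ifP => _; case: ifP => _; rewrite ?inE // => /eqP-> /eqP->.
  + case: (v =P b) => [->|/eqP vb] xQ; first by rewrite (negbTE (QaQb xQ)).
    case: ifP => [vA xv|]; last by rewrite inE.
    by case/andP: (nQ _ _ vA va vb xv); rewrite xQ.
  + case: (u =P b) => [->|/eqP ub] xu xQ; first by have := QaQb xQ; rewrite xu.
    move: xu; case: ifP => [uA xu|]; last by rewrite inE.
    by case/andP: (nQ _ _ uA ua ub xu); rewrite xQ.
- move=> v; rewrite /merge_set; case: ifP => // _; case: ifP => // _.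
  by case: ifP => _; [apply: conn1|apply: conn0].
- move=> u v /eA_sub/and3P[uA vA euv]; exists u, v; split=> //; exact: own.
Qed.

Lemma in_merge W v : (v \in trace (merge_set Qa Qb) W) =
  if v == a then [exists x in Qa, x \in W] else
  if v == b then [exists x in Qb, x \in W] else (v \in A) && (v \in W).
Proof.
rewrite inE /merge_set; case: ifP => // _; case: ifP => // _.
case: ifP => vA /=; last by apply/negbTE/exists_inP => -[x]; rewrite inE.
by apply/exists_inP/idP => [[x /set1P->]|vW] //; exists v; rewrite ?inE.
Qed.

Lemma merge_root U S p q : rep e U S -> (forall x, x \in A -> x \in U) ->
  p \in Qa -> q \in Qb -> p \in S -> q \in S -> rep eA A [set a; b].
Proof.
move=> r AU pa qb pS qS; have := merge_rep r.
have SE : S = [set p; q].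
  apply/eqP; rewrite eq_sym eqEcard; apply/andP; split.
    by apply/subsetP=> x /set2P[]->.
  rewrite cards2; apply: leq_trans (rep_card r) _.
  by case: eqP => // pq; move: (QaQb pa); rewrite pq qb.
have -> : trace (merge_set Qa Qb) U = A.
  apply/setP=> v; rewrite in_merge; case: eqP => [->|_].
    by rewrite aA; apply/exists_inP; exists a; rewrite ?AU.
  case: eqP => [->|_]; first by rewrite bA; apply/exists_inP; exists b; rewrite ?AU.
  by case vA: (v \in A) => //=; apply: AU.
suff -> : trace (merge_set Qa Qb) S = [set a; b] by [].
apply/setP=> v; rewrite in_merge !inE; case: (v =P a) => [_|/eqP va] /=.
  by apply/exists_inP; exists p.
case: (v =P b) => [_|/eqP vb]; first by apply/exists_inP; exists q.
apply/negbTE/negP=> /andP[vA]; rewrite SE => /set2P[] vE.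
  by have := QaA pa; rewrite -vE (negbTE va) vA.
by have := QbA qb; rewrite -vE (negbTE vb) vA.
Qed.
End One.
End Merge.

Ltac tset n1 n2 :=
  first [by rewrite !inE ?eqxx ?orbT
        |by move=> z; rewrite !inE; do ?[case/orP]; move/eqP->; rewrite ?eqxx ?n1 ?n2 ?orbT].
Section TwoSubdivided.
Variables (V : finType) (e eA : rel V) (A : {set V}).
Hypothesis e_sym : symmetric e.
Hypothesis eA_sub : forall u v, eA u v -> [&& u \in A, v \in A & e u v].

Lemma sep_eA S : sep eA A S.
Proof. by move=> u v uA uS vA; apply/negP=> /eA_sub; rewrite (negbTE vA) andbF. Qed.

(* The tree edge carries c and at most one further vertex w; on the side of a
   the vertex c is renamed a, on the side of b the path c, d, b is renamed b,
   and the two sides meet at a new node with bag {a, b, w}. *)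
Lemma path_split a b c d (U W1 W2 S : {set V}) :
  a \in A -> b \in A -> a != b -> c \notin A -> d \notin A -> c != d ->
  (forall x, (x \in U) = [|| x \in A, x == c | x == d]) ->
  e a c -> e c d -> e d b ->
  rep e W1 S -> rep e W2 S ->
  (forall x, (x \in U) = (x \in W1) || (x \in W2)) ->
  (forall x, x \in W1 -> x \in W2 -> x \in S) ->
  a \in W1 -> b \in W2 -> a \notin S -> b \notin S -> c \in S -> d \notin S ->
  rep eA A [set a; b].
Proof.
move=> aA bA ab cA dA cd eU ac cd' db r1 r2 eU' h a1 b2 aS bS cS dS.
have neq x y : x \in A -> y \notin A -> x != y by move=> xA yA; apply: contraNneq yA => <-.
have b1 : b \notin W1 by apply: contra bS => b1; apply: h.
have a2 : a \notin W2 by apply: contra aS => a2; apply: h.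
have d2 : d \in W2.
  apply: contraT => d2; move: (rep_sep r2 b2 bS d2); by rewrite e_sym db.
have d1 : d \notin W1 by apply: contra dS => d1; apply: h.
have c1 := rep_sub r1 cS; have c2 := rep_sub r2 cS.
have m1 := @merge_rep V e eA A a b eA_sub [set a; c] [set b].
have m2 := @merge_rep V e eA A a b eA_sub [set a] [set b; d; c].
have {m1} m1 : rep eA (trace (merge_set A a b [set a; c] [set b]) W1)
                      (trace (merge_set A a b [set a; c] [set b]) S).
  apply: m1 => //; rewrite ?inE ?eqxx //; try by [apply: conn1|apply: conn2].
  - by move=> x /set2P[]->; rewrite ?eqxx ?cA ?orbT.
  - by move=> x /set1P->; rewrite eqxx.
  - by move=> x /set2P[]->; rewrite inE ?ab // eq_sym neq.
have {m2} m2 : rep eA (trace (merge_set A a b [set a] [set b; d; c]) W2)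
                      (trace (merge_set A a b [set a] [set b; d; c]) S).
  apply: m2 => //; rewrite ?inE ?eqxx //; try by apply: conn1.
  - rewrite setUC; apply: (@conn_add _ _ e_sym c d) => //; last by rewrite !inE eqxx orbT.
    by apply: conn2; rewrite // e_sym.
  - by move=> x /set1P->; rewrite eqxx.
  - by move=> x; rewrite !inE -orbA => /or3P[] /eqP->; rewrite ?eqxx ?cA ?dA ?orbT.
  - by move=> x /set1P->; rewrite !inE !negb_or ab !neq.
apply: (RepNode m1 m2); first by rewrite cards2 ab.
- exact: sep_eA.
- move=> x; rewrite !in_merge !inE.
  case: (x =P a) => [->|_]; first by rewrite aA /= !orbT.
  case: (x =P b) => [->|_]; first by rewrite bA /= !orbT.
  by rewrite !orbF -andb_orr -eU' eU; case: (x \in A).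
- move=> x; rewrite !in_merge.
  case: (x =P a) => [_ _ /exists_inP[y /set1P->]|_]; first by rewrite (negbTE a2).
  case: (x =P b) => [_ /exists_inP[y /set1P->]|_]; first by rewrite (negbTE b1).
  by case/andP=> -> x1 /= x2; rewrite h.
- move=> x /set2P[]->; rewrite !in_merge ?eqxx.
    by move=> _; apply/exists_inP; exists c; rewrite // !inE eqxx orbT.
  by rewrite eq_sym (negbTE ab) => /exists_inP[y /set1P->]; rewrite (negbTE b1).
- move=> x /set2P[]->; rewrite !in_merge ?eqxx.
    by case/exists_inP=> y /set1P->; rewrite (negbTE a2).
  rewrite eq_sym (negbTE ab) => _.
  by apply/exists_inP; exists c; rewrite // !inE eqxx orbT.
Qed.

Definition path_pattern (a b c d : V) := [&& e a c, e c d & e d b].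
Definition square_pattern (a b c d : V) := [&& e a c, e c b, e a d & e d b].

(* If two of a, b, c, d share a tree edge, uniting their subtrees suitably makes
   a and b share it.  If a tree edge separates a from b, use [path_split].
   Otherwise a, b, c, d would be pairwise edge-disjoint and all in the bag of one
   node, which has only three tree edges. *)
Lemma rep_two_subdivided a b c d (U : {set V}) :
  a \in A -> b \in A -> a != b -> c \notin A -> d \notin A -> c != d ->
  (forall x, (x \in U) = [|| x \in A, x == c | x == d]) -> sep e U set0 ->
  path_pattern a b c d || square_pattern a b c d ->
  rep e U set0 -> rep eA A [set a; b].
Proof.
move=> aA bA ab cA dA cd eU sepU pat r.
have neq x y : x \in A -> y \notin A -> x != y by move=> xA yA; apply: contraNneq yA => <-.
have ac := neq _ _ aA cA; have ad := neq _ _ aA dA.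
have bc := neq _ _ bA cA; have bd := neq _ _ bA dA.
have AU x : x \in A -> x \in U by rewrite eU => ->.
pose Q := [set a; b; c; d].
have nE := (negbTE ab, negbTE ac, negbTE ad, negbTE bc, negbTE bd, negbTE cd).
have nE' : ((b == a) = false) * ((c == a) = false) * ((d == a) = false) *
           ((c == b) = false) * ((d == b) = false) * ((d == c) = false).
  by do !split; rewrite eq_sym nE.
have two S : rep e U S -> 1 < #|S :&: Q| -> rep eA A [set a; b].
  move=> rS /card_gt1P[p [q [/setIP[pS pQ] /setIP[qS qQ] pq]]].
  have main (Qa Qb : {set V}) x y : conn e Qa -> conn e Qb ->
      x \in S -> y \in S -> x \in Qa -> y \in Qb -> a \in Qa -> b \in Qb ->
      (forall z, z \in Qa -> [|| z == a, z == c | z == d]) ->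
      (forall z, z \in Qb -> [|| z == b, z == c | z == d]) ->
      (forall z, z \in Qa -> z \notin Qb) -> rep eA A [set a; b].
    move=> ca cb xS yS xa yb aQ bQ sa sb dab.
    apply: (merge_root eA_sub aA bA aQ bQ ca cb _ _ dab rS AU xa yb xS yS) => z.
    - by move/sa => /or3P[]/eqP->; rewrite ?eqxx ?cA ?dA ?orbT.
    - by move/sb => /or3P[]/eqP->; rewrite ?eqxx ?cA ?dA ?orbT.
  have [c1a c1b] : conn e [set a] /\ conn e [set b] by split; apply: conn1.
  have pab : a \in S -> b \in S -> rep eA A [set a; b].
    by move=> aS bS; apply: (main [set a] [set b] a b) => //; tset nE nE'.
  have pac : a \in S -> c \in S -> rep eA A [set a; b].
    move=> aS cS; case/orP: pat => [/and3P[h1 h2 h3]|/and4P[h1 h2 h3 h4]].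
      apply: (main [set a] (c |: [set d; b]) a c) => //; try tset nE nE'.
      by apply: (@conn_add _ _ e_sym c d) => //; [apply: conn2|tset nE nE'].
    by apply: (main [set a] [set c; b] a c) => //; try tset nE nE'; apply: conn2.
  have pad : a \in S -> d \in S -> rep eA A [set a; b].
    have edb : e d b by case/orP: pat => [/and3P[]|/and4P[]].
    by move=> aS dS; apply: (main [set a] [set d; b] a d) => //; try tset nE nE'; apply: conn2.
  have pbc : b \in S -> c \in S -> rep eA A [set a; b].
    have eac : e a c by case/orP: pat => [/and3P[]|/and4P[]].
    by move=> bS cS; apply: (main [set a; c] [set b] c b) => //; try tset nE nE'; apply: conn2.
  have pbd : b \in S -> d \in S -> rep eA A [set a; b].
    move=> bS dS; case/orP: pat => [/and3P[h1 h2 h3]|/and4P[h1 h2 h3 h4]].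
      apply: (main (a |: [set c; d]) [set b] d b) => //; try tset nE nE'.
      by apply: (@conn_add _ _ e_sym a c) => //; [apply: conn2|tset nE nE'].
    by apply: (main [set a; d] [set b] d b) => //; try tset nE nE'; apply: conn2.
  have pcd : c \in S -> d \in S -> rep eA A [set a; b].
    have eac : e a c by case/orP: pat => [/and3P[]|/and4P[]].
    have edb : e d b by case/orP: pat => [/and3P[]|/and4P[]].
    by move=> cS dS; apply: (main [set a; c] [set d; b] c d) => //; try tset nE nE'; apply: conn2.
  move: pQ qQ pq pS qS; rewrite !inE -!orbA.
  by do 2![case/or4P=> /eqP->]; rewrite ?eqxx //; auto.
have [[S /andP[aS bS] rS]|[W1 [W2 [S [r1 r2 eU' h]]]]|] :=
  walk_root e_sym sepU r (AU a aA) (AU b bA).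
- apply: (two S rS); apply/card_gt1P; exists a, b; split=> //; by rewrite !inE ?aS ?bS eqxx ?orbT.
- case/and4P=> a1 b2 aS bS.
  have rS : rep e U S by apply: (rep_edge r1 r2).
  have twocd : c \in S -> d \in S -> rep eA A [set a; b].
    move=> cS dS; apply: (two S rS); apply/card_gt1P; exists c, d.
    by split=> //; rewrite !inE ?cS ?dS eqxx ?orbT.
  have next1 x y : x \in W1 -> x \notin S -> e x y -> y \in W1.
    by move=> x1 xS exy; apply: contraT => /(rep_sep r1 x1 xS); rewrite exy.
  have next2 x y : x \in W2 -> x \notin S -> e x y -> y \in W2.
    by move=> x1 xS exy; apply: contraT => /(rep_sep r2 x1 xS); rewrite exy.
  have b1 : b \notin W1 by apply: contra bS => b1; apply: h.
  (* In the square, [c] and [d] are both adjacent to [a] and to [b], hence on both sides of the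
     separating tree edge and therefore on it. *)
  case/orP: pat => [/and3P[h1 h2 h3]|/and4P[h1 h2 h3 h4]]; last first.
    apply: twocd; apply: h.
    + exact: next1 h1.
    + by apply: next2 b2 bS _; rewrite e_sym.
    + exact: next1 h3.
    + by apply: next2 b2 bS _; rewrite e_sym.
  case cS: (c \in S); case dS: (d \in S).
  + exact: twocd.
  + by apply: (path_split aA bA ab cA dA cd eU h1 h2 h3 r1 r2); rewrite ?dS.
  + rewrite setUC; rewrite eq_sym in ab; rewrite eq_sym in cd.
    apply: (path_split (U := U) bA aA ab dA cA cd _ _ _ _ r2 r1); rewrite ?cS //; try by rewrite e_sym.
    * by move=> x; rewrite eU; congr (_ || _); rewrite orbC.
    * by move=> x; rewrite eU' orbC.
    * by move=> x x2 x1; apply: h.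
  + case/negP: b1; apply: (next1 d); rewrite ?dS //; apply: (next1 c); rewrite ?cS //.
    exact: next1 h1.
case=> W1 [S1 [W2 [S2 [W3 [S3 [T /andP[aB bB]]]]]]].
have R1 := rep_tri e_sym sepU (tri_rot T).
have R2 := rep_tri e_sym sepU (tri_rot (tri_rot T)).
have R3 := rep_tri e_sym sepU T.
case: (ltnP 1 #|S1 :&: Q|) => [/(two _ R1)//|n1].
case: (ltnP 1 #|S2 :&: Q|) => [/(two _ R2)//|n2].
case: (ltnP 1 #|S3 :&: Q|) => [/(two _ R3)//|n3].
case: T => [[r1 r2 r3] eU' h12 h13 h23].
have pairQ (S : {set V}) x y : #|S :&: Q| <= 1 -> x \in Q -> y \in Q -> x != y ->
    x \in S -> y \in S -> False.
  move=> n xQ yQ xy xS yS; have : 1 < #|S :&: Q|.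
    by apply/card_gt1P; exists x, y; rewrite !in_setI xS yS xQ yQ.
  by rewrite ltnNge n.
have inB i x : x \in nth set0 [:: W1; W2; W3] i -> x \in S1 :|: S2 :|: S3 ->
    x \in nth set0 [:: S1; S2; S3] i.
  case: i => [|[|[|[|i]]]] /=; rewrite ?inE //.
  - move=> xi /orP[/orP[//|/(rep_sub r2) xj]|/(rep_sub r3) xj].
      by case/andP: (h12 _ xi xj).
    by case/andP: (h13 _ xi xj).
  - move=> xi /orP[/orP[/(rep_sub r1) xj|//]|/(rep_sub r3) xj].
      by case/andP: (h12 _ xj xi).
    by case/andP: (h23 _ xi xj).
  - move=> xi /orP[/orP[/(rep_sub r1) xj|/(rep_sub r2) xj]|//].
      by case/andP: (h13 _ xj xi).
    by case/andP: (h23 _ xj xi).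
have inW x : x \in U -> exists2 i, i < 3 & x \in nth set0 [:: W1; W2; W3] i.
  by rewrite eU' => /or3P[] xi; [exists 0|exists 1|exists 2].
have step i x y : i < 3 -> x \in nth set0 [:: W1; W2; W3] i ->
    x \notin S1 :|: S2 :|: S3 -> e x y -> y \in nth set0 [:: W1; W2; W3] i.
  move=> i3 xi; rewrite !inE => /norP[/norP[x1 x2] x3] exy; apply: contraT => yi.
  case: i i3 xi yi => [|[|[|//]]] _ /= xi yi.
  - by move: (rep_sep r1 xi x1 yi); rewrite exy.
  - by move: (rep_sep r2 xi x2 yi); rewrite exy.
  - by move: (rep_sep r3 xi x3 yi); rewrite exy.
have pairB i x y : i < 3 -> x \in Q -> y \in Q -> x != y ->
    x \in nth set0 [:: S1; S2; S3] i -> y \in nth set0 [:: S1; S2; S3] i -> False.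
  by case: i => [|[|[|//]]] _ /=; apply: pairQ.
have [aQ bQ cQ dQ] : [/\ a \in Q, b \in Q, c \in Q & d \in Q] by rewrite !inE !eqxx !orbT.
have cU : c \in U by rewrite eU eqxx orbT.
have dU : d \in U by rewrite eU eqxx !orbT.
(* A vertex outside the bag lies strictly inside one branch and drags its neighbours there. Those of
   them that are in the bag lie on the tree edge of the branch, so two of the four vertices would
   share it. *)
have [cB dB] : c \in S1 :|: S2 :|: S3 /\ d \in S1 :|: S2 :|: S3.
  case/orP: pat => [/and3P[h1 h2 h3]|/and4P[h1 h2 h3 h4]].
    case cB: (c \in _); case dB: (d \in _) => //; exfalso.
    + have [i i3 di] := inW d dU.
      have bi : b \in nth set0 [:: W1; W2; W3] i by apply: step h3; rewrite ?dB.
      have ci : c \in nth set0 [:: W1; W2; W3] i by apply: step i3 di _ _; rewrite ?dB // e_sym.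
      by apply: (pairB i b c) => //; apply: inB.
    + have [i i3 ci] := inW c cU.
      have ai : a \in nth set0 [:: W1; W2; W3] i by apply: step i3 ci _ _; rewrite ?cB // e_sym.
      have di : d \in nth set0 [:: W1; W2; W3] i by apply: step h2; rewrite ?cB.
      by apply: (pairB i a d) => //; apply: inB.
    + have [i i3 ci] := inW c cU.
      have ai : a \in nth set0 [:: W1; W2; W3] i by apply: step i3 ci _ _; rewrite ?cB // e_sym.
      have di : d \in nth set0 [:: W1; W2; W3] i by apply: step h2; rewrite ?cB.
      have bi : b \in nth set0 [:: W1; W2; W3] i by apply: step h3; rewrite ?dB.
      by apply: (pairB i a b) => //; apply: inB.
  have both x : x \in U -> e a x -> e x b -> x \in S1 :|: S2 :|: S3.
    move=> xU ax xb; apply: contraT => xB; exfalso; have [i i3 xi] := inW x xU.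
    have ai : a \in nth set0 [:: W1; W2; W3] i by apply: step i3 xi xB _; rewrite e_sym.
    have bi : b \in nth set0 [:: W1; W2; W3] i by apply: step xb.
    by apply: (pairB i a b) => //; apply: inB.
  by split; apply: both.
have : Q \subset (S1 :&: Q) :|: (S2 :&: Q) :|: (S3 :&: Q).
  by rewrite -!setIUl subsetI subxx andbT; apply/subsetP=> x; rewrite !in_setU -!orbA !in_set1 => /or4P[]/eqP->; rewrite ?orbA -!in_setU.
move/subset_leq_card; have -> : #|Q| = 4.
  by rewrite /Q setUC cardsU1 setUC cardsU1 cards2 !inE !nE !nE'.
move=> H; have := leq_trans H (leq_trans (leq_card_setU _ _).1
  (leq_add (leq_trans (leq_card_setU _ _).1 (leq_add n1 n2)) n3)).
by [].
Qed.


End TwoSubdivided.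


Lemma sep_setT (V : finType) (e : rel V) (S : {set V}) : sep e setT S.
Proof. by move=> u v _ _; rewrite inE. Qed.

(** * Adding the third edge of a triangle at a vertex of degree 2 *)

Section Triangle.
Variables (V : finType) (e e' : rel V) (a b c : V).
Hypotheses (e_sym : symmetric e) (e'_sym : symmetric e').
Hypotheses (ab : a != b) (ca : c != a) (cb : c != b) (ac : e a c) (bc : e c b).
Hypothesis c_nbr : forall v, e c v -> (v == a) || (v == b).
Hypothesis e'_sub : forall u v, e' u v ->
  [|| e u v, (u == a) && (v == b) | (u == b) && (v == a)].

(** A part in which [a] and [b] occur at most on its root edge does not notice the new edge. *)
Lemma rep_add_edge W S : rep e W S -> (a \in W -> a \in S) -> (b \in W -> b \in S) -> rep e' W S.
Proof.
move=> r aS bS; apply: (rep_mono r) => u v uW uS /e'_sub/or3P[//|/andP[/eqP ue _]|/andP[/eqP ue _]].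
  by rewrite ue aS -?ue in uS.
by rewrite ue bS -?ue in uS.
Qed.

(** If [a] and [b] share a tree edge or a node, the edge [ab] costs nothing. A tree edge separating
    them must carry their common neighbour [c]; renaming [c] to [a] on one side and to [b] on the
    other makes the two meet at a new node. *)
Lemma rep_triangle : rep e setT set0 -> rep e' setT set0.
Proof.
move=> r.
have fin S : rep e' setT S -> rep e' setT set0.
  by move=> rS; apply: (rep_shrink rS) (@sep_setT _ _ _) => x; rewrite inE.
have [[S /andP[aS bS] rS]|[W1 [W2 [S [r1 r2 eU h /and4P[a1 b2 aS bS]]]]]|] :=
  walk_root e_sym (@sep_setT _ _ _) r (in_setT a) (in_setT b).
- by apply: (fin S); apply: rep_add_edge.
- have b1 : b \notin W1 by apply: contra bS => b1; apply: h.
  have a2 : a \notin W2 by apply: contra aS => a2; apply: h.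
  have c1 : c \in W1 by apply: contraT => /(rep_sep r1 a1 aS); rewrite ac.
  have c2 : c \in W2 by apply: contraT => /(rep_sep r2 b2 bS); rewrite e_sym bc.
  have cS := h _ c1 c2.
  pose A := [set~ c]; pose eA u v := [&& u \in A, v \in A & e u v].
  have eA_sub u v : eA u v -> [&& u \in A, v \in A & e u v] by [].
  have ac' : a != c by rewrite eq_sym.
  have bc' : b != c by rewrite eq_sym.
  have m1 : rep eA (trace (merge_set A a b [set a; c] [set b]) W1)
                   (trace (merge_set A a b [set a; c] [set b]) S).
    apply: (merge_rep eA_sub) r1; rewrite ?inE ?eqxx //; try by [apply: conn1|apply: conn2].
    - by move=> x; rewrite !inE => /orP[]/eqP->; rewrite eqxx ?orbT.
    - by move=> x /set1P->; rewrite eqxx.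
    - by move=> x /set2P[]->; rewrite inE.
  have m2 : rep eA (trace (merge_set A a b [set a] [set b; c]) W2)
                   (trace (merge_set A a b [set a] [set b; c]) S).
    apply: (merge_rep eA_sub) r2; rewrite ?inE ?eqxx //; try by [apply: conn1|apply: conn2; rewrite // e_sym].
    - by move=> x /set1P->; rewrite eqxx.
    - by move=> x; rewrite !inE => /orP[]/eqP->; rewrite eqxx ?orbT.
    - by move=> x /set1P->; rewrite !inE negb_or ab.
  have T1 : trace (merge_set A a b [set a; c] [set b]) W1 = W1 :\ c.
    apply/setP=> x; rewrite in_merge !inE; case: (x =P a) => [->|_].
      by rewrite a1 ac'; apply/exists_inP; exists a; rewrite // !inE eqxx.
    case: (x =P b) => [->|//]; rewrite (negbTE b1) andbF.
    by apply/negbTE/exists_inP => -[y /set1P->]; rewrite (negbTE b1).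
  have T2 : trace (merge_set A a b [set a] [set b; c]) W2 = W2 :\ c.
    apply/setP=> x; rewrite in_merge !inE; case: (x =P a) => [->|_].
      rewrite (negbTE a2) andbF.
      by apply/negbTE/exists_inP => -[y /set1P->]; rewrite (negbTE a2).
    case: (x =P b) => [->|//].
    by rewrite b2 bc'; apply/exists_inP; exists b; rewrite // !inE eqxx.
  have S1 : trace (merge_set A a b [set a; c] [set b]) S = a |: (S :\ c).
    apply/setP=> x; rewrite in_merge !inE; case: (x =P a) => [->|_] /=.
      by apply/exists_inP; exists c; rewrite // !inE eqxx orbT.
    case: (x =P b) => [->|//]; rewrite (negbTE bS) andbF.
    by apply/negbTE/exists_inP => -[y /set1P->]; rewrite (negbTE bS).
  have S2 : trace (merge_set A a b [set a] [set b; c]) S = b |: (S :\ c).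
    apply/setP=> x; rewrite in_merge !inE; case: (x =P a) => [->|_] /=.
      rewrite (negbTE aS) (negbTE ab) andbF.
      by apply/negbTE/exists_inP => -[y /set1P->]; rewrite (negbTE aS).
    case: (x =P b) => [_|//] /=.
    by apply/exists_inP; exists c; rewrite // !inE eqxx orbT.
  have keep W S' : rep eA W S' -> c \notin W -> (a \in W -> a \in S') -> (b \in W -> b \in S') -> rep e' W S'.
    move=> r' cW aS' bS'; apply: (rep_mono r') => u v uW uS.
    have ua : u != a by apply: contraNneq uS => ue; rewrite ue aS' // -ue.
    have ub : u != b by apply: contraNneq uS => ue; rewrite ue bS' // -ue.
    have uc : u != c by apply: contraNneq cW => <-.
    move/e'_sub; rewrite (negbTE ua) (negbTE ub) !orbF => euv.
    rewrite /eA euv !inE uc /= andbT; apply: contraTneq euv => ->.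
    by apply/negP; rewrite e_sym => /c_nbr; rewrite (negbTE ua) (negbTE ub).
  rewrite T1 S1 in m1; rewrite T2 S2 in m2.
  have {}m1 : rep e' (W1 :\ c) (a |: S :\ c) by apply: keep m1 _ _ _; rewrite ?inE ?eqxx // (negbTE b1) andbF.
  have {}m2 : rep e' (W2 :\ c) (b |: S :\ c) by apply: keep m2 _ _ _; rewrite ?inE ?eqxx // (negbTE a2) andbF.
  (* The third branch of the new node brings [c] back; it meets [a] and [b] in the bag, and it has
     no other neighbours. *)
  have m3 : rep e' [set c] [set c] by apply: RepLeaf; rewrite cards1.
  apply: (fin [set c]); apply: (@rep_tri _ _ _ e'_sym (@sep_setT _ _ _) _ _ _ _ _ _ (And5 (And3 m1 m2 m3) _ _ _ _)) => x; rewrite !inE.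
  - by have := eU x; rewrite inE; case: (x == c); rewrite ?orbT ?orbF.
  - by case/andP=> xc x1 /andP[_ x2]; rewrite xc h ?orbT.
  - by case/andP=> /negbTE->.
  - by case/andP=> /negbTE->.
case=> W1 [S1 [W2 [S2 [W3 [S3 [[[r1 r2 r3] eU h12 h13 h23] /andP[aB bB]]]]]]].
have inB x : x \in S1 :|: S2 :|: S3 -> [/\ x \in W1 -> x \in S1, x \in W2 -> x \in S2 & x \in W3 -> x \in S3].
  rewrite !inE => /orP[/orP[]|] xS; split=> // xi.
  - by case/andP: (h12 _ (rep_sub r1 xS) xi).
  - by case/andP: (h13 _ (rep_sub r1 xS) xi).
  - by case/andP: (h12 _ xi (rep_sub r2 xS)).
  - by case/andP: (h23 _ (rep_sub r2 xS) xi).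
  - by case/andP: (h13 _ xi (rep_sub r3 xS)).
  - by case/andP: (h23 _ xi (rep_sub r3 xS)).
have [[aS1 aS2 aS3] [bS1 bS2 bS3]] := (inB a aB, inB b bB).
apply: (fin S3); apply: (@rep_tri _ _ _ e'_sym (@sep_setT _ _ _) W1 S1 W2 S2 W3).
by split=> //; split; apply: rep_add_edge.
Qed.
End Triangle.

(** * Clusterings and minimum covers *)

Section Clustering.
Variable V : finType.
Implicit Types (e : rel V) (Z S C D W : {set V}).

(** [P] is not imposed on singletons; for [cover2] they satisfy it anyway, each being a cover of its
    own cut. *)
Inductive cluster (P : {set V} -> Prop) : {set V} -> Prop :=
| ClusterLeaf v : cluster P [set v]
| ClusterNode Z1 Z2 : cluster P Z1 -> cluster P Z2 -> [disjoint Z1 & Z2] ->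
    P (Z1 :|: Z2) -> cluster P (Z1 :|: Z2).

Definition covers e S Z := forall u v, u \in Z -> v \notin Z -> e u v -> (u \in S) || (v \in S).
Definition cover2 e Z := exists2 S : {set V}, #|S| <= 2 & covers e S Z.

(** A caterpillar: one vertex is split off at a time. *)
Lemma cluster_all Z : Z != set0 -> cluster (fun _ => True) Z.
Proof.
elim: {Z}_.+1 {-2}Z (ltnSn #|Z|) => // n IH Z leZ /set0Pn[v vZ].
case: (eqVneq (Z :\ v) set0) => [Z0|Zn0].
  by rewrite -(setD1K vZ) Z0 setU0; apply: ClusterLeaf.
rewrite -(setD1K vZ); apply: ClusterNode => //; first exact: ClusterLeaf.
  by apply: IH => //; move: leZ; rewrite (cardsD1 v) vZ.
by rewrite disjoints1 !inE eqxx.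
Qed.

Lemma covers_between e W S Z : sep e W S -> (forall x, x \in W -> x \notin S -> x \in Z) ->
  (forall x, x \in Z -> x \in W) -> covers e S Z.
Proof.
move=> hs lo hi u v uZ vZ euv; case uS: (u \in S) => //=; apply: contraT => vS.
have vW : v \notin W by apply: contra vZ => vW; apply: lo.
by move: (hs u v (hi _ uZ) (negbT uS) vW); rewrite euv.
Qed.


(** The subtrees of [S] lie on both sides of the root edge, and it is left open which vertices of
    [S] count as members of [Z]. In the induction this freedom assigns every vertex shared by the
    children to just one of them, while [S] covers the cut in every case. *)
Lemma rep_cluster e W S : rep e W S -> forall Z, Z != set0 ->
  (forall x, x \in W -> x \notin S -> x \in Z) -> (forall x, x \in Z -> x \in W) ->
  cluster (cover2 e) Z.
Proof.
(* The vertices of [X] are attached one by one, which is allowed when all intermediate sets satisfy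
   [P]. *)
have add (P : {set V} -> Prop) n : forall (X Z : {set V}), #|X| <= n -> Z = set0 \/ cluster P Z ->
    (forall Y : {set V}, Z \subset Y -> Y \subset Z :|: X -> P Y) -> [disjoint Z & X] ->
    Z :|: X != set0 -> cluster P (Z :|: X).
  elim: n => [|n IH] X Z cX hZ hP dZX.
    move: cX; rewrite leqn0 cards_eq0 => /eqP->; rewrite setU0 => /eqP Zn.
    by case: hZ.
  case: (eqVneq X set0) => [->|]; first by rewrite setU0 => /eqP Zn; case: hZ.
  case/set0Pn=> x xX _.
  have xZ : x \notin Z by rewrite (disjointFl dZX xX).
  have E : Z :|: X = (x |: Z) :|: (X :\ x) by apply/setP=> y; rewrite !inE; case: (y =P x) => [->|_]; rewrite ?xX ?orbT.
  rewrite E; apply: IH.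
  - by move: cX; rewrite (cardsD1 x) xX.
  - right; case: hZ => [->|cZ]; first by rewrite setU0; apply: ClusterLeaf.
    apply: ClusterNode => //; [exact: ClusterLeaf|by rewrite disjoints1|].
    by apply: hP; [apply: subsetUr|rewrite E subsetUl].
  - move=> Y h1 h2; apply: hP; first by apply: subset_trans h1; apply: subsetUr.
    by rewrite E.
  - rewrite disjoint_sym; apply/pred0P=> y /=; rewrite !inE; case: eqP => //= _.
    by case yX: (y \in X) => //=; rewrite (disjointFl dZX yX).
  - by apply/set0Pn; exists x; rewrite !inE eqxx.
elim=> {W S} [S hS Z Zn _ ZS|W S W1 S1 W2 S2 r1 IH1 r2 IH2 hS hs eW h12 h1 h2 Z Zn lo hi].
  rewrite -(set0U Z); apply: (add _ #|Z|) => //; rewrite ?set0U ?disjoint0 //; first by left.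
  - move=> Y _ YZ; exists Y; last by move=> u v ->.
    apply: leq_trans hS; apply: subset_leq_card; apply: subset_trans YZ _; exact/subsetP.
  - by apply/pred0P=> x /=; rewrite inE.
(* Vertices in both children go to the first. Those in neither child belong to [S] and are attached
   last as single leaves. *)
pose Z1 := Z :&: W1; pose Z2 := (Z :&: W2) :\: W1; pose Z3 := Z :\: (W1 :|: W2).
have P (Y : {set V}) : (Z1 :|: Z2) \subset Y -> Y \subset Z -> cover2 e Y.
  move=> /subsetP h /subsetP YZ; exists S => //; apply: (covers_between hs) => x; last by move/YZ/hi.
  move=> xW xS; apply: h; rewrite !inE lo //=.
  by move: xW; rewrite eW (negbTE xS) orbF; case: (x \in W1).
have E : Z = (Z1 :|: Z2) :|: Z3.
  by apply/setP=> x; rewrite !inE; case: (x \in Z) => //=; case: (x \in W1) => //=; case: (x \in W2).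
rewrite E; apply: (add _ #|Z3|) => //; last by rewrite -E.
- have c1 : Z1 = set0 \/ cluster (cover2 e) Z1.
    case: (eqVneq Z1 set0) => [|n1]; [by left|right]; apply: IH1 => // x; rewrite !inE; last by case/andP.
    move=> x1 xS; rewrite x1 andbT; apply: lo; first by rewrite eW x1.
    by apply: contra xS => xS; apply: h1.
  have c2 : Z2 = set0 \/ cluster (cover2 e) Z2.
    case: (eqVneq Z2 set0) => [|n2]; [by left|right]; apply: IH2 => // x; rewrite !inE; last by case/and3P.
    move=> x2 xS; rewrite x2 andbT; apply/andP; split.
      by apply: contra xS => x1; case/andP: (h12 _ x1 x2).
    apply: lo; first by rewrite eW x2 orbT.
    by apply: contra xS => xS; apply: h2.
  case: c1 => [->|c1]; first by rewrite set0U.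
  case: c2 => [->|c2]; first by rewrite setU0; right.
  right; apply: ClusterNode => //; last by apply: P => //; rewrite E subsetUl.
  apply/pred0P=> x /=; rewrite !inE; case: (x \in W1); rewrite ?andbF //.
- by move=> Y h1' h2'; apply: P => //; rewrite E.
- apply/pred0P=> x /=; rewrite !inE; case: (x \in W1); rewrite ?andbF //=.
  by case: (x \in W2); rewrite ?andbF.
Qed.

(* Among the minimum covers of the cut around Z, a heavy one has as few vertices
   outside Z as possible; by uncrossing, heavy covers make the set of tree edges
   whose cover contains a given vertex connected. *)
Definition min_cover e Z S := covers e S Z /\ forall S', covers e S' Z -> #|S| <= #|S'|.
Definition heavy e Z S := min_cover e Z S /\
  forall S', covers e S' Z -> #|S'| = #|S| -> #|S :\: Z| <= #|S' :\: Z|.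

Lemma covers_self e Z : covers e Z Z.
Proof. by move=> u v ->. Qed.

Definition coversb e S Z := [forall u in Z, forall v in ~: Z, e u v ==> (u \in S) || (v \in S)].

Lemma coversP e S Z : reflect (covers e S Z) (coversb e S Z).
Proof.
apply: (iffP forall_inP) => [h u v uZ vZ euv|h u uZ].
  by have /forall_inP/(_ v) := h u uZ; rewrite inE euv; apply.
by apply/forall_inP=> v; rewrite inE => vZ; apply/implyP; apply: h.
Qed.

Lemma heavy_exists e Z : exists S, heavy e Z S.
Proof.
have h0 : coversb e Z Z by apply/coversP/covers_self.
(* The weight orders the two sizes lexicographically, as the second is at most [#|V|]. *)
have [S /coversP cS minS] := @arg_minnP _ Z (fun S => coversb e S Z) (fun S => #|S| * #|V|.+1 + #|S :\: Z|) h0.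
exists S; split; first split=> // S' cS'.
  have h1 : #|S' :\: Z| <= #|V| by apply: max_card.
  have /coversP/minS /= h2 := cS'; rewrite leqNgt; apply/negP=> h3.
  have : #|S'|.+1 * #|V|.+1 <= #|S| * #|V|.+1 by rewrite leq_mul2r h3 orbT.
  move/leq_trans/(_ (leq_addr _ _))/leq_trans/(_ h2).
  by rewrite mulSn addnC leq_add2l ltnNge h1.
by move=> S' /coversP/minS h E; move: h; rewrite E leq_add2l.
Qed.

(** [C'] covers the cut of [Z1], [D'] covers that of [Z], and together they have the size of [C] and
    [D]; by minimality [C'] is again a minimum cover. Outside [Z1] it is contained in [C], so
    heaviness forces equality there, and then counting forces it inside [Z1]. *)
Lemma uncross e Z1 Z C D : symmetric e -> Z1 \subset Z -> heavy e Z1 C -> min_cover e Z D ->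
  (forall x, x \in D -> x \in Z1 -> x \in C) /\ (forall x, x \in C -> x \notin Z -> x \in D).
Proof.
move=> e_sym /subsetP Z1Z [[cC minC] hC] [cD minD].
pose C' := (C :&: D) :|: (C :&: Z) :|: (D :&: Z1).
pose D' := (C :&: D) :|: (D :\: Z1) :|: (C :\: Z).
have cC' : covers e C' Z1.
  move=> u v u1 v1 euv; have := cC u v u1 v1 euv; have := cD u v (Z1Z _ u1).
  rewrite !inE u1 (negbTE v1) (Z1Z _ u1) euv; case vZ: (v \in Z) => /=; bcases; by move=> h; apply: h.
have cD' : covers e D' Z.
  move=> u v uZ vZ euv; have := cD u v uZ vZ euv.
  have v1 : v \notin Z1 by apply: contra vZ; apply: Z1Z.
  have := cC u v; rewrite !inE v1 uZ (negbTE vZ) euv; case u1: (u \in Z1) => /=; bcases; by move=> h; apply: h.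
have sum : #|C'| + #|D'| = #|C| + #|D|.
  rewrite -!sum1_card !(big_mkcond (fun x => x \in _)) -!big_split /=.
  apply: eq_bigr => x _; rewrite !inE; have := Z1Z x.
  case: (x \in Z1); case: (x \in Z); case: (x \in C); case: (x \in D) => //=; by move/(_ isT).
have eC : #|C'| = #|C|.
  by apply/eqP; rewrite eqn_leq minC // andbT -(leq_add2r #|D'|) sum leq_add2l minD.
have eDiff : C :\: Z1 = C' :\: Z1.
  apply/esym/eqP; rewrite eqEcard hC // andbT; apply/subsetP=> x; rewrite !inE.
  by case: (x \in Z1) => //=; bcases.
have eInt : C :&: Z1 = C' :&: Z1.
  apply/eqP; rewrite eqEcard; apply/andP; split.
    apply/subsetP=> x; rewrite !inE => /andP[-> x1]; by rewrite x1 (Z1Z _ x1) /= orbT.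
  by rewrite -(leq_add2r #|C :\: Z1|) {1}eDiff !cardsID eC.
split=> x.
  by move=> xD x1; have /setP/(_ x) := eInt; rewrite !inE x1 xD /= !orbT !andbT.
move=> xC xZ; have x1 : x \notin Z1 by apply: contra xZ; apply: Z1Z.
by have /setP/(_ x) := eDiff; rewrite !inE x1 xC (negbTE xZ) (negbTE x1) /= !orbF andbF orbF.
Qed.

Lemma covers_setC e S Z : symmetric e -> covers e S (~: Z) -> covers e S Z.
Proof.
by move=> e_sym h u v uZ vZ euv; rewrite orbC; apply: h; rewrite ?inE ?uZ // e_sym.
Qed.

(** Each cluster receives a heavy cover as its tree edge. The inclusions required at a node come
    from [uncross], applied to each child and its parent, and to each child and the complement of
    the other child, whose cut is the same as that of the other child. *)
Lemma cluster_rep e Z S : symmetric e -> cluster (cover2 e) Z -> heavy e Z S ->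
  rep e (Z :|: S) S.
Proof.
move=> e_sym cZ; elim: cZ S => {Z} [v|Z1 Z2 c1 IH1 c2 IH2 d12 [K cK KZ]] S hS.
  have [[cS minS] hS'] := hS.
  have S1 := minS _ (@covers_self e [set v]); rewrite cards1 in S1.
  case vS: (v \in S).
    by have -> : [set v] :|: S = S; [apply/setUidPr; rewrite sub1set|apply: RepLeaf; apply: leq_trans S1 _].
  (* A cover by one vertex other than [v] is not heavy, because [[set v]] covers the cut with no
     vertex outside. *)
  have S0 : S = set0.
    apply/eqP; rewrite -cards_eq0; move: S1; case E: #|S| => [//|[|//]] _.
    have := hS' _ (@covers_self e [set v]); rewrite cards1 setDv cards0 E => /(_ erefl).
    rewrite leqn0 cards_eq0 => /eqP SD; move/eqP/cards1P: E => [w Sw].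
    have : w \in S :\: [set v] by rewrite !inE Sw inE eqxx andbT; apply: contraFneq vS => <-; rewrite ?Sw ?inE ?eqxx.
    by rewrite SD inE.
  (* Here [v] has no other neighbour, so nothing has to be carried to the root; but its subtree
     needs an edge, provided by an extra leaf. *)
  rewrite S0 setU0; apply: (@RepNode _ _ _ _ [set v] [set v] set0 set0).
  - by apply: RepLeaf; rewrite cards1.
  - exact: rep_leaf0.
  - by rewrite cards0.
  - move=> u w /set1P-> _; rewrite inE => wv; apply/negP=> evw.
    by have := cS v w; rewrite !inE S0 eqxx wv evw !inE => /(_ isT isT isT).
  - by move=> x; rewrite !inE !orbF.
  - by move=> x; rewrite !inE.
  - by move=> x; rewrite !inE.
  - by move=> x; rewrite !inE.
have [[cS minS] hS'] := hS.
have [S1 h1] := heavy_exists e Z1; have [S2 h2] := heavy_exists e Z2.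
have r1 := IH1 _ h1; have r2 := IH2 _ h2.
have [a1 a2] := uncross e_sym (subsetUl Z1 Z2) h1 hS.1.
have [b1 b2] := uncross e_sym (subsetUr Z1 Z2) h2 hS.1.
have nC Z0 T : min_cover e Z0 T -> min_cover e (~: Z0) T.
  case=> cT mT; split; first by apply: covers_setC; rewrite ?setCK.
  by move=> T' /(covers_setC e_sym); apply: mT.
have [_ c1'] : (forall x, x \in S2 -> x \in Z1 -> x \in S1) /\ (forall x, x \in S1 -> x \notin ~: Z2 -> x \in S2).
  by apply: (uncross e_sym _ h1 (nC _ _ h2.1)); rewrite -disjoints_subset.
have [_ c2'] : (forall x, x \in S1 -> x \in Z2 -> x \in S2) /\ (forall x, x \in S2 -> x \notin ~: Z1 -> x \in S1).
  by apply: (uncross e_sym _ h2 (nC _ _ h1.1)); rewrite -disjoints_subset disjoint_sym.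
apply: (RepNode r1 r2).
- exact: leq_trans (minS _ KZ) cK.
- move=> u v; rewrite !inE => uZ uS; rewrite !negb_or => /andP[vZ vS].
  rewrite (negbTE uS) orbF in uZ.
  apply/negP=> euv; have := cS u v; rewrite !inE negb_or vZ (negbTE uS) (negbTE vS) euv uZ.
  by move/(_ isT isT isT).
- move=> x; rewrite !inE; have := a2 x; have := b2 x; rewrite !inE.
  by case: (x \in Z1); case: (x \in Z2); case: (x \in S); case: (x \in S1); case: (x \in S2) => //= h h'; rewrite ?(h isT isT) ?(h' isT isT).
- move=> x; rewrite !inE; have := c1' x; have := c2' x; rewrite !inE.
  have := disjointFr d12 (x := x).
  by case: (x \in Z1); case: (x \in Z2); case: (x \in S1); case: (x \in S2) => //= d h h'; rewrite ?(h isT isT) ?(h' isT isT) //; move: (d isT).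
- by move=> x xS; rewrite inE => /orP[|//]; apply: a1.
- by move=> x xS; rewrite inE => /orP[|//]; apply: b1.
Qed.
End Clustering.

(** * Koenig duality and the sides of tree edges *)

Section Konig.
Variable G : sgraph.
Implicit Types (A S C D : {set G}) (E : {set G * G}).

(** Weak duality: sending a vertex of [S] to the block of [M] that contains it reaches all of
    [M]. *)
Lemma cover_matching A S (M : {set {set G}}) : covers (@adj G) S A ->
  crossing_matching A M -> #|M| <= #|S|.
Proof.
move=> cS /and3P[/subsetP sM tM /forall_inP xM].
apply: leq_trans (leq_imset_card (pblock M) S); apply: subset_leq_card.
apply/subsetP=> E EM; have /imsetP[[u v]] := sM _ EM; rewrite inE /= => auv Euv.
have /andP[/set0Pn[x] ] := xM _ EM; rewrite Euv !inE => /andP[xE xA] /set0Pn[y].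
rewrite !inE => /andP[yA yE].
have axy : adj x y.
  case/orP: xE => /eqP xe; case/orP: yE => /eqP ye.
  - by rewrite ye -xe xA in yA.
  - by rewrite xe ye.
  - by rewrite xe ye adj_sym.
  - by rewrite ye -xe xA in yA.
have [z zS zE] : exists2 z, z \in S & z \in E.
  case/orP: (cS x y xA yA axy) => zS; [exists x|exists y] => //; by rewrite Euv !inE.
by apply/imsetP; exists z => //; rewrite (def_pblock tM EM zE).
Qed.

Lemma cover2_matching A : cover2 (@adj G) A -> max_crossing_matching A <= 2.
Proof.
by case=> S cS h; apply/bigmax_leqP=> M /(cover_matching h) hM; apply: leq_trans cS.
Qed.

Definition hits S E := [forall p in E, (p.1 \in S) || (p.2 \in S)].

(* A minimal set of pairs without a cover of size 2 is a matching: if two of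
   its pairs share a vertex x, then the covers C and D obtained by dropping
   either pair uncross to a cover and a set that is a cover together with x. *)
Lemma matching_cover2 A : max_crossing_matching A <= 2 -> cover2 (@adj G) A.
Proof.
move=> hA; apply: contrapT => nc.
pose E0 := [set p : G * G | [&& p.1 \in A, p.2 \notin A & adj p.1 p.2]].
pose bad E := ~~ [exists S : {set G}, (#|S| <= 2) && hits S E].
have badE0 : bad E0.
  apply/existsPn=> S; apply/negP=> /andP[cS /forall_inP h]; apply: nc; exists S => // u v uA vA auv.
  by apply: (h (u, v)); rewrite inE uA vA.
have [E minE sE] := minset_exists badE0.
have [badE less] := minsetP minE.
have nohit S : #|S| <= 2 -> hits S E -> False.
  by move=> cS hS; case/negP: badE; apply/existsP; exists S; rewrite cS.
have drop p : p \in E -> exists S, [/\ #|S| <= 2, p.1 \notin S, p.2 \notin S &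
    forall q, q \in E -> q != p -> (q.1 \in S) || (q.2 \in S)].
  move=> pE; have : ~~ bad (E :\ p).
    apply/negP=> /less/(_ (subD1set _ _)) e; by have := setD11 p E; rewrite e pE.
  rewrite negbK => /existsP[S /andP[cS /forall_inP h]]; exists S.
  have hq q : q \in E -> q != p -> (q.1 \in S) || (q.2 \in S) by move=> qE qp; apply: h; rewrite !inE qp.
  have : ~~ ((p.1 \in S) || (p.2 \in S)).
    apply/negP=> hp; apply: (nohit S cS); apply/forall_inP=> q qE.
    by case: (eqVneq q p) => [->//|]; apply: hq.
  by rewrite negb_or => /andP[p1 p2]; split.
have sides p : p \in E -> [&& p.1 \in A, p.2 \notin A & adj p.1 p.2].
  by move/(subsetP sE); rewrite inE.
have inj p q : p \in E -> q \in E -> p != q -> (p.1 != q.1) && (p.2 != q.2).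
  move=> pE qE pq; have qp : q != p by rewrite eq_sym.
  have [C [cC p1C p2C hC]] := drop p pE; have [D [cD q1D q2D hD]] := drop q qE.
  pose C' := ((C :|: D) :&: A) :|: (C :&: D); pose D' := ((C :|: D) :\: A) :|: (C :&: D).
  have sum : #|C'| + #|D'| <= 4.
    suff -> : #|C'| + #|D'| = #|C| + #|D| by apply: (leq_add cC cD).
    rewrite -!sum1_card !(big_mkcond (fun x => x \in _)) -!big_split /=.
    by apply: eq_bigr => x _; rewrite !inE; bcases.
  have hC' r : r \in E -> r != p -> r != q -> (r.1 \in C') || (r.2 \in C').
    move=> rE rp rq; have := hC r rE rp; have := hD r rE rq; have /and3P[r1 r2 _] := sides r rE.
    by rewrite !inE r1 (negbTE r2); bcases.
  have hD' r : r \in E -> r != p -> r != q -> (r.1 \in D') || (r.2 \in D').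
    move=> rE rp rq; have := hC r rE rp; have := hD r rE rq; have /and3P[r1 r2 _] := sides r rE.
    by rewrite !inE r1 (negbTE r2); bcases.
  have pD := hD p pE pq; have qC := hC q qE qp.
  have /and3P[pA pA' _] := sides p pE; have /and3P[qA qA' _] := sides q qE.
  (* If one of the two sets has more than two elements, the other has at most one, and adding the
     shared vertex to it keeps the size at two. *)
  have small m n : m + n <= 4 -> 2 < n -> m <= 1 by clear; lia.
  have big S x : #|S| <= 1 -> hits (x |: S) E -> False.
    by move=> S1; apply: nohit; rewrite cardsU1; case: (x \in S); rewrite ?add0n ?(leq_trans S1).
  apply/andP; split; apply/eqP=> e.
  - have D2 : hits D' E.
      apply/forall_inP=> r rE; case: (eqVneq r p) => [->|rp].
        by move: pD; rewrite e (negbTE q1D) !inE pA' => /= ->; rewrite !orbT.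
      case: (eqVneq r q) => [->|rq]; last exact: hD'.
      by move: qC; rewrite -e (negbTE p1C) !inE qA' => /= ->; rewrite !orbT.
    case: (leqP #|D'| 2) => [le|gt]; first exact: nohit D2.
    apply: (big C' p.1); first exact: small sum gt.
    apply/forall_inP=> r rE; case: (eqVneq r p) => [->|rp]; first by rewrite !inE eqxx.
    case: (eqVneq r q) => [->|rq]; first by rewrite -e !inE eqxx.
    by rewrite !in_setU1; case/orP: (hC' r rE rp rq) => ->; rewrite !orbT.
  - have C2 : hits C' E.
      apply/forall_inP=> r rE; case: (eqVneq r p) => [->|rp].
        by move: pD; rewrite e (negbTE q2D) orbF !inE pA => ->; rewrite !orbT.
      case: (eqVneq r q) => [->|rq]; last exact: hC'.
      by move: qC; rewrite -e (negbTE p2C) orbF !inE qA => ->.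
    case: (leqP #|C'| 2) => [le|gt]; first exact: nohit C2.
    apply: (big D' p.2); first by apply: small gt; rewrite addnC.
    apply/forall_inP=> r rE; case: (eqVneq r p) => [->|rp]; first by rewrite !inE eqxx !orbT.
    case: (eqVneq r q) => [->|rq]; first by rewrite -e !inE eqxx !orbT.
    by rewrite !in_setU1; case/orP: (hD' r rE rp rq) => ->; rewrite !orbT.
pose f (p : G * G) := [set p.1; p.2].
have disj p q x : p \in E -> q \in E -> x \in f p -> x \in f q -> p = q.
  move=> pE qE xp xq; apply/eqP; apply: contraT => pq.
  have /andP[n1 n2] := inj p q pE qE pq.
  have /and3P[pA pA' _] := sides p pE; have /and3P[qA qA' _] := sides q qE.
  case/set2P: xp => xe; rewrite xe in xq; case/set2P: xq => xe'.
  - by rewrite xe' eqxx in n1.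
  - by rewrite -xe' pA in qA'.
  - by rewrite xe' qA in pA'.
  - by rewrite xe' eqxx in n2.
have finj : {in E &, injective f}.
  by move=> p q pE qE epq; apply: (disj p q p.1) => //; rewrite -?epq !inE eqxx.
(* Two pairs would be covered by their first vertices. *)
have cE : 2 < #|E|.
  rewrite ltnNge; apply/negP=> cE; apply: (nohit [set p.1 | p in E]).
    exact: leq_trans (leq_imset_card _ _) cE.
  by apply/forall_inP=> p pE; rewrite (imset_f (fun p : G * G => p.1)).
have : #|f @: E| <= 2.
  apply: leq_trans hA; apply: (@leq_bigmax_cond _ _ (fun M : {set {set G}} => #|M|)).
  apply/and3P; split.
  - apply/subsetP=> _ /imsetP[p pE ->]; apply/imsetP; exists p => //.
    by rewrite inE; case/and3P: (sides p pE).
  - apply/trivIsetP=> _ _ /imsetP[p pE ->] /imsetP[q qE ->] npq.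
    apply/pred0P=> x /=; apply/negbTE/negP=> /andP[xp xq].
    by case/eqP: npq; rewrite (disj p q x).
  - apply/forall_inP=> _ /imsetP[p pE ->]; case/and3P: (sides p pE) => pA pA' _.
    apply/andP; split; apply/set0Pn; [exists p.1|exists p.2]; by rewrite !inE eqxx ?pA ?pA' ?orbT.
by rewrite card_in_imset // leqNgt cE.
Qed.
End Konig.

(** * The two sides of an edge of a tree *)

Section Tree.
Variable T : sgraph.
Hypothesis treeT : is_tree T.

Definition tside (r s : T) : {set T} := [set t | connect (del_edge_adj r s) r t].

Lemma connect_inv (I : finType) (e : rel I) (X : {set I}) x y :
  (forall u v, u \in X -> e u v -> v \in X) -> x \in X -> connect e x y -> y \in X.
Proof.
move=> hX xX /connectP[p]; elim: p x xX => [|z p IH] x xX /=; first by move=> _ ->.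
by case/andP=> /(hX _ _ xX) zX; apply: IH.
Qed.

Lemma del_edgeC (r s u v : T) : del_edge_adj r s u v = del_edge_adj s r u v.
Proof. by rewrite /del_edge_adj [X in _ != X]setUC. Qed.

Lemma del_edge_away (r s u v : T) : u != r -> v != r -> adj u v -> del_edge_adj r s u v.
Proof.
move=> ur vr auv; rewrite /del_edge_adj auv /=; apply/eqP=> /setP/(_ r).
by rewrite !inE eqxx /= ![r == _]eq_sym (negbTE ur) (negbTE vr).
Qed.

Lemma tside_refl r s : r \in tside r s.
Proof. by rewrite inE. Qed.

Lemma tside_step r s u v : u \in tside r s -> del_edge_adj r s u v -> v \in tside r s.
Proof. by rewrite !inE => c h; apply: connect_trans c (connect1 h). Qed.

(** A simple path from [r] to [s] that avoids the edge [rs] would close up to a cycle with it. *)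
Lemma bridge r s : adj r s -> s \notin tside r s.
Proof.
move=> ars; rewrite inE; apply/negP=> /connectP[p pp sE].
case/shortenP: pp sE => p' pp' up' _ sE.
have [_ _ acyc] := treeT.
have sub : subrel (del_edge_adj r s) (@adj T) by move=> x y /andP[].
case: p' pp' up' sE => [|t [|t' p']] pp' up' sE.
- by rewrite /= in sE; rewrite sE adj_irr in ars.
- by move: pp'; rewrite /= andbT sE /= /del_edge_adj eqxx andbF.
- have := acyc [:: r, t, t' & p'] isT; rewrite /ucycleb up' andbT.
  rewrite (_ : cycle _ _ = path (@adj T) r (rcons [:: t, t' & p'] r)) // rcons_path.
  by rewrite (sub_path sub pp') -sE adj_sym ars.
Qed.

Lemma tsideC r s : adj r s -> tside s r = ~: tside r s.
Proof.
move=> ars; apply/setP=> t; rewrite in_setC; apply/idP/idP => [ts|].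
  apply/negP=> tr; have := bridge ars; rewrite inE => /negP; apply.
  rewrite inE in tr; apply: connect_trans tr _.
  rewrite (@sym_connect_sym _ (del_edge_adj r s) (@del_edge_sym _ r s)); rewrite inE in ts.
  by rewrite (eq_connect (del_edgeC r s)).
have [_ con _] := treeT.
have : t \in tside r s :|: tside s r; last by rewrite inE => /orP[->|].
apply: (connect_inv _ _ (con r t)); last by rewrite inE tside_refl.
move=> u v; rewrite !in_setU => /orP[] us auv.
  case d: (del_edge_adj r s u v); first by rewrite (tside_step us d).
  move: d; rewrite /del_edge_adj auv /= => /negbFE/eqP/setP/(_ v).
  by rewrite !inE eqxx orbT => /esym/orP[]/eqP->; rewrite connect0 ?orbT.
case d: (del_edge_adj s r u v); first by rewrite (tside_step us d) orbT.
move: d; rewrite /del_edge_adj auv /= => /negbFE/eqP/setP/(_ v).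
by rewrite !inE eqxx orbT => /esym/orP[]/eqP->; rewrite connect0 ?orbT.
Qed.

Lemma tside_sub r s t x : adj r s -> adj t r -> t != s -> x \in tside t r -> x \in tside r s.
Proof.
move=> ars atr ts; have rt := bridge atr.
rewrite {1}inE => c; suff : x \in tside r s :&: tside t r by case/setIP.
have art : del_edge_adj r s r t.
  rewrite /del_edge_adj adj_sym atr /=; apply/eqP=> /setP/(_ t).
  rewrite !inE eqxx orbT (negbTE ts) orbF => /esym/eqP e; by rewrite e adj_irr in atr.
apply: (connect_inv _ _ c); last by rewrite inE tside_refl (tside_step (tside_refl r s) art).
move=> u v /setIP[u1 u2] d; have v2 := tside_step u2 d; rewrite inE v2 andbT.
apply: (tside_step u1); apply: del_edge_away; last by case/andP: d.
  by apply: contraTneq u2 => ->.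
by apply: contraTneq v2 => ->.
Qed.

(** This recursion turns a tree into nested clusters: without [r], its side falls apart into the
    sides of its other neighbours. *)
Lemma tsideP r s x : adj r s -> reflect (x = r \/ exists2 t, adj t r && (t != s) & x \in tside t r)
  (x \in tside r s).
Proof.
move=> ars; apply: (iffP idP) => [|[->|[t /andP[atr ts]]]]; last 2 first.
- exact: tside_refl.
- exact: tside_sub.
rewrite inE => c; pose X := r |: [set x | [exists t, [&& adj t r, t != s & x \in tside t r]]].
suff : x \in X.
  by rewrite !inE => /orP[/eqP->|/existsP[t /and3P[h1 h2 h3]]]; [left|right; exists t; rewrite ?h1].
apply: (connect_inv _ _ c); last by rewrite !inE eqxx.
move=> u v; rewrite ![_ \in X]inE => /orP[/set1P->|]; rewrite !in_set.
  case/andP=> arv nrs; apply/orP; right; apply/existsP; exists v.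
  rewrite adj_sym arv tside_refl andbT /=; apply: contraNneq nrs => ->; exact: eqxx.
case/existsP=> t /and3P[h1 h2 h3] d; case d': (del_edge_adj t r u v).
  by apply/orP; right; apply/existsP; exists t; rewrite h1 h2 (tside_step h3 d').
move: d'; rewrite /del_edge_adj; case/andP: d => -> _ /= /negbFE/eqP/setP e.
have ur : u != r by apply: contraTneq h3 => ->; apply: bridge.
have := e u; have := e v; rewrite !inE !eqxx !orbT (negbTE ur) orbF => /esym/orP[]/eqP ve /esym/eqP ue.
  have := e r; rewrite !inE eqxx orbT ue ve orbb => /eqP rt; by rewrite rt adj_irr in h1.
by rewrite ve eqxx.
Qed.
End Tree.

(** * From a branch decomposition to a clustering *)

Section FromTree.
Variables (V : finType) (T : sgraph) (L : {t : T | leaf t} -> V).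
Hypothesis bdL : is_branch_decomposition L.

Lemma branch_sideC r s : adj r s -> branch_side L s r = ~: branch_side L r s.
Proof.
move=> ars; have [tr _ [g gL Lg]] := bdL; apply/setP=> v; rewrite in_setC -(Lg v).
rewrite !(mem_imset _ _ (can_inj gL)) !inE.
by have /setP/(_ (val (g v))) := tsideC tr ars; rewrite !inE.
Qed.

(** Induction on the size of the side of [r]. A leaf has no neighbour but [s] and gives a singleton;
    a node of degree 3 has two further neighbours, whose sides are smaller and disjoint. *)
Lemma decomposition_cluster (P : {set V} -> Prop) :
  (forall r s, adj r s -> P (branch_side L r s)) ->
  forall r s, adj r s -> cluster P (branch_side L r s).
Proof.
move=> hP r s; elim: {r s}_.+1 {-2}r {-2}s (ltnSn #|tside r s|) => // n IH r s le ars.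
have [tr deg [g gL Lg]] := bdL.
have smaller t : adj t r -> t != s -> #|tside t r| < n.
  move=> atr ts; rewrite ltnS in le; apply: leq_trans le; apply: proper_card; apply/properP; split.
    by apply/subsetP=> x; apply: tside_sub.
  by exists r; [apply: tside_refl|apply: bridge].
have sN : s \in [set y | adj r y] by rewrite inE.
case: (deg r) => dr.
  have lr : leaf r by rewrite /leaf dr.
  have -> : branch_side L r s = [set L (exist _ r lr)]; last exact: ClusterLeaf.
  apply/setP=> v; rewrite inE -(Lg v) (inj_eq (can_inj gL)) (mem_imset _ _ (can_inj gL)) inE.
  have -> : connect (del_edge_adj r s) r (val (g v)) = (val (g v) \in tside r s) by rewrite inE.
  apply/(tsideP tr _ ars)/eqP => [[e|[t /andP[atr ts] _]]|->]; [exact: val_inj| |by left].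
  have /eqP/cards1P[y Ny] := dr; case/eqP: ts.
  by move: sN; have : t \in [set y | adj r y]; [rewrite inE adj_sym|rewrite Ny => /set1P-> /set1P->].
have : #|[set y | adj r y] :\ s| == 2 by move: dr; rewrite /degree (cardsD1 s) sN add1n => -[->].
case/cards2P=> t1 [t2 [t12 Nr]].
have nbr t : (adj t r && (t != s)) = (t == t1) || (t == t2).
  by have /setP/(_ t) := Nr; rewrite !inE andbC adj_sym.
have /andP[a1 n1] : adj t1 r && (t1 != s) by rewrite nbr eqxx.
have /andP[a2 n2] : adj t2 r && (t2 != s) by rewrite nbr eqxx orbT.
have E : branch_side L r s = branch_side L t1 r :|: branch_side L t2 r.
  apply/setP=> v; rewrite in_setU -(Lg v) !(mem_imset _ _ (can_inj gL)) !inE.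
  have E (x y : T) : connect (del_edge_adj x y) x (val (g v)) = (val (g v) \in tside x y) by rewrite inE.
  rewrite !E; apply/(tsideP tr _ ars)/orP => [[e|[t]]|].
  - have := valP (g v); rewrite /leaf /=; by rewrite e dr.
  - by rewrite nbr => /orP[]/eqP->; [left|right].
  - by case=> h; right; [exists t1|exists t2]; rewrite ?nbr ?eqxx ?orbT.
rewrite E; apply: ClusterNode.
- by apply: IH => //; apply: smaller.
- by apply: IH => //; apply: smaller.
- rewrite -setI_eq0; apply/eqP/setP=> v; rewrite inE in_set0 -(Lg v) !(mem_imset _ _ (can_inj gL)) !inE.
  have E' (x y : T) : connect (del_edge_adj x y) x (val (g v)) = (val (g v) \in tside x y) by rewrite inE.
  rewrite !E'; apply/negbTE/negP=> /andP[h1 h2].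
  have art1 : adj r t1 by rewrite adj_sym.
  have h3 : val (g v) \in tside r t1 by apply: (tside_sub tr art1 a2) h2; rewrite eq_sym.
  by move: h1; rewrite (tsideC tr art1) inE h3.
- by rewrite -E; apply: hP.
Qed.

Lemma decomposition_cluster_setT (P : {set V} -> Prop) : P setT ->
  (forall r s, adj r s -> P (branch_side L r s)) -> cluster P setT.
Proof.
move=> PT hP; have [[T0 _ _] deg _] := bdL.
have /card_gt0P[r _] := T0.
have [s ars] : exists s, adj r s.
  have : 0 < degree r by case: (deg r) => ->.
  by case/card_gt0P=> s; rewrite inE; exists s.
rewrite -(setUCr (branch_side L r s)); rewrite -(branch_sideC ars).
apply: ClusterNode; try by apply: decomposition_cluster; rewrite // adj_sym.
  by rewrite (branch_sideC ars) disjoints_subset setCK.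
by rewrite (branch_sideC ars) setUCr.
Qed.
End FromTree.

(** * Branch decompositions from clusterings *)

Section Hierarchy.
Variable V : finType.
Implicit Types (A B C X Y Z : {set V}) (F : {set {set V}}).

Definition laminar F := forall A B, A \in F -> B \in F ->
  [\/ A \subset B, B \subset A | [disjoint A & B]].

(** A clustering flattened to the laminar family of its clusters, so that inclusion can serve as the
    order of the tree. *)
Record hierarchy (P : {set V} -> Prop) F Z : Prop := Hierarchy {
  hier_top : Z \in F;
  hier_sub : forall A, A \in F -> A \subset Z;
  hier_n0 : forall A, A \in F -> A != set0;
  hier_lam : laminar F;
  hier_split : forall A, A \in F -> (exists v, A = [set v]) \/
     exists B C, [/\ B \in F, C \in F, [disjoint B & C], A = B :|: C & P A] }.

Lemma cluster_hierarchy P Z : cluster P Z -> exists F, hierarchy P F Z.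
Proof.
elim=> {Z} [v|Z1 Z2 _ [F1 h1] _ [F2 h2] d12 PZ].
  exists [set [set v]]; split; rewrite ?inE //.
  - by move=> A /set1P->.
  - by move=> A /set1P->; apply/set0Pn; exists v; rewrite inE.
  - by move=> A B /set1P-> /set1P->; apply: Or31.
  - by move=> A /set1P->; left; exists v.
exists ((Z1 :|: Z2) |: (F1 :|: F2)).
have sub A : A \in F1 :|: F2 -> A \subset Z1 :|: Z2.
  by case/setUP=> [/(hier_sub h1)|/(hier_sub h2)] h; apply: subset_trans h _; rewrite ?subsetUl ?subsetUr.
have cross A B : A \in F1 -> B \in F2 -> [disjoint A & B].
  move=> /(hier_sub h1) A1 /(hier_sub h2) B2.
  exact: disjointWl A1 (disjointWr B2 d12).
split.
- by rewrite !inE eqxx.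
- by move=> A /setU1P[->//|]; apply: sub.
- move=> A /setU1P[->|/setUP[]]; [|exact: (hier_n0 h1)|exact: (hier_n0 h2)].
  have /set0Pn[v v1] := hier_n0 h1 (hier_top h1).
  by apply/set0Pn; exists v; rewrite inE v1.
- move=> A B /setU1P[->|AF] /setU1P[->|BF].
  + exact: Or31.
  + by apply: Or32; apply: sub.
  + by apply: Or31; apply: sub.
  + case/setUP: AF => AF; case/setUP: BF => BF.
    * exact: hier_lam h1 _ _ AF BF.
    * by apply: Or33; apply: cross.
    * by apply: Or33; rewrite disjoint_sym; apply: cross.
    * exact: hier_lam h2 _ _ AF BF.
- move=> A /setU1P[->|/setUP[]AF].
  + by right; exists Z1, Z2; split; rewrite // !inE ?(hier_top h1) ?(hier_top h2) ?orbT.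
  + case: (hier_split h1 AF) => [|[B [C [BF CF d e PA]]]]; [by left|right].
    by exists B, C; split; rewrite // !inE ?BF ?CF ?orbT.
  + case: (hier_split h2 AF) => [|[B [C [BF CF d e PA]]]]; [by left|right].
    by exists B, C; split; rewrite // !inE ?BF ?CF ?orbT.
Qed.

Lemma hier_single P F Z v : hierarchy P F Z -> forall A, A \in F -> v \in A -> [set v] \in F.
Proof.
move=> h A; elim: {A}_.+1 {-2}A (ltnSn #|A|) => // n IH A le AF vA.
case: (hier_split h AF) => [[w e]|[B [C [BF CF d e _]]]].
  by move: vA AF; rewrite e inE => /eqP->.
have cA : #|A| = #|B| + #|C| by rewrite e cardsU (disjoint_setI0 d) cards0 subn0.
have B0 : 0 < #|B| by rewrite card_gt0 (hier_n0 h).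
have C0 : 0 < #|C| by rewrite card_gt0 (hier_n0 h).
by move: vA; rewrite e => /setUP[]; apply: IH => //; move: le; rewrite cA; clear -B0 C0; lia.
Qed.
End Hierarchy.

(* The vertex setT of the tree is the leaf labelled v0; every other vertex is a
   cluster of the hierarchy on the remaining elements. *)
Section ToTree.
Variables (V : finType) (v0 : V) (P : {set V} -> Prop) (F0 : {set {set V}}).
Hypothesis hF : hierarchy P F0 [set~ v0].

Let F := setT |: F0.
Let node := {A : {set V} | A \in F}.
Implicit Types (A B C : node).

(** The covering relation of inclusion: the tree is the Hasse diagram of the family. *)
Definition cov A B : bool := (val A \proper val B) &&
  [forall C : node, ~~ ((val A \proper val C) && (val C \proper val B))].

Definition htree_adj : rel node := fun A B => cov A B || cov B A.

Lemma htree_sym : symmetric htree_adj.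
Proof. by move=> A B; rewrite /htree_adj orbC. Qed.

Lemma htree_irr : irreflexive htree_adj.
Proof. by move=> A; rewrite /htree_adj /cov properxx. Qed.

Definition htree := SGraph htree_sym htree_irr.

Lemma topF : setT \in F. Proof. by rewrite !inE eqxx. Qed.
Definition top : node := exist _ setT topF.

Lemma node_lam A B : [\/ val A \subset val B, val B \subset val A | [disjoint val A & val B]].
Proof.
case: A B => [A AF] [B BF] /=; case/setU1P: (AF) => [->|AF0]; first by apply: Or32; apply: subsetT.
case/setU1P: (BF) => [->|BF0]; first by apply: Or31; apply: subsetT.
exact: hier_lam hF _ _ AF0 BF0.
Qed.

Lemma node_n0 A : exists v, v \in val A.
Proof.
case: A => A AF /=; case/setU1P: (AF) => [->|/(hier_n0 hF)/set0Pn //]; by exists v0.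
Qed.

Lemma node_F0 A : A != top -> val A \in F0.
Proof. by case: A => A AF nA; case/setU1P: (AF) => // e; case/eqP: nA; apply: val_inj. Qed.

Lemma node_comp A B v : v \in val A -> v \in val B -> (val A \subset val B) || (val B \proper val A).
Proof.
move=> vA vB; case: (node_lam A B) => [->//|BA|/pred0P/(_ v)]; last by rewrite /= vA vB.
by rewrite properE BA /=; case: (_ \subset _).
Qed.

Lemma cov_uniq A B B' : cov A B -> cov A B' -> B = B'.
Proof.
move=> /andP[AB /forallP nB] /andP[AB' /forallP nB']; have [v vA] := node_n0 A.
have vB := subsetP (proper_sub AB) v vA; have vB' := subsetP (proper_sub AB') v vA.
apply: val_inj; apply/eqP; rewrite eqEsubset.
case/orP: (node_comp vB vB') => h; last by have := nB B'; rewrite AB' h.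
rewrite h /=; case/orP: (node_comp vB' vB) => // h'; by have := nB' B; rewrite AB h'.
Qed.

Lemma cov_ex A : A != top -> exists2 B, cov A B & forall C, val A \proper val C -> val B \subset val C.
Proof.
move=> nA; have h0 : val A \proper val top.
  by rewrite properE subsetT /=; apply: contra nA => h; apply/eqP/val_inj/eqP; rewrite eqEsubset subsetT.
have [B AB minB] := @arg_minnP _ top (fun B : node => val A \proper val B) (fun B => #|val B|) h0.
have min' C : val A \proper val C -> val C \proper val B = false.
  by move=> AC; apply/negbTE/negP=> /proper_card; rewrite ltnNge minB.
exists B; first by rewrite /cov AB; apply/forallP=> C; apply/negP=> /andP[/min'->].
move=> C AC; have [v vA] := node_n0 A.
have := node_comp (subsetP (proper_sub AB) v vA) (subsetP (proper_sub AC) v vA).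
by rewrite min' // orbF.
Qed.

Lemma htree_connect_top A : connect (@adj htree) A top.
Proof.
elim: {A}_.+1 {-2}A (ltnSn (#|V| - #|val A|)) => // n IH A le.
case: (eqVneq A top) => [->|/cov_ex[B AB _]]; first exact: connect0.
apply: (@connect_trans htree _ B); first by apply: connect1; rewrite /= /htree_adj AB.
apply: IH.
have /andP[/proper_card lAB _] := AB; have lB : #|val B| <= #|V| by apply: max_card.
move: le lAB lB; clear; move: #|V| #|val A| #|val B| => a b c; lia.
Qed.

(** On a cycle, a node of least cardinality would be covered by both of its distinct neighbours,
    whereas laminarity makes the covering node unique. *)
Lemma htree_tree : is_tree htree.
Proof.
split; first by apply/card_gt0P; exists top.
  move=> A B; apply: connect_trans (htree_connect_top A) _.
  by rewrite (sym_connect_sym (@adj_sym htree)) htree_connect_top.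
move=> c sc; apply/negP=> /andP[cyc uc].
have [A0 A0c] : exists A, A \in c by case: c sc cyc uc => // A c _ _ _; exists A; rewrite inE eqxx.
have [A Ac minA] := @arg_minnP _ A0 (fun A : node => A \in c) (fun A => #|val A|) A0c.
have [i p e] := rot_to Ac.
move: sc cyc uc minA; rewrite -(size_rot i) -(rot_cycle i) -(rot_uniq i).
move=> sc cyc uc minA.
have mem B : (B \in c) = (B \in A :: p) by rewrite -e mem_rot.
rewrite e in sc cyc uc.
have up B : B \in p -> adj (A : htree) B -> cov A B.
  move=> Bp; have := minA B; rewrite mem inE Bp orbT => /(_ isT) le.
  by case/orP=> // /andP[/proper_card]; rewrite ltnNge le.
case: p sc cyc uc mem up {e} => [//|B p] sc cyc uc mem up.
case/lastP: p sc cyc uc mem up => [//|p C] _ cyc uc mem up.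
have AB : adj (A : htree) B by case/andP: cyc.
have CA : adj (A : htree) C.
  by move: cyc; rewrite /cycle /= rcons_path last_rcons => /and3P[_ _]; rewrite htree_sym.
have cAB := up B (mem_head _ _) AB.
have cAC : cov A C by apply: up; rewrite // inE mem_rcons mem_head orbT.
move: uc => /and3P[_ nB _]; case/negP: nB.
by rewrite (cov_uniq cAB cAC) mem_rcons mem_head.
Qed.

(** By laminarity a node inside [A] that meets both [B] and [C] without being contained in either
    contains both, hence all of [A]. So nothing but [B] and [C] can lie directly below [A]. *)
Lemma node_split (A : node) (B C : {set V}) : A != top -> B \in F0 -> C \in F0 -> [disjoint B & C] ->
  val A = B :|: C -> forall X : node, cov X A = (val X == B) || (val X == C).
Proof.
move=> nA BF CF d eA X.
have [BF' CF'] : B \in F /\ C \in F by rewrite !inE BF CF !orbT.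
have [b bB] := set0Pn _ (hier_n0 hF BF); have [c cC] := set0Pn _ (hier_n0 hF CF).
have pB : B \proper val A.
  by rewrite eA properE subsetUl; apply/subsetPn; exists c; rewrite ?inE ?cC ?orbT // (disjointFl d cC).
have pC : C \proper val A.
  by rewrite eA properE subsetUr; apply/subsetPn; exists b; rewrite ?inE ?bB // (disjointFr d bB).
have below (Y : node) : val Y \proper val A -> (val Y \subset B) || (val Y \subset C).
  move=> YA; have [y yY] := node_n0 Y.
  have half (D D' : {set V}) : D \in F -> D' \in F -> val A = D :|: D' -> [disjoint D & D'] ->
      y \in D -> val Y \subset D.
    move=> DF DF' eD dD yD; have /= := @node_comp Y (exist _ D DF) y yY yD.
    case/orP=> // /properP[DY [z zY zD]].
    have zD' : z \in D' by have := subsetP (proper_sub YA) z zY; rewrite eD inE (negbTE zD).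
    have /= := @node_comp Y (exist _ D' DF') z zY zD'.
    case/orP=> [YD'|/proper_sub D'Y].
      by have := subsetP YD' y yY; rewrite (disjointFr dD yD).
    by have := YA; rewrite properE eD subUset DY D'Y andbF.
  have := subsetP (proper_sub YA) y yY; rewrite eA => /setUP[yB|yC].
    by rewrite (half B C).
  by rewrite (half C B) ?orbT // 1?setUC // disjoint_sym.
have covB (D D' : {set V}) (DF : D \in F) : D \proper val A -> [disjoint D & D'] ->
    (forall Y : node, val Y \proper val A -> (val Y \subset D) || (val Y \subset D')) ->
    D != set0 -> cov (exist _ D DF) A.
  move=> pD dD bel /set0Pn[x xD]; rewrite /cov /= pD; apply/forallP=> Y; apply/negP=> /andP[DY YA].
  case/orP: (bel Y YA) => h; first by have := proper_sub_trans DY h; rewrite properxx.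
  have := subsetP h x (subsetP (proper_sub DY) x xD); by rewrite (disjointFr dD xD).
apply/idP/orP => [/andP[XA /forallP nX]|[]/eqP e].
- case/orP: (below X XA) => h; [left|right]; rewrite eqEsubset h /=.
    apply: contraT => nh; have := nX (exist _ B BF'); by rewrite /= pB properE h nh.
  apply: contraT => nh; have := nX (exist _ C CF'); by rewrite /= pC properE h nh.
- have -> : X = exist _ B BF' by apply: val_inj.
  by apply: (covB B C BF'); rewrite ?(hier_n0 hF).
- have -> : X = exist _ C CF' by apply: val_inj.
  apply: (covB C B CF'); rewrite ?(hier_n0 hF) // 1?disjoint_sym //.
  by move=> Y; rewrite orbC; apply: below.
Qed.

Lemma Z_F : [set~ v0] \in F.
Proof. by rewrite inE (hier_top hF) orbT. Qed.

Definition subtop : node := exist _ [set~ v0] Z_F.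

Lemma v0_notin A : A != top -> v0 \notin val A.
Proof. by move/node_F0/(hier_sub hF)/subsetP=> h; apply/negP=> /h; rewrite !inE eqxx. Qed.

Lemma cov_top X : cov X top = (val X == [set~ v0]).
Proof.
apply/idP/eqP => [/andP[XT /forallP nX]|e].
  have nt : X != top by apply: contraTneq XT => ->; rewrite properxx.
  have sX := hier_sub hF (node_F0 nt); apply/eqP; rewrite eqEsubset sX /=.
  apply: contraT => nh; have := nX subtop; rewrite /= !properE sX nh subsetT /=.
  by rewrite negbK subTset => /eqP/setP/(_ v0); rewrite !inE eqxx.
rewrite /cov e properE subsetT /= subTset; apply/andP; split.
  by apply/eqP=> /setP/(_ v0); rewrite !inE eqxx.
apply/forallP=> C; apply/negP=> /andP[ZC CT].
have nt : C != top by apply: contraTneq CT => ->; rewrite properxx.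
by have := proper_sub_trans ZC (hier_sub hF (node_F0 nt)); rewrite properxx.
Qed.

Lemma cov_top_l X : cov top X = false.
Proof. by rewrite /cov properE subTset; case: eqP => //= ->; rewrite subxx. Qed.

Lemma cov_single X v A : val A = [set v] -> cov X A = false.
Proof.
move=> e; apply/negbTE/negP=> /andP[/proper_card]; rewrite e cards1 ltnS leqn0 cards_eq0 => /eqP XA _.
by have [x] := node_n0 X; rewrite XA inE.
Qed.

Lemma htree_nbr (A : htree) (Q : {set htree}) :
  (forall X, (X \in Q) = htree_adj A X) -> degree A = #|Q|.
Proof. by move=> h; apply: eq_card => X; rewrite h inE. Qed.

Lemma degree_top : degree (top : htree) = 1.
Proof.
rewrite (@htree_nbr _ [set (subtop : htree)]) ?cards1 // => X.
by rewrite inE /htree_adj cov_top_l cov_top -(inj_eq val_inj).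
Qed.

Lemma degree_single (A : htree) v : A != top -> val A = [set v] -> degree A = 1.
Proof.
move=> nA e; have [B AB _] := cov_ex nA.
rewrite (@htree_nbr _ [set (B : htree)]) ?cards1 // => X.
rewrite inE /htree_adj (cov_single _ e) orbF; apply/eqP/idP => [->//|AX]; exact: cov_uniq AX AB.
Qed.

Lemma degree_node (A : htree) (B C : {set V}) : A != top -> B \in F0 -> C \in F0 ->
  [disjoint B & C] -> val A = B :|: C -> degree A = 3.
Proof.
move=> nA BF CF d eA; have [D AD _] := cov_ex nA.
have [BF' CF'] : B \in F /\ C \in F by rewrite !inE BF CF !orbT.
have cX := node_split nA BF CF d eA.
pose b : htree := exist _ B BF'; pose c : htree := exist _ C CF'.
have nbc : b != c.
  apply/eqP=> /(congr1 val) /= e; have [x xB] := set0Pn _ (hier_n0 hF BF).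
  by have := disjointFr d xB; rewrite -e xB.
have up X : cov A X -> cov X A -> False.
  by case/andP=> /proper_card h1 _ /andP[/proper_card h2 _]; have := ltn_trans h1 h2; rewrite ltnn.
have nD X : cov X A -> X != D by move=> XA; apply/eqP=> e; apply: (up D) => //; rewrite -e.
rewrite (@htree_nbr _ [set (D : htree); b; c]).
  rewrite setUC cardsU1 cards2 !inE negb_or ![_ == D]eq_sym.
  have bA : cov b A by rewrite cX /= eqxx.
  have cA : cov c A by rewrite cX /= eqxx orbT.
  by rewrite ![D == _]eq_sym !nD // [c == b]eq_sym nbc.
move=> X; rewrite !inE /htree_adj cX -orbA -[X == b]val_eqE -[X == c]val_eqE; congr (_ || _).
by apply/eqP/idP => [->//|AX]; rewrite (cov_uniq AX AD).
Qed.

Lemma htree_degree (A : htree) :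
  ((degree A = 1) /\ (A = top \/ exists v, val A = [set v])) \/
  (degree A = 3 /\ A != top /\ P (val A)).
Proof.
case: (eqVneq A top) => [->|nA]; first by left; split; [apply: degree_top|left].
case: (hier_split hF (node_F0 nA)) => [[v e]|[B [C [BF CF d e PA]]]].
  by left; split; [apply: degree_single e|right; exists v].
by right; split; [apply: degree_node e|].
Qed.

(** Leaves other than [top] are singletons, so the default [v0] of the choice is never returned. *)
Definition hlabel (t : {t : htree | leaf t}) : V :=
  if val t == top then v0 else odflt v0 [pick v in val (val t)].

Lemma hlabel_single (t : {t : htree | leaf t}) v : val (val t) = [set v] -> v != v0 -> hlabel t = v.
Proof.
move=> e vv0; rewrite /hlabel; case: eqP => [et|_].
  have : v0 \in val (val t) by rewrite et inE.
  by rewrite e inE eq_sym (negbTE vv0).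
by case: pickP => [w|/(_ v)]; rewrite e !inE ?eqxx // => /eqP.
Qed.

Lemma hlabelP (t : {t : htree | leaf t}) : (val t = top /\ hlabel t = v0) \/
  [/\ val t != top, hlabel t != v0 & val (val t) = [set hlabel t]].
Proof.
case: (eqVneq (val t) top) => [e|nt]; first by left; rewrite /hlabel e eqxx.
right; case: (htree_degree (val t)) => [[_ [e|[v e]]]|[e _]].
- by rewrite e eqxx in nt.
- have vv0 : v != v0 by have := v0_notin nt; rewrite e inE eq_sym.
  by rewrite (hlabel_single e vv0).
- by have := valP t; rewrite /leaf e.
Qed.

Lemma hlabel_bij : bijective hlabel.
Proof.
apply: inj_card_bij => [t u|].
  case: (hlabelP t) => [[et lt]|[nt lt et]]; case: (hlabelP u) => [[eu lu]|[nu lu eu]] e.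
  - by apply: val_inj; rewrite et eu.
  - by rewrite -e lt eqxx in lu.
  - by rewrite e lu eqxx in lt.
  - by apply: val_inj; apply: val_inj; rewrite et eu e.
apply: leq_trans (leq_image_card hlabel _); apply: subset_leq_card; apply/subsetP=> v _.
case: (eqVneq v v0) => [->|vv0].
  have lt : leaf (top : htree) by rewrite /leaf degree_top.
  by apply/imageP; exists (exist (@leaf htree) top lt) => //; rewrite /hlabel eqxx.
have vF0 : [set v] \in F0 by apply: (hier_single hF (hier_top hF)); rewrite !inE.
have vF : [set v] \in F by rewrite inE vF0 orbT.
pose A : node := exist _ [set v] vF.
have nA : A != top.
  by apply/eqP=> /(congr1 val)/setP/(_ v0) /=; rewrite !inE eq_sym (negbTE vv0).
have lA : leaf (A : htree) by rewrite /leaf (degree_single nA erefl).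
by apply/imageP; exists (exist (@leaf htree) A lA) => //; rewrite (@hlabel_single _ v).
Qed.

Lemma hlabel_decomposition : is_branch_decomposition hlabel.
Proof.
split; [exact: htree_tree| |exact: hlabel_bij].
by move=> A; case: (htree_degree A) => [[-> _]|[-> _]]; [left|right].
Qed.

(** The only tree edge that leaves the nodes below [A] is the one from [A] to the unique node
    covering it. *)
Lemma tside_below (A B : htree) : cov A B -> tside A B = [set t : htree | val t \subset val A].
Proof.
move=> AB; have /andP[pAB _] := AB.
apply/setP=> t; rewrite [in RHS]inE; apply/idP/idP.
  rewrite inE => c; suff : t \in [set t : htree | val t \subset val A] by rewrite inE.
  apply: (connect_inv _ _ c); last by rewrite inE subxx.
  move=> u v; rewrite !inE => uA /andP[/orP[uv|/andP[/proper_sub vu _]] ne]; last exact: subset_trans vu uA.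
  have /andP[puv _] := uv; have [x xu] := node_n0 u.
  have xv := subsetP (proper_sub puv) x xu; have xA := subsetP uA x xu.
  case/orP: (node_comp xv xA) => // Av.
  have eu : u = A.
    apply: val_inj; apply/eqP; rewrite eqEsubset uA /=; apply: contraT => nAu.
    by case/andP: uv => _ /forallP/(_ A); rewrite properE uA nAu Av.
  by move: uv ne; rewrite eu => /cov_uniq/(_ AB)->; rewrite eqxx.
elim: {t}_.+1 {-2}t (ltnSn (#|V| - #|val t|)) => // n IH t le tA.
case: (eqVneq t A) => [->|ntA]; first exact: tside_refl.
have ptA : val t \proper val A.
  rewrite properE tA; apply: contra ntA => At; apply/eqP/val_inj/eqP; by rewrite eqEsubset tA At.
have nt : t != top by apply: contraTneq ptA => ->; rewrite properE [X in _ && ~~ X]subsetT andbF.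
have [D tD minD] := cov_ex nt.
apply: (@tside_step _ _ _ (D : htree)).
  apply: IH; last exact: minD.
  have /andP[/proper_card lAB _] := tD; have lB : #|val D| <= #|V| by apply: max_card.
  move: le lAB lB; clear; move: #|V| #|val t| #|val D| => a b c; lia.
rewrite /del_edge_adj /= /htree_adj tD orbT /=; apply/eqP=> /setP/(_ t).
rewrite !inE eqxx orbT (negbTE ntA) /= => /esym/eqP e.
by have := proper_trans ptA pAB; rewrite e properxx.
Qed.

Lemma hside (A B : htree) : cov A B -> branch_side hlabel A B = val A.
Proof.
move=> AB; have nA : A != top by apply: contraTneq AB => ->; rewrite cov_top_l.
have [g gL Lg] := hlabel_bij.
apply/setP=> v; rewrite -(Lg v) (mem_imset _ _ (can_inj gL)).
have := tside_below AB; move/setP/(_ (val (g v))); rewrite !inE => ->.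
case: (hlabelP (g v)) => [[et ->]|[_ _ et]].
  rewrite et (negbTE (v0_notin nA)); apply/negbTE; rewrite [X in X \subset _]/= subTset.
  by apply/eqP=> e; have := v0_notin nA; rewrite e inE.
by rewrite et sub1set Lg.
Qed.

(** Closure of [Q] under complement takes care of the edges read from parent to child. *)
Lemma hierarchy_decomposition (Q : {set V} -> Prop) :
  (forall v, Q [set v]) -> (forall X : {set V}, P X -> Q X) -> (forall X, Q X -> Q (~: X)) ->
  forall r s : htree, adj r s -> Q (branch_side hlabel r s).
Proof.
move=> Q1 PQ QC.
have down (A B : htree) : cov A B -> Q (branch_side hlabel A B).
  move=> AB; rewrite hside //; case: (htree_degree A) => [[_ [e|[v ->]]]|[_ [_ /PQ]]] //.
  by rewrite e cov_top_l in AB.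
move=> r s /orP[|sr]; first exact: down.
rewrite (branch_sideC hlabel_decomposition (_ : adj (s : htree) r)); last by rewrite /= /htree_adj sr.
exact/QC/down.
Qed.
End ToTree.

Lemma cluster_decomposition (V : finType) (v0 : V) (P Q : {set V} -> Prop) :
  cluster P [set~ v0] ->
  (forall v, Q [set v]) -> (forall A, P A -> Q A) -> (forall A, Q A -> Q (~: A)) ->
  exists (T : sgraph) (L : {t : T | leaf t} -> V),
    is_branch_decomposition L /\ forall r s : T, adj r s -> Q (branch_side L r s).
Proof.
case/cluster_hierarchy=> F hF Q1 PQ QC.
exists (htree F), (@hlabel V v0 F); split; first exact: hlabel_decomposition hF.
exact: (hierarchy_decomposition hF).
Qed.

(** * Width at most 2 is equivalent to having a representation *)

Lemma cover2_setC (V : finType) (e : rel V) (A : {set V}) : symmetric e ->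
  cover2 e A -> cover2 e (~: A).
Proof. by move=> e_sym [S cS h]; exists S => //; apply: covers_setC; rewrite ?setCK. Qed.

Lemma mmw_rep (G : sgraph) : mmw G <= 2 -> rep (@adj G) setT set0.
Proof.
case: (ltnP #|G| 2) => [G1 _|G2].
  apply: rep_small; rewrite ?cards0 //; first exact: sep_setT.
  by rewrite setD0 cardsT; apply: leq_trans (ltnW G1) _.
have cl : cluster (cover2 (@adj G)) setT -> rep (@adj G) setT set0.
  move=> cl; have [S hS] := heavy_exists (@adj G) setT.
  apply: (rep_shrink (S' := S)); [|by move=> x; rewrite inE|exact: sep_setT].
  by rewrite -[X in rep _ X _](setTU S); apply: cluster_rep => //; apply: adj_sym.
rewrite /mmw; case: pselect => [ex|nex _].
  case: ex_minnP => m /asboolP[T [L [bdL wL]]] _ m2.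
  apply/cl/(decomposition_cluster_setT bdL).
    by exists set0; rewrite ?cards0 // => u v _; rewrite inE.
  move=> r s ars; apply: matching_cover2; apply: leq_trans m2; rewrite -wL.
  exact: (@leq_bigmax_cond _ _ (fun p : T * T => max_crossing_matching (branch_side L p.1 p.2)) (r, s)).
(* The default width 0 cannot occur here: with two vertices or more a caterpillar is a branch
   decomposition. *)
case: nex; have /card_gt1P[x [y [_ _ xy]]] := G2.
have n0 : [set~ x] != set0 by apply/set0Pn; exists y; rewrite !inE eq_sym.
have [|//|//|T [L [bdL _]]] := cluster_decomposition (Q := fun _ => True) (cluster_all n0) => //.
by exists (branch_width L); apply/asboolP; exists T, L.
Qed.

(** A root edge carrying a single vertex [x] turns into the leaf edge of [x], and the tree beyond it
    clusters all other vertices. *)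
Lemma rep_mmw (G : sgraph) : rep (@adj G) setT set0 -> mmw G <= 2.
Proof.
move=> r; rewrite /mmw; case: pselect => // ex; case: ex_minnP => m /asboolP[T [L [bdL wL]]] minm.
case: (ltnP #|G| 2) => [G1|G2].
  rewrite -wL; apply/bigmax_leqP=> p _; apply: cover2_matching; exists setT.
    by rewrite cardsT ltnW.
  by move=> u v _ _ _; rewrite inE.
have /card_gt1P[x [y [_ _ xy]]] := G2.
have rx := rep_vertex (@adj_sym G) (@sep_setT _ _ _) r (in_setT x).
have cl : cluster (cover2 (@adj G)) [set~ x].
  apply: (rep_cluster rx) => [|z|z]; rewrite ?inE //.
  by apply/set0Pn; exists y; rewrite !inE eq_sym.
have [|//||T' [L' [bdL' hL']]] := cluster_decomposition (Q := cover2 (@adj G)) cl.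
- by move=> v; exists [set v]; rewrite ?cards1 // => u w ->.
- by move=> A; apply: cover2_setC; apply: adj_sym.
apply: leq_trans (minm (branch_width L') _) _; first by apply/asboolP; exists T', L'.
by apply/bigmax_leqP=> -[r' s'] /hL' /cover2_matching.
Qed.

(** * Separations of a minimal graph *)

(** Vertex deletion and contraction produce graphs on subtypes; their representations are moved to
    the vertices of [G], where different minors can be compared. *)
Lemma rep_val (V : finType) (p : pred V) (e : rel V) :
  rep (fun u v : {x | p x} => e (val u) (val v)) setT set0 ->
  rep (fun u v => [&& p u, p v & e u v]) [set x | p x] set0.
Proof.
pose beta v : {set {x | p x}} := [set u | val u == v].
move=> r; have := @rep_push _ _ (fun u v => [&& p u, p v & e u v]) _ beta _ _ _ _ _ r.
have -> : trace beta setT = [set x | p x].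
  apply/setP=> v; rewrite [in RHS]inE; apply/traceP/idP => [[u]|pv].
    by rewrite inE => /eqP<- _; apply: valP.
  by exists (exist _ v pv); rewrite !inE.
have -> : trace beta set0 = set0.
  by apply/setP=> v; rewrite [in RHS]inE; apply/traceP => -[u _]; rewrite inE.
apply.
- by move=> u v x; rewrite !inE => /eqP-> /eqP->.
- move=> v X _ x y; rewrite !inE => /eqP xv /eqP yv.
  by have -> : x = y by apply: val_inj; rewrite /= xv yv.
- move=> u v /and3P[pu pv euv]; exists (exist _ u pu), (exist _ v pv).
  by rewrite !inE /=.
Qed.

Lemma rep_restrict (V : finType) (e : rel V) (U A S : {set V}) : rep e U S ->
  (forall x, x \in A -> x \in U) ->
  rep (fun u v => [&& u \in A, v \in A & e u v]) A (S :&: A).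
Proof.
pose beta v : {set V} := if v \in A then [set v] else set0.
have inb u v : (u \in beta v) = (u == v) && (v \in A).
  by rewrite /beta; case: ifP; rewrite inE ?andbT ?andbF.
have tr X : trace beta X = X :&: A.
  apply/setP=> v; rewrite inE; apply/exists_inP/idP => [[u]|/setIP[vX vA]].
    by rewrite inb inE => /andP[/eqP-> ->] ->.
  by exists v; rewrite // inb eqxx.
move=> r AU; have := @rep_push _ _ (fun u v => [&& u \in A, v \in A & e u v]) _ beta _ _ _ _ _ r.
have -> : trace beta U = A by rewrite tr; apply/setIidPr/subsetP.
rewrite tr; apply.
- by move=> u v x; rewrite !inb => /andP[/eqP-> _] /andP[/eqP-> _].
- by move=> v; rewrite /beta; case: ifP => _; [apply: conn1|apply: conn0].
- by move=> u v /and3P[uA vA euv]; exists u, v; rewrite !inb !eqxx.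
Qed.

Section Minimal.
Variable G : sgraph.
Hypothesis hmin : minor_minimal_mmw_ge3 G.
Implicit Types (Z S A C : {set G}).

Lemma not_rep : ~ rep (@adj G) setT set0.
Proof. by move/rep_mmw; case: hmin => h _; rewrite leqNgt h. Qed.

Lemma minor_step_rep (H : sgraph) : minor_step G H -> rep (@adj H) setT set0.
Proof.
move=> st; apply: mmw_rep; apply: (proj2 hmin); exists H; first exact: MinorOne.
by exists id => //; exists id.
Qed.

Lemma del_vertex_rep (z : G) : rep (fun u v => [&& u != z, v != z & adj u v]) [set~ z] set0.
Proof.
have := minor_step_rep (MinorDelVertex z) => /(@rep_val G (fun x => x != z) (@adj G)).
have -> // : [set x | x != z] = [set~ z] by apply/setP=> x; rewrite !inE.
Qed.

Lemma del_edge_rep (x y : G) : adj x y -> rep (del_edge_adj x y) setT set0.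
Proof. by move=> axy; apply: (minor_step_rep (MinorDelEdge axy)). Qed.

(** The contraction of [xy] read on the vertices of [G], with [y] isolated instead of removed. *)
Definition ctr (x y : G) : rel G := fun u v =>
  [&& u != y, v != y, u != v & [|| adj u v, (u == x) && adj y v | (v == x) && adj y u]].

Lemma contract_rep (x y : G) : adj x y -> rep (ctr x y) [set~ y] set0.
Proof.
move=> axy; have := minor_step_rep (MinorContract axy) => /(@rep_val G (fun x => x != y)
  (fun u v => (u != v) && [|| adj u v, (u == x) && adj y v | (v == x) && adj y u])).
have -> // : [set x | x != y] = [set~ y] by apply/setP=> z; rewrite !inE.
Qed.

Lemma card_ge7 : 6 < #|G|.
Proof.
rewrite ltnNge; apply/negP=> le6; apply: not_rep.
case: (leqP #|G| 4) => [le4|gt4].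
  by apply: rep_small; rewrite ?cards0 ?setD0 ?cardsT //; apply: sep_setT.
have /card_gt1P[x [y [_ _ xy]]] : 1 < #|G| by apply: leq_trans gt4.
have cS : #|[set x; y]| = 2 by rewrite cards2 xy.
apply: (rep_shrink (S' := [set x; y])) (@sep_setT _ _ _) => [|z]; last by rewrite inE.
apply: rep_small; rewrite ?cS //; first exact: sep_setT.
by have := cardsC [set x; y]; rewrite setTD cS; move: le6; clear; lia.
Qed.

(** The vertex [y] beyond the separator makes this side part of a proper minor, which has a
    representation. As [S] has at most one vertex, the root can be moved to an edge carrying exactly
    [S]. *)
Lemma side_rep Z S y : #|S| <= 1 -> y \notin Z -> y \notin S ->
  (forall u, u \in Z -> u \notin S) ->
  (forall u v, u \in Z -> adj u v -> (v \in Z) || (v \in S)) ->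
  rep (@adj G) (Z :|: S) S.
Proof.
move=> S1 yZ yS ZS cl.
pose A := Z :|: S; pose e u v := [&& u \in A, v \in A & adj u v].
have e_sym : symmetric e by move=> u v; rewrite /e adj_sym andbCA.
have sA : sep e A set0 by move=> u v _ _ vA; rewrite /e (negbTE vA) andbF.
have r : rep e A set0.
  have := rep_restrict (del_vertex_rep y) (A := A); rewrite set0I => r.
  apply: (rep_mono (r _)) => [x|u v _ _ /and3P[uA vA auv]].
    by rewrite !inE => /orP[] h; apply: contraTneq h => ->.
  have nA x : x \in A -> x != y by move=> xA; apply: contraTneq xA => ->; rewrite inE (negbTE yZ).
  by rewrite uA vA !nA.
have rS : rep e A S.
  case: (set_0Vmem S) => [->//|[s sS]].
  have -> : S = [set s] by apply/esym/eqP; rewrite eqEcard sub1set sS cards1.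
  by apply: rep_vertex => //; rewrite inE sS orbT.
apply: (rep_mono rS) => u v; rewrite inE => uA uS auv; rewrite (negbTE uS) orbF in uA.
by rewrite /e !inE uA auv (cl u).
Qed.

(** Both sides are representable with root [S] and glue to a representation of [G]. Since [S] may be
    empty, this also shows that [G] is connected. *)
Lemma no_cut1 Z S z y : #|S| <= 1 -> z \in Z -> y \notin Z -> y \notin S ->
  (forall u, u \in Z -> u \notin S) ->
  (forall u v, u \in Z -> adj u v -> (v \in Z) || (v \in S)) -> False.
Proof.
move=> S1 zZ yZ yS ZS cl; apply: not_rep.
have r1 := side_rep S1 yZ yS ZS cl.
have r2 : rep (@adj G) (~: (Z :|: S) :|: S) S.
  apply: (@side_rep _ _ z S1); rewrite ?inE ?zZ ?ZS //.
    by move=> u; rewrite !inE negb_or => /andP[].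
  move=> u v; rewrite !inE !negb_or => /andP[uZ uS] auv.
  case vS: (v \in S); rewrite ?orbT // andbT orbF.
  apply: contraT; rewrite negbK => vZ.
  by have := cl v u vZ; rewrite adj_sym auv (negbTE uZ) (negbTE uS) => /(_ isT).
apply: (rep_union r1 r2) (@sep_setT _ _ _) _ _ => x; rewrite !inE.
  by case: (x \in Z); case: (x \in S).
by case: (x \in Z); case: (x \in S).
Qed.

(** [Z] is one side without its separator. It need not be connected, so that unions of components
    can be treated as one side. *)
Definition sep2 (a b : G) Z := [/\ a != b, a \notin Z, b \notin Z,
  exists z, z \in Z & exists y, [&& y \notin Z, y != a & y != b]] /\
  forall u v, u \in Z -> adj u v -> [|| v \in Z, v == a | v == b].

Definition coside (a b : G) Z := [set y | [&& y \notin Z, y != a & y != b]].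

Lemma sep2C a b Z : sep2 a b Z -> sep2 b a Z.
Proof.
case=> [[ab aZ bZ exz [y /and3P[h1 h2 h3]]] cl]; split.
  by split=> //; [rewrite eq_sym|exists y; rewrite h1 h2 h3].
by move=> u v uZ auv; rewrite [(v == b) || _]orbC (cl u).
Qed.

Lemma sep2_sub a b Z C : sep2 a b Z -> C \subset Z -> (exists z, z \in C) ->
  (forall u v, u \in C -> v \in Z -> adj u v -> v \in C) -> sep2 a b C.
Proof.
case=> [[ab aZ bZ exz [y /and3P[h1 h2 h3]]] cl] /subsetP CZ exC clC; split.
  split=> //; try by [apply: contra aZ; apply: CZ|apply: contra bZ; apply: CZ].
  by exists y; rewrite h2 h3 !andbT; apply: contra h1; apply: CZ.
move=> u v uC auv; case/or3P: (cl u v (CZ _ uC) auv) => [vZ|->|->]; rewrite ?orbT //.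
by rewrite (clC u).
Qed.

Lemma sep2_coside a b Z : sep2 a b Z -> sep2 a b (coside a b Z).
Proof.
case=> [[ab aZ bZ [z zZ] [y hy]] cl]; split.
  split=> //; try by rewrite !inE eqxx ?andbF.
    by exists y; rewrite inE.
  exists z; rewrite !inE zZ /=; apply/andP; split; apply: contraTneq zZ => -> //.
move=> u v; rewrite !inE => /and3P[uZ ua ub] auv.
case va: (v == a); rewrite ?orbT //; case vb: (v == b); rewrite ?orbT // orbF andbT /= .
rewrite orbF; apply/negP=> vZ; have := cl v u vZ; rewrite adj_sym auv (negbTE uZ) (negbTE ua) (negbTE ub).
by move/(_ isT).
Qed.

(** Otherwise [b] alone would separate [Z] from the rest. *)
Lemma sep2_nbr a b Z : sep2 a b Z -> exists2 z, z \in Z & adj a z.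
Proof.
case=> [[ab aZ bZ [z zZ] [y /and3P[h1 h2 h3]]] cl].
apply: contrapT => no; apply: (@no_cut1 Z [set b] z y); rewrite ?cards1 ?inE //.
  by move=> u uZ; rewrite inE; apply: contraTneq uZ => ->.
move=> u v uZ auv; case/or3P: (cl u v uZ auv) => [->//|/eqP va|vb]; last by rewrite inE vb orbT.
by case: no; exists u => //; rewrite adj_sym -va.
Qed.
End Minimal.


Definition touch (V : finType) (e : rel V) (X Y : {set V}) :=
  exists x y, [/\ x \in X, y \in Y & e x y].


(** * Connected pieces and their images under contraction *)

Section Component.
Variables (G : sgraph) (Z : {set G}) (c : G).
Hypothesis cZ : c \in Z.

Definition comp_of := [set z | connect (fun u v : G => [&& u \in Z, v \in Z & adj u v]) c z].

Lemma comp_of_refl : c \in comp_of.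
Proof. by rewrite inE connect0. Qed.

Lemma comp_of_closed u v : u \in comp_of -> v \in Z -> adj u v -> v \in comp_of.
Proof.
move=> uC vZ auv; have uZ : u \in Z by move: uC; rewrite inE => /(connect_inv (X := Z)); apply=> // x y xZ /and3P[].
by move: uC; rewrite !inE => h; apply: connect_trans h (connect1 _); rewrite uZ vZ.
Qed.

Lemma comp_of_sub : comp_of \subset Z.
Proof.
by apply/subsetP=> u; rewrite inE => /(connect_inv (X := Z)); apply=> // x y xZ /and3P[].
Qed.

Lemma comp_of_conn : conn (@adj G) comp_of.
Proof.
move=> X hX.
have eqX x y : x \in comp_of -> y \in comp_of -> adj x y -> (x \in X) = (y \in X).
  by move=> xC yC axy; apply/idP/idP => h; [apply: (hX x)|apply: (hX y)] => //; rewrite adj_sym.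
have all_c z : z \in comp_of -> (z \in X) = (c \in X).
  move=> zC; suff : z \in [set z in comp_of | (z \in X) == (c \in X)] by rewrite inE => /andP[_ /eqP].
  have zc := zC; rewrite inE in zc; apply: (connect_inv _ _ zc); last by rewrite inE comp_of_refl eqxx.
  move=> x y /setIdP[xC /eqP <-] /and3P[_ yZ axy]; have yC := comp_of_closed xC yZ axy.
  by apply/setIdP; rewrite (eqX x y).
by move=> x y xC yC; rewrite (all_c x xC) (all_c y yC).
Qed.
End Component.

Section Contract.
Variables (G : sgraph) (x y : G).
Hypothesis axy : adj x y.

Lemma ctr_sym : symmetric (ctr x y).
Proof.
by move=> u v; rewrite /ctr andbCA [v == u]eq_sym adj_sym; congr [&& _, _, _ & _ || _]; rewrite orbC.
Qed.

(** A set closed under the contracted adjacency is pulled back along the map [pi], which sends [y]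
    to [x], to one closed under adjacency in [G]. *)
Lemma ctr_conn (X : {set G}) : (y \in X -> x \in X) -> conn (@adj G) X -> conn (ctr x y) (X :\ y).
Proof.
move=> yx cX Y hY p q /setD1P[py pX] /setD1P[qy qX] pY.
have xy : x != y by apply: contraTneq axy => ->; rewrite adj_irr.
pose pi z := if z == y then x else z.
suff : q \in [set z | pi z \in Y] by rewrite inE /pi (negbTE qy).
apply: (cX _ _ p) => //; last by rewrite inE /pi (negbTE py).
move=> u v uX vX; rewrite !inE => uY auv.
case: (eqVneq (pi u) (pi v)) => [<-//|npi].
apply: (hY (pi u)) => //.
- rewrite !inE /pi; case: (eqVneq u y) => [e|->//]; by rewrite xy yx // -e.
- rewrite !inE /pi; case: (eqVneq v y) => [e|->//]; by rewrite xy yx // -e.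
- rewrite /ctr npi /pi; case: (eqVneq u y) auv => [->|->]; case: (eqVneq v y) => [->|->] /=.
  + by rewrite adj_irr.
  + by rewrite xy eqxx => -> /=; rewrite orbT.
  + by rewrite xy eqxx adj_sym => -> /=; rewrite !orbT.
  + by move=> ->.
Qed.

Lemma ctr_touch (X Y : {set G}) : (y \in X -> x \in X) -> (y \in Y -> x \in Y) ->
  (forall z, z \in X -> z \notin Y) -> touch (@adj G) X Y -> touch (ctr x y) (X :\ y) (Y :\ y).
Proof.
move=> yX yY dXY [u [v [uX vY auv]]].
have xy : x != y by apply: contraTneq axy => ->; rewrite adj_irr.
have neq p q : p \in X -> q \in Y -> p != q by move=> pX qY; apply: contraTneq qY => <-; apply: dXY.
case: (eqVneq u y) => [uy|nuy].
  have vy : v != y by rewrite -uy eq_sym neq.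
  have xX : x \in X by rewrite yX // -uy.
  exists x, v; split; rewrite ?inE ?xy ?vy ?xX ?vY //.
  by rewrite uy in auv; apply/and4P; split=> //; [exact: neq|rewrite eqxx auv orbT].
case: (eqVneq v y) => [vy|nvy].
  have xY : x \in Y by rewrite yY // -vy.
  exists u, x; split; rewrite ?inE ?xy ?nuy ?xY ?uX //.
  by rewrite vy adj_sym in auv; apply/and4P; split=> //; [exact: neq|rewrite eqxx auv !orbT].
by exists u, v; split; rewrite ?inE ?nuy ?nvy //; apply/and4P; split=> //; [exact: neq|rewrite auv].
Qed.
End Contract.

(** * Forcing a side of a 2-separation to be a good subdivision *)

Section Small.
Variable G : sgraph.
Hypothesis hmin : minor_minimal_mmw_ge3 G.
Implicit Types (Z S A C : {set G}).

Definition path_model (e : rel G) a b C1 C2 :=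
  [/\ touch e [set a] C1, touch e C1 C2 & touch e C2 [set b]].
Definition square_model (e : rel G) a b C1 C2 :=
  [/\ touch e [set a] C1, touch e C1 [set b], touch e [set a] C2 & touch e C2 [set b]].

Definition is_pair (a b u v : G) := ((u == a) && (v == b)) || ((u == b) && (v == a)).

(** If [Z] keeps one of the two patterns as a model in a representable graph, shrinking the branch
    sets to vertices leaves the other side together with a path or square from [a] to [b], and
    [rep_two_subdivided] applies. *)
Lemma model_rep a b Z (e' : rel G) (U' : {set G}) C1 C2 :
  sep2 a b Z -> rep e' U' set0 -> symmetric e' ->
  (forall u, u \notin Z -> u \in U') -> (forall u, u \in C1 -> u \in Z) -> (forall u, u \in C2 -> u \in Z) ->
  (forall u, u \in C1 -> u \in U') -> (forall u, u \in C2 -> u \in U') ->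
  conn e' C1 -> conn e' C2 -> (forall u, u \in C1 -> u \notin C2) ->
  (forall u v, u \notin Z -> v \notin Z -> adj u v -> ~~ is_pair a b u v -> e' u v) ->
  path_model e' a b C1 C2 \/ square_model e' a b C1 C2 ->
  rep (@adj G) (~: Z) [set a; b].
Proof.
move=> [[ab aZ bZ _ _] cl] r e'_sym ZU C1Z C2Z C1U C2U c1 c2 d12 e'A mod.
(* Arbitrary members of the two branch sets serve as names for the two new vertices. *)
have [c cC] : exists c, c \in C1.
  by case: mod => [[[_ [y [_ yC _]]] _ _]|[[_ [y [_ yC _]]] _ _ _]]; exists y.
have [d dC] : exists d, d \in C2.
  by case: mod => [[_ _ [y [_ [yC _ _]]]]|[_ _ _ [y [_ [yC _ _]]]]]; exists y.
have cd : c != d by apply: contraTneq dC => <-; apply: d12.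
(* The edge [ab] is left out because it may be the one deleted in the minor. It can be restored at
   the end, when [a] and [b] lie on the root edge. *)
pose eA u v := [&& u \in ~: Z, v \in ~: Z, adj u v & ~~ is_pair a b u v].
have is_pairC u v : is_pair a b u v = is_pair a b v u by rewrite /is_pair orbC andbC [(v == b) && _]andbC.
have eA_sym : symmetric eA by move=> u v; rewrite /eA andbCA adj_sym is_pairC.
have [sq hsq] : exists sq : bool, if sq then square_model e' a b C1 C2 else path_model e' a b C1 C2.
  by case: mod => h; [exists false|exists true].
pose pat u v := if sq then (u == a) && ((v == c) || (v == d)) || ((u == c) || (u == d)) && (v == b)
  else [|| (u == a) && (v == c), (u == c) && (v == d) | (u == d) && (v == b)].
pose e u v := [|| eA u v, pat u v | pat v u].
have e_sym : symmetric e by move=> u v; rewrite /e eA_sym; congr (_ || _); rewrite orbC.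
pose beta v := if v == c then C1 else if v == d then C2 else if v \in ~: Z then [set v] else set0.
have neq u v : u \notin Z -> v \in Z -> u != v by move=> uZ vZ; apply: contraTneq vZ => <-.
have cZ := C1Z _ cC; have dZ := C2Z _ dC.
have betaA u : u \notin Z -> beta u = [set u].
  by move=> uZ; rewrite /beta !(negbTE (neq u _ uZ _)) // inE uZ.
have betac : beta c = C1 by rewrite /beta eqxx.
have betad : beta d = C2 by rewrite /beta eq_sym (negbTE cd) eqxx.
have beta0 u : u \in Z -> u != c -> u != d -> beta u = set0.
  by rewrite /beta => uZ /negbTE-> /negbTE->; rewrite inE uZ.
have inb x v : x \in beta v -> [\/ x \notin Z /\ v = x, x \in C1 /\ v = c | x \in C2 /\ v = d].
  case: (boolP (v \in Z)) => vZ; last by rewrite betaA // => /set1P->; apply: Or31.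
  case: (eqVneq v c) => [->|vc]; first by rewrite betac => ?; apply: Or32.
  case: (eqVneq v d) => [->|vd]; first by rewrite betad => ?; apply: Or33.
  by rewrite beta0 // inE.
have patT u v : pat u v -> touch e' (beta u) (beta v).
  have ba := betaA a aZ; have bb := betaA b bZ.
  move: hsq; rewrite /pat; case: (boolP sq) => _ [h1 h2 h3]; first move=> h4.
    by case/orP=> [/andP[/eqP-> /orP[]/eqP->]|/andP[/orP[]/eqP-> /eqP->]]; rewrite ?ba ?bb ?betac ?betad.
  by case/or3P=> /andP[/eqP-> /eqP->]; rewrite ?ba ?bb ?betac ?betad.
have rp : rep e (trace beta U') (trace beta set0).
  apply: (rep_push (beta := beta)) r => [u v x|v|u v].
  - case/inb=> [[h1 ->]|[h1 ->]|[h1 ->]] /inb[[h2 ->]|[h2 ->]|[h2 ->]] //.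
    + by rewrite (C1Z _ h2) in h1.
    + by rewrite (C2Z _ h2) in h1.
    + by rewrite (C1Z _ h1) in h2.
    + by have := d12 _ h1; rewrite h2.
    + by rewrite (C2Z _ h1) in h2.
    + by have := d12 _ h2; rewrite h1.
  - case: (boolP (v \in Z)) => vZ; last by rewrite betaA //; apply: conn1.
    case: (eqVneq v c) => [->|vc]; first by rewrite betac.
    case: (eqVneq v d) => [->|vd]; first by rewrite betad.
    by rewrite beta0 //; apply: conn0.
  - case/or3P=> [/and4P[]|/patT//|/patT[x [y [h1 h2 h3]]]]; last by exists y, x; rewrite e'_sym.
    rewrite !inE => uZ vZ auv np; exists u, v; rewrite !betaA // !inE !eqxx; split=> //; exact: e'A.
have t0 : trace beta set0 = set0.
  by apply/setP=> v; rewrite [in RHS]inE; apply/traceP => -[u _]; rewrite inE.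
have tU x : (x \in trace beta U') = [|| x \in ~: Z, x == c | x == d].
  apply/traceP/or3P => [[y /inb[[h1 ->] _|[_ ->] _|[_ ->] _]]|[]].
  - by apply: Or31; rewrite inE.
  - exact: Or32.
  - exact: Or33.
  - by rewrite inE => xZ; exists x; [rewrite betaA ?inE|apply: ZU].
  - by move/eqP->; exists c; [rewrite betac|apply: C1U].
  - by move/eqP->; exists d; [rewrite betad|apply: C2U].
rewrite t0 in rp.
have inU u v : e u v -> (u \in trace beta U') && (v \in trace beta U').
  have aA : a \in ~: Z by rewrite inE.
  have bA : b \in ~: Z by rewrite inE.
  have pU p q : pat p q -> (p \in trace beta U') && (q \in trace beta U').
    rewrite !tU /pat; case: (boolP sq) => _.
      by case/orP=> [/andP[/eqP-> /orP[]/eqP->]|/andP[/orP[]/eqP-> /eqP->]]; rewrite ?aA ?bA ?eqxx ?orbT.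
    by case/or3P=> /andP[/eqP-> /eqP->]; rewrite ?aA ?bA ?eqxx ?orbT.
  case/or3P=> [/and4P[h1 h2 _ _]|/pU//|/pU]; last by rewrite andbC.
  by rewrite !tU h1 h2.
have {}rp : rep eA (~: Z) [set a; b].
  apply: (@rep_two_subdivided _ e eA (~: Z) e_sym _ a b c d (trace beta U')); rewrite ?inE ?negbK //.
  - by move=> u v h; rewrite /e h; case/and4P: h => -> ->.
  - by move=> u v _ _ vU; apply/negP=> /inU; rewrite (negbTE vU) andbF.
  - rewrite /path_pattern /square_pattern /e /pat; case: (boolP sq) => _; by rewrite !eqxx !orbT.
apply: (rep_mono rp) => u v; rewrite !inE negb_or => uZ /andP[ua ub] auv.
rewrite /eA !inE uZ auv /is_pair (negbTE ua) (negbTE ub) /= andbT.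
apply/negP=> vZ; have := cl v u vZ; rewrite adj_sym auv (negbTE uZ) (negbTE ua) (negbTE ub).
by move/(_ isT).
Qed.
End Small.


Lemma conn_edge (G : sgraph) (C : {set G}) : conn (@adj G) C -> 1 < #|C| ->
  exists x y, [/\ x \in C, y \in C & adj x y].
Proof.
move=> cC /card_gt1P[p [q [pC qC pq]]]; apply: contrapT => no.
have /set1P qp : q \in [set p]; last by rewrite qp eqxx in pq.
apply: (cC [set p] _ p q) => //; last by rewrite inE.
by move=> x y xC yC _ axy; case: no; exists x, y.
Qed.

Lemma degree2 (G : sgraph) (c a b : G) : a != b -> (forall v, adj c v = (v == a) || (v == b)) -> degree c = 2.
Proof.
move=> ab h; rewrite /degree; have -> : [set y | adj c y] = [set a; b] by apply/setP=> v; rewrite !inE h.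
by rewrite cards2 ab.
Qed.

Lemma touch1 (V : finType) (e : rel V) x y : e x y -> touch e [set x] [set y].
Proof. by move=> exy; exists x, y; rewrite !inE !eqxx. Qed.

Lemma touch1E (V : finType) (e : rel V) x y : touch e [set x] [set y] -> e x y.
Proof. by case=> u [v [/set1P-> /set1P->]]. Qed.

Lemma touch_mono (V : finType) (e e' : rel V) (X Y : {set V}) : touch e X Y ->
  (forall x y, x \in X -> y \in Y -> e x y -> e' x y) -> touch e' X Y.
Proof. by move=> [x [y [xX yY exy]]] h; exists x, y; split=> //; apply: h. Qed.

Lemma is_pairP (G : sgraph) (a b u v : G) : adj u v -> [set u; v] = [set a; b] -> is_pair a b u v.
Proof.
move=> auv E; have /set2P hu : u \in [set a; b] by rewrite -E !inE eqxx.
have /set2P hv : v \in [set a; b] by rewrite -E !inE eqxx orbT.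
rewrite /is_pair; case: hu => ue; case: hv => ve; rewrite ue ve !eqxx ?orbT //.
  by rewrite ue ve adj_irr in auv.
by rewrite ue ve adj_irr in auv.
Qed.

Section SmallSide.
Variable G : sgraph.
Hypothesis hmin : minor_minimal_mmw_ge3 G.
Implicit Types (Z S A C : {set G}).

(** Two components of [Z] both reach [a] and [b] and form the square. If [Z] is connected, a
    neighbour [d] of [b] and the component of [Z] minus [d] around a neighbour of [a] form the
    path. *)
Lemma model_exists a b Z : sep2 a b Z -> 1 < #|Z| -> exists C1 C2 : {set G},
  [/\ conn (@adj G) C1 /\ conn (@adj G) C2, C1 \subset Z, C2 \subset Z,
      forall u, u \in C1 -> u \notin C2
    & path_model (@adj G) a b C1 C2 \/ square_model (@adj G) a b C1 C2].
Proof.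
move=> s2 Z2; have [[ab aZ bZ [z zZ] [y hy]] cl] := s2.
have nbrs (C : {set G}) : C \subset Z -> (exists z, z \in C) ->
    (forall u v, u \in C -> v \in Z -> adj u v -> v \in C) ->
    touch (@adj G) [set a] C /\ touch (@adj G) C [set b].
  move=> CZ C0 clC; have sC := sep2_sub s2 CZ C0 clC.
  have [c cC ac] := sep2_nbr hmin sC; have [d dC bd] := sep2_nbr hmin (sep2C sC).
  split; [by exists a, c; rewrite inE eqxx|by exists d, b; rewrite inE eqxx adj_sym].
case: (boolP (Z \subset comp_of Z z)) => [ZC|/subsetPn[w wZ wC]]; last first.
  exists (comp_of Z z), (comp_of Z w).
  have [t1 t2] := nbrs _ (comp_of_sub zZ) (ex_intro _ z (comp_of_refl Z z)) (@comp_of_closed _ _ _ zZ).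
  have [t3 t4] := nbrs _ (comp_of_sub wZ) (ex_intro _ w (comp_of_refl Z w)) (@comp_of_closed _ _ _ wZ).
  split; [by split; apply: comp_of_conn|exact: comp_of_sub|exact: comp_of_sub| |by right].
  move=> u uC; apply/negP=> uC'; case/negP: wC.
  apply: (@comp_of_conn _ _ _ wZ (comp_of Z z) _ u w) => //; last exact: comp_of_refl.
  move=> p q _ qC pC apq; apply: (comp_of_closed zZ pC) => //.
  exact: (subsetP (comp_of_sub wZ)).
have cZ : conn (@adj G) Z.
  have -> : Z = comp_of Z z by apply/eqP; rewrite eqEsubset ZC comp_of_sub.
  by have := comp_of_conn zZ.
(* Without two distinct such vertices, a single vertex of [Z] would be the only one with neighbours
   among [a] and [b], and it would cut off the rest of [Z]. *)
have [c [d [cZ' dZ ac bd cd]]] : exists c d, [/\ c \in Z, d \in Z, adj a c, adj b d & c != d].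
  have [c cZ' ac] := sep2_nbr hmin s2; have [d dZ bd] := sep2_nbr hmin (sep2C s2).
  case: (eqVneq c d) => [e|cd]; last by exists c, d.
  apply: contrapT => no.
  have [w wZ wc] : exists2 w, w \in Z & w != c.
    case/card_gt1P: Z2 => p [q [pZ qZ pq]]; case: (eqVneq p c) => [pc|]; last by exists p.
    by exists q; rewrite // -pc eq_sym.
  apply: (@no_cut1 _ hmin (Z :\ c) [set c] w a); rewrite ?cards1 ?inE ?(negbTE aZ) ?andbF ?wc //.
  - by apply: contraTneq cZ' => <-.
  - by move=> u /setD1P[uc _]; rewrite inE.
  - move=> u v /setD1P[uc uZ] auv; rewrite !inE; case: (eqVneq v c) => //= vc; rewrite orbF.
    case/or3P: (cl u v uZ auv) => // /eqP ve.
      by case: no; exists u, d; split=> //; [rewrite -ve adj_sym|rewrite -e].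
    by case: no; exists c, u; split=> //; [rewrite -ve adj_sym|rewrite eq_sym].
have cZd : c \in Z :\ d by rewrite !inE cd.
have sub := comp_of_sub cZd.
exists (comp_of (Z :\ d) c), [set d]; split.
- by split; [apply: comp_of_conn|apply: conn1].
- by apply: subset_trans sub _; apply: subD1set.
- by rewrite sub1set.
- by move=> u /(subsetP sub)/setD1P[]; rewrite inE.
- left; split; first by exists a, c; rewrite inE eqxx comp_of_refl.
    apply: contrapT => no.
    have /(subsetP sub) : d \in comp_of (Z :\ d) c; last by rewrite !inE eqxx.
    apply: (cZ _ _ c d) => //; last exact: comp_of_refl.
    move=> u v uZ vZ uC auv; apply: (comp_of_closed cZd uC) => //.
    by rewrite !inE vZ andbT; apply/eqP=> vd; case: no; exists u, d; split=> //; [rewrite inE|rewrite -vd].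
  by exists d, b; rewrite !inE !eqxx adj_sym.
Qed.

Definition small (a b : G) Z :=
  [/\ ~~ adj a b, #|Z| <= 2 & forall z, z \in Z -> degree z = 2].

(** As the other side is not representable, no proper minor that preserves it apart from [ab] can
    keep a path or square model in [Z]. The model is therefore irreducible under deleting vertices,
    contracting edges and deleting edges, which leaves exactly the pattern. *)
Lemma sep2_small a b Z : sep2 a b Z -> ~ rep (@adj G) (~: Z) [set a; b] -> small a b Z.
Proof.
move=> s2 nr; have [[ab aZ bZ [z zZ] [y hy]] cl] := s2.
have neq u v : u \notin Z -> v \in Z -> u != v by move=> uZ vZ; apply: contraTneq vZ => <-.
(* A single vertex has [a] and [b] as its neighbours, and an edge [ab] could be added to a
   representation of the graph without it. *)
case: (leqP #|Z| 1) => [Z1|Z2].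
  have Zz : Z = [set z] by apply/esym/eqP; rewrite eqEcard sub1set zZ cards1.
  have [z1 z1Z az] := sep2_nbr hmin s2; have [z2 z2Z bz] := sep2_nbr hmin (sep2C s2).
  move: az bz z1Z z2Z; rewrite Zz => az bz /set1P e1 /set1P e2; rewrite e1 in az; rewrite e2 in bz.
  have Nz v : adj z v = (v == a) || (v == b).
    apply/idP/orP => [azv|[]/eqP->]; rewrite 1?adj_sym //.
    have := cl z v zZ azv; rewrite Zz inE; case: (eqVneq v z) azv => [->|_ _ /= /orP//]; by rewrite adj_irr.
  split; rewrite ?cards1 //; last by move=> w /set1P->; apply: degree2 ab Nz.
  apply/negP=> aab; apply: (not_rep hmin).
  apply: (@rep_triangle _ (del_edge_adj a b) _ a b z (@del_edge_sym G a b) (@adj_sym G) ab).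
  - by rewrite eq_sym neq.
  - by rewrite eq_sym neq.
  - rewrite /del_edge_adj az; apply/eqP=> /setP/(_ b); rewrite !inE eqxx orbT eq_sym (negbTE ab) /=.
    by move/eqP=> e; rewrite e zZ in bZ.
  - rewrite /del_edge_adj adj_sym bz; apply/eqP=> /setP/(_ a); rewrite !inE eqxx (negbTE ab) orbF /=.
    by move/eqP=> e; rewrite e zZ in aZ.
  - by move=> v /andP[]; rewrite Nz.
  - move=> u v auv; rewrite /del_edge_adj auv /=.
    by case: (eqVneq [set u; v] [set a; b]) => //= /(is_pairP auv).
  - exact: del_edge_rep.
have [C1 [C2 [[c1 c2] /subsetP C1Z /subsetP C2Z d12 mod]]] := model_exists s2 Z2.
(* A vertex outside both branch sets could be deleted. *)
have Zcov w : w \in Z -> (w \in C1) || (w \in C2).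
  move=> wZ; apply: contraT; rewrite negb_or => /andP[w1 w2]; case: nr.
  pose e' u v := [&& u != w, v != w & adj u v].
  have lift (X Y : {set G}) : touch (@adj G) X Y -> w \notin X -> w \notin Y -> touch e' X Y.
    move=> t wX wY; apply: touch_mono t _ => p q pX qY apq.
    by rewrite /e' apq andbT; apply/andP; split; [apply: contraTneq pX|apply: contraTneq qY] => ->.
  have cn (X : {set G}) : conn (@adj G) X -> w \notin X -> conn e' X.
    move=> cX wX Y hY; apply: cX => p q pX qX pY apq; apply: (hY p) => //.
    by rewrite /e' apq andbT; apply/andP; split; [apply: contraTneq pX|apply: contraTneq qX] => ->.
  apply: (model_rep s2 (del_vertex_rep hmin w) _ _ C1Z C2Z _ _ (cn _ c1 w1) (cn _ c2 w2) d12).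
  - by move=> u v; rewrite /= andbCA adj_sym.
  - by move=> u uZ; rewrite !inE neq.
  - by move=> u uC; rewrite !inE; apply: contraTneq uC => ->.
  - by move=> u uC; rewrite !inE; apply: contraTneq uC => ->.
  - by move=> u v uZ vZ auv _; rewrite !neq.
  - have wa : w \notin [set a] by rewrite inE eq_sym neq.
    have wb : w \notin [set b] by rewrite inE eq_sym neq.
    by case: mod => [[t1 t2 t3]|[t1 t2 t3 t4]]; [left|right]; split; apply: lift.
(* A larger branch set contains an edge, which could be contracted. *)
have single C : (C = C1 \/ C = C2) -> #|C| <= 1.
  move=> hC; rewrite leqNgt; apply/negP=> C2'; case: nr.
  have [x [w [xC wC axw]]] : exists x w, [/\ x \in C, w \in C & adj x w].
    by apply: conn_edge C2'; case: hC => ->.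
  have wZ : w \in Z by case: hC wC => ->; [apply: C1Z|apply: C2Z].
  have xZ : x \in Z by case: hC xC => ->; [apply: C1Z|apply: C2Z].
  have k1 : w \in C1 -> x \in C1 by case: hC wC xC => -> // w2 _ w1; have := d12 _ w1; rewrite w2.
  have k2 : w \in C2 -> x \in C2 by case: hC wC xC => -> // w1 _ w2; have := d12 _ w1; rewrite w2.
  have ka u : u \notin Z -> w \in [set u] -> x \in [set u] by move=> uZ /set1P e; rewrite -e wZ in uZ.
  have D u : u \notin Z -> [set u] :\ w = [set u].
    by move=> uZ; apply/setDidPl; rewrite disjoints1 inE neq.
  have dA u (X : {set G}) : u \notin Z -> (forall v, v \in X -> v \in Z) -> forall v, v \in [set u] -> v \notin X.
    by move=> uZ XZ v /set1P->; apply: contra uZ; apply: XZ.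
  have dA' u (X : {set G}) : u \notin Z -> (forall v, v \in X -> v \in Z) -> forall v, v \in X -> v \notin [set u].
    by move=> uZ XZ v /XZ vZ; rewrite inE eq_sym neq.
  apply: (@model_rep _ a b Z (ctr x w) [set~ w] (C1 :\ w) (C2 :\ w) s2 (contract_rep hmin axw) (@ctr_sym G x w)).
  - by move=> u uZ; rewrite !inE neq.
  - by move=> u /setD1P[_]; apply: C1Z.
  - by move=> u /setD1P[_]; apply: C2Z.
  - by move=> u /setD1P[uw _]; rewrite !inE.
  - by move=> u /setD1P[uw _]; rewrite !inE.
  - exact: ctr_conn.
  - exact: ctr_conn.
  - by move=> u /setD1P[_ /d12 u2]; rewrite inE (negbTE u2) andbF.
  - move=> u v uZ vZ auv _; apply/and4P; split; [exact: neq|exact: neq| |by rewrite auv].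
    by apply: contraTneq auv => ->; rewrite adj_irr.
  - by case: mod => [[t1 t2 t3]|[t1 t2 t3 t4]]; [left|right]; split;
      rewrite -1?(D a aZ) -1?(D b bZ); apply: ctr_touch => //; by [apply: ka|apply: dA|apply: dA'].
have [c cC1] : exists c, c \in C1.
  by case: mod => [[[_ [q [_ qC _]]] _ _]|[[_ [q [_ qC _]]] _ _ _]]; exists q.
have [d dC2] : exists d, d \in C2.
  by case: mod => [[_ _ [q [_ [qC _ _]]]]|[_ _ _ [q [_ [qC _ _]]]]]; exists q.
have C1c : C1 = [set c] by apply/esym/eqP; rewrite eqEcard sub1set cC1 cards1 single //; left.
have C2d : C2 = [set d] by apply/esym/eqP; rewrite eqEcard sub1set dC2 cards1 single //; right.
have cZ := C1Z _ cC1; have dZ := C2Z _ dC2.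
have cd : c != d by apply: contraTneq dC2 => <-; apply: d12.
have Zcd : Z = [set c; d].
  apply/setP=> w; apply/idP/set2P => [/Zcov|[]->//]; by rewrite C1c C2d !inE => /orP[]/eqP->; [left|right].
rewrite {}C1c {}C2d in c1 c2 mod d12 {single Zcov cC1 dC2}.
(* An edge that the model does not use, either [ab] or one with an end in [Z], could be deleted. *)
have clear x w : adj x w -> ((x == a) && (w == b)) || (x \in Z) ->
    (path_model (del_edge_adj x w) a b [set c] [set d] \/ square_model (del_edge_adj x w) a b [set c] [set d]) -> False.
  move=> axw hxw mod'; apply: nr.
  apply: (@model_rep _ a b Z (del_edge_adj x w) setT [set c] [set d] s2 (del_edge_rep hmin axw) (@del_edge_sym G x w)) => //.
  - by move=> u /set1P->.
  - by move=> u /set1P->.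
  - exact: conn1.
  - exact: conn1.
  - move=> u v uZ vZ auv np; rewrite /del_edge_adj auv; apply/eqP=> E.
    case/orP: hxw => [/andP[/eqP xa /eqP wb]|xZ].
      by case/negP: np; apply: is_pairP => //; rewrite -xa -wb.
    have /setP/(_ x) := E; rewrite !inE eqxx /= => /orP[]/eqP xe; by [rewrite -xe xZ in uZ|rewrite -xe xZ in vZ].
have de p q x w : adj p q -> (x != p) && (x != q) || (w != p) && (w != q) -> del_edge_adj x w p q.
  move=> apq h; rewrite /del_edge_adj apq; apply/eqP=> /setP E.
  by have := (E x, E w); rewrite !inE !eqxx !orbT => -[/orP h1 /orP h2]; case/orP: h => /andP[/negbTE n1 /negbTE n2]; [case: h1|case: h2]; rewrite ?n1 ?n2.
have ac := neq _ _ aZ cZ; have ad := neq _ _ aZ dZ; have bc := neq _ _ bZ cZ; have bd := neq _ _ bZ dZ.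
have nE := (ab, ac, ad, bc, bd, cd).
have nE' : ((b != a) * (c != a) * (d != a) * (c != b) * (d != b) * (d != c))%type.
  by do !split; rewrite eq_sym nE.
have Zc2 : #|Z| <= 2 by rewrite Zcd cards2 cd.
case: mod => [[/touch1E t1 /touch1E t2 /touch1E t3]|[/touch1E t1 /touch1E t2 /touch1E t3 /touch1E t4]].
  have nab : ~~ adj a b.
    apply/negP=> h; apply: (clear a b h); rewrite ?eqxx //; left.
    by split; apply: touch1; apply: de; rewrite // ?nE ?nE' ?orbT.
  have nda : ~~ adj d a.
    apply/negP=> h; apply: (clear d a h); rewrite ?dZ ?orbT //; left.
    by split; apply: touch1; apply: de; rewrite // ?nE ?nE' ?orbT.
  have ncb : ~~ adj c b.
    apply/negP=> h; apply: (clear c b h); rewrite ?cZ ?orbT //; left.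
    by split; apply: touch1; apply: de; rewrite // ?nE ?nE' ?orbT.
  split=> // w; rewrite Zcd => /set2P[]->.
    apply: (degree2 ad) => v; apply/idP/orP => [h|[]/eqP->//]; last by rewrite adj_sym.
    have := cl c v cZ h; rewrite Zcd !inE; case: (eqVneq v c) h => [->|_]; first by rewrite adj_irr.
    by case: (eqVneq v b) => [->|_]; [rewrite (negbTE ncb)|rewrite /= orbF => _ /orP[]->; [right|left]].
  apply: (degree2 bc) => v; apply/idP/orP => [h|[]/eqP->//]; last by rewrite adj_sym.
  have := cl d v dZ h; rewrite Zcd !inE; case: (eqVneq v d) h => [->|_]; first by rewrite adj_irr.
  by case: (eqVneq v a) => [->|_]; [rewrite (negbTE nda)|rewrite /= orbF => _ /orP[]->; [right|left]].
have nab : ~~ adj a b.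
  apply/negP=> h; apply: (clear a b h); rewrite ?eqxx //; right.
  by split; apply: touch1; apply: de; rewrite // ?nE ?nE' ?orbT.
have ncd : ~~ adj c d.
  apply/negP=> h; apply: (clear c d h); rewrite ?cZ ?orbT //; right.
  by split; apply: touch1; apply: de; rewrite // ?nE ?nE' ?orbT.
split=> // w; rewrite Zcd => /set2P[]->.
  apply: (degree2 ab) => v; apply/idP/orP => [h|[]/eqP->//]; last by rewrite adj_sym.
  have := cl c v cZ h; rewrite Zcd !inE; case: (eqVneq v c) h => [->|_]; first by rewrite adj_irr.
  by case: (eqVneq v d) => [->|_]; [rewrite (negbTE ncd)|move=> _ /= /orP].
apply: (degree2 ab) => v; apply/idP/orP => [h|[]/eqP->//]; last by rewrite adj_sym.
have := cl d v dZ h; rewrite Zcd !inE; case: (eqVneq v d) h => [->|_]; first by rewrite adj_irr.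
by case: (eqVneq v c) => [->|_]; [rewrite adj_sym (negbTE ncd)|move=> _ /= /orP].
Qed.

Lemma sep2_two a b Z : sep2 a b Z -> small a b Z \/ small a b (coside a b Z).
Proof.
move=> s2; have s2' := sep2_coside s2; have [[ab aZ bZ _ _] cl] := s2.
case: (pselect (rep (@adj G) (~: Z) [set a; b])) => [r|nr]; [right|by left; apply: sep2_small].
apply: sep2_small => // r'; apply: (not_rep hmin).
apply: (rep_union r' r) (@sep_setT _ _ _) _ _ => x; rewrite !inE.
  by case: (x \in Z) => //=; rewrite orbT.
by case: (x \in Z) => //=; rewrite !negb_and !negbK => ->.
Qed.

(** With [a] and [b] such a side has at most six vertices and is representable by itself, so the
    other side cannot be. *)
Lemma sep2_le4 a b Z : sep2 a b Z -> #|Z| <= 4 -> small a b Z.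
Proof.
move=> s2 Z4; have [[ab aZ bZ _ _] cl] := s2; apply: sep2_small => // r; apply: (not_rep hmin).
have r' : rep (@adj G) (Z :|: [set a; b]) [set a; b].
  apply: rep_small; first by move=> x xS; rewrite inE xS orbT.
  - by rewrite cards2 ab.
  - move=> u v; rewrite !inE => uZ nu; rewrite (negbTE nu) orbF in uZ; rewrite negb_or => /andP[vZ nv].
    by apply/negP=> /(cl u v uZ); rewrite (negbTE vZ) (negbTE nv).
  - by apply: leq_trans Z4; apply: subset_leq_card; rewrite setDUl setDv setU0 subsetDl.
apply: (rep_union r' r) (@sep_setT _ _ _) _ _ => x; rewrite !inE.
  by case: (x \in Z) => //=; rewrite orbT.
by case: (x \in Z) => //=; rewrite andbb.
Qed.
End SmallSide.

(** * Suppressing vertices of degree 2 *)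

Section Suppress.
Variable G : sgraph.
Hypothesis hmin : minor_minimal_mmw_ge3 G.
Implicit Types (Z S E X : {set G}) (a b c d u v : G).

Definition deg2 v := degree v == 2.
Definition nbr2 c a b := forall v, adj c v = (v == a) || (v == b).

Lemma ex_outside X : #|X| <= 6 -> exists y, y \notin X.
Proof.
move=> X6; apply: contrapT => no; have := card_ge7 hmin; rewrite ltnNge -cardsT.
rewrite (leq_trans _ X6) //; apply: subset_leq_card; apply/subsetP=> y _.
by apply: contraT => yX; case: no; exists y.
Qed.

Lemma card_seqset (s : seq G) : #|[set x in s]| <= size s.
Proof. by rewrite cardsE card_size. Qed.

Lemma ex_outside_seq (s : seq G) : size s <= 6 -> exists y, y \notin s.
Proof.
by move=> s6; have [y] := ex_outside (leq_trans (card_seqset s) s6); rewrite inE; exists y.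
Qed.

Lemma deg2P c : deg2 c -> exists a b, a != b /\ nbr2 c a b.
Proof.
rewrite /deg2 /degree => /cards2P[a [b [ab E]]]; exists a, b; split=> // v.
by have /setP/(_ v) := E; rewrite !inE.
Qed.

Lemma nbr2C c a b : nbr2 c a b -> nbr2 c b a.
Proof. by move=> h v; rewrite h orbC. Qed.

Lemma nbr2_neq c a b : nbr2 c a b -> (c != a) && (c != b).
Proof. by move=> h; have := h c; rewrite adj_irr => /esym/negbT; rewrite negb_or. Qed.

Section Chain.
Variables a c d b : G.
Hypotheses (nc : nbr2 c a d) (nd : nbr2 d b c) (ad : a != d) (bc : b != c).

Lemma chain_neq : a != b.
Proof.
apply/eqP=> e; have [y] := @ex_outside_seq [:: a; c; d] isT.
have /andP[ca cd] := nbr2_neq nc.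
rewrite !inE !negb_or => /and3P[ya yc yd].
apply: (@no_cut1 _ hmin [set c; d] [set a] c y); rewrite ?cards1 ?inE ?eqxx ?negb_or ?yc //.
  by move=> u /set2P[]->; rewrite inE // eq_sym.
move=> u v /set2P[]->; rewrite ?nc ?nd !inE -?e; by case/orP=> ->; rewrite ?orbT.
Qed.

Lemma chain_sep2 : sep2 a b [set c; d].
Proof.
have /andP[ca cd] := nbr2_neq nc; have /andP[db _] := nbr2_neq nd.
have [y] := @ex_outside_seq [:: a; c; d; b] isT.
rewrite !inE !negb_or => /and4P[ya yc yd yb]; split.
  split; rewrite ?chain_neq ?inE ?negb_or ?ad ?bc ?andbT //; try by rewrite eq_sym.
    by exists c; rewrite !inE eqxx.
  by exists y; rewrite !inE negb_or yc yd ya yb.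
move=> u v /set2P[]->; rewrite ?nc ?nd !inE; by case/orP=> ->; rewrite ?orbT.
Qed.

(** Otherwise [a], [c], [d] are cut off from the rest by one or two vertices; one is impossible by
    [no_cut1], and with two [sep2_le4] allows only two vertices on that side. *)
Lemma chain_end : ~~ deg2 a.
Proof.
have /andP[ca cd] := nbr2_neq nc; have /andP[db _] := nbr2_neq nd.
have ab := chain_neq.
have acc : adj a c by rewrite adj_sym nc eqxx.
apply/negP=> /deg2P[p [q [pq nab]]].
have [p' [p'c na]] : exists p', p' != c /\ nbr2 a p' c.
  move: acc; rewrite nab => /orP[]/eqP e; [exists q|exists p]; rewrite e; split=> //.
  - by rewrite eq_sym.
  - exact: nbr2C.
have p'd : p' != d.
  apply/eqP=> e; have := na d; rewrite e eqxx adj_sym nd.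
  by rewrite (negbTE ab) /= => /eqP e'; rewrite e' eqxx in ca.
have p'a : p' != a by have /andP[] := nbr2_neq na; rewrite eq_sym.
pose Z := [set x in [:: a; c; d]].
have [y] := @ex_outside_seq [:: a; c; d; b; p'] isT.
rewrite !inE !negb_or => /and5P[ya yc yd yb yp'].
have clZ u v : u \in Z -> adj u v -> [|| v \in Z, v == p' | v == b].
  rewrite inE !inE => /or3P[]/eqP->; rewrite ?na ?nc ?nd; by case/orP=> ->; rewrite ?orbT.
have aZ : a \in Z by rewrite !inE eqxx.
have yZ : y \notin Z by rewrite !inE !negb_or ya yc.
have bZ : b \notin Z by rewrite !inE !negb_or eq_sym ab bc eq_sym.
case: (eqVneq p' b) => [e|p'b].
  apply: (@no_cut1 _ hmin Z [set b] a y); rewrite ?cards1 ?in_set1 //.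
    by move=> u uZ; rewrite inE; apply: contraTneq uZ => ->.
  by move=> u v uZ /(clZ u v uZ); rewrite e orbb in_set1.
have s2 : sep2 p' b Z.
  split=> //; split=> //; first by rewrite !inE !negb_or p'a p'c.
    by exists a.
  by exists y; rewrite yZ yp'.
have [_ +  _] := sep2_le4 hmin s2 (leq_trans (card_seqset [:: a; c; d]) (isT : 3 <= 4)).
have -> // : #|Z| = 3.
have -> : Z = a |: [set c; d] by apply/setP=> x; rewrite !inE.
by rewrite cardsU1 cards2 cd !inE negb_or ad [a == c]eq_sym ca.
Qed.
End Chain.

(** By [chain_end] at most two vertices of degree 2 are consecutive, so passing through one further
    vertex is enough to reach both ends. *)
Definition ends c := [set x | ~~ deg2 x && (adj c x || [exists d, [&& deg2 d, adj c d & adj d x]])].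

Definition deg2_one c := exists a b, [/\ [/\ a != b, ~~ deg2 a, ~~ deg2 b & ~~ adj a b],
  nbr2 c a b & ends c = [set a; b]].
Definition deg2_two c := exists a d b, [/\ [/\ a != b, ~~ deg2 a, ~~ deg2 b & ~~ adj a b],
  deg2 d, nbr2 c a d, nbr2 d b c & ends c = [set a; b] /\ ends d = [set a; b]].

Lemma chain_two c a d : deg2 c -> deg2 d -> nbr2 c a d -> a != d -> deg2_two c.
Proof.
move=> c2 d2 nc ad.
have adc : adj d c by rewrite adj_sym nc eqxx orbT.
have [b [bc nd]] : exists b, b != c /\ nbr2 d b c.
  have [p [q [pq nd]]] := deg2P d2.
  move: adc; rewrite nd => /orP[]/eqP e; [exists q|exists p]; rewrite e; split=> //.
    by rewrite eq_sym.
  exact: nbr2C.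
exists a, d, b; have a2 := chain_end nc nd ad bc; have b2 := chain_end nd nc bc ad.
have endE c' d' a' b' : deg2 c' -> deg2 d' -> nbr2 c' a' d' -> nbr2 d' b' c' -> ~~ deg2 a' -> ~~ deg2 b' ->
    ends c' = [set a'; b'].
  move=> c2' d2' nc' nd' a2' b2'; apply/setP=> x; rewrite !inE nc'; apply/andP/orP.
    case=> x2 /orP[/orP[->|/eqP e]|/existsP[y /and3P[y2]]]; [by left|by rewrite e d2' in x2|].
    rewrite nc' => /orP[]/eqP e; rewrite e in y2 *; first by rewrite y2 in a2'.
    by rewrite nd' => /orP[->|/eqP e']; [right|rewrite e' c2' in x2].
  case=> /eqP->; rewrite ?a2' ?b2' ?eqxx //; split=> //; apply/orP; right.
  by apply/existsP; exists d'; rewrite d2' nc' nd' !eqxx orbT.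
have [nab _ _] : small a b [set c; d].
  by apply: sep2_le4 hmin _ _ _ (chain_sep2 nc nd ad bc) _; rewrite cards2; case: eqP.
split=> //; first by split=> //; apply: chain_neq nc nd ad.
by split; [apply: (endE c d)|rewrite setUC; apply: (endE d c)].
Qed.

Lemma deg2_cases c : deg2 c -> deg2_one c \/ deg2_two c.
Proof.
move=> c2; have [p [q [pq nc]]] := deg2P c2.
case: (boolP (deg2 q)) => q2; first by right; apply: chain_two q2 nc pq.
case: (boolP (deg2 p)) => p2.
  by right; apply: chain_two p2 (nbr2C nc) _ => //; rewrite eq_sym.
left; exists p, q; have /andP[cp cq] := nbr2_neq nc; split=> //.
- split=> //.
  have [nab _ _] // : small p q [set c].
  have [y] := @ex_outside_seq [:: p; c; q] isT; rewrite !inE !negb_or => /and3P[yp yc yq].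
  apply: (sep2_le4 hmin); last by rewrite cards1.
  split; last by move=> u v /set1P->; rewrite nc inE => ->; rewrite orbT.
  split; rewrite ?inE //; try by rewrite eq_sym.
    by exists c; rewrite inE.
  by exists y; rewrite inE yp yc.
- apply/setP=> x; rewrite !inE nc; apply/andP/idP => [[x2 /orP[//|/existsP[y /and3P[y2]]]]|].
    by rewrite nc => /orP[]/eqP e; move: y2; rewrite e ?(negbTE p2) ?(negbTE q2).
  by case/orP=> /eqP->; rewrite ?p2 ?q2 ?eqxx ?orbT.
Qed.

Lemma endsP c : deg2 c -> exists a b, [/\ a != b, ~~ deg2 a, ~~ deg2 b, ~~ adj a b & ends c = [set a; b]].
Proof.
by case/deg2_cases=> [[a [b [[h1 h2 h3 h4] _ h5]]]|[a [d [b [[h1 h2 h3 h4] _ _ _ [h5 _]]]]]]; exists a, b.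
Qed.

Lemma ends_card c : deg2 c -> #|ends c| = 2.
Proof. by case/endsP=> a [b [ab _ _ _ ->]]; rewrite cards2 ab. Qed.

Lemma ends_deg c x : x \in ends c -> ~~ deg2 x.
Proof. by rewrite inE => /andP[]. Qed.

Lemma ends_adj c x : ~~ deg2 x -> adj c x -> x \in ends c.
Proof. by rewrite inE => -> ->. Qed.

Lemma ends_eq c d : deg2 c -> deg2 d -> adj c d -> ends c = ends d.
Proof.
case/deg2_cases=> [[a [b [[_ a2 b2 _] nc _]]]|[a [d' [b [[_ a2 _ _] _ nc _ [-> <-]]]]]] d2.
  by rewrite nc => /orP[]/eqP e; move: a2 b2; rewrite -e d2.
by rewrite nc => /orP[]/eqP e; [rewrite -e d2 in a2|rewrite e].
Qed.

Definition between E := [set c | deg2 c && (ends c == E)].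
(** The component of [c] among the vertices of degree 2; chains being short, it consists of [c] and
    its neighbours of degree 2. *)
Definition comp2 c := [set d | deg2 d && ((d == c) || adj c d)].

Lemma comp2_between c E x : c \in between E -> x \in comp2 c -> x \in between E.
Proof.
rewrite !inE => /andP[c2 /eqP <-] /andP[x2]; rewrite x2 => /orP[/eqP->|acx]; first by rewrite eqxx.
by rewrite (ends_eq c2 x2 acx) eqxx.
Qed.

Lemma comp2_refl c : deg2 c -> c \in comp2 c.
Proof. by rewrite !inE eqxx => ->. Qed.

Lemma comp2_closed c u v : deg2 c -> u \in comp2 c -> deg2 v -> adj u v -> v \in comp2 c.
Proof.
move=> c2; rewrite !inE => /andP[u2 /orP[/eqP->|acu]] v2; first by rewrite v2 => ->; rewrite orbT.
case/deg2_cases: c2 => [[a [b [[_ a2 b2 _] nc _]]]|[a [d [b [[_ a2 b2 _] _ nc nd _]]]]].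
  by move: acu; rewrite nc => /orP[]/eqP e; move: a2 b2; rewrite -e u2.
move: acu; rewrite nc => /orP[]/eqP e; first by rewrite -e u2 in a2.
by rewrite e nd v2 => /orP[/eqP e'|->//]; rewrite e' (negbTE b2) in v2.
Qed.

Lemma comp2_card c : deg2 c -> #|comp2 c| <= 2.
Proof.
move=> c2; case/deg2_cases: (c2) => [[a [b [[_ a2 b2 _] nc _]]]|[a [d [b [[_ a2 b2 _] _ nc nd _]]]]].
  apply: leq_trans (card_seqset [:: c; c]); apply: subset_leq_card; apply/subsetP=> x.
  rewrite !inE nc => /andP[x2 /or3P[->//|/eqP e|/eqP e]].
    by rewrite -e x2 in a2.
  by rewrite -e x2 in b2.
apply: leq_trans (card_seqset [:: c; d]); apply: subset_leq_card; apply/subsetP=> x.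
by rewrite !inE nc => /andP[x2 /or3P[->|/eqP e|->]]; rewrite ?orbT //; rewrite -e x2 in a2.
Qed.

(** As [X] is closed under adjacency among vertices of degree 2, its only outer neighbours are [a]
    and [b], so it is a side of a 2-separation. *)
Lemma between_small a b X : a != b -> X \subset between [set a; b] -> (exists x, x \in X) ->
  (forall u v, u \in X -> deg2 v -> adj u v -> v \in X) -> #|X| <= 4 -> small a b X.
Proof.
move=> ab /subsetP XI [x xX] clX X4.
have XE u : u \in X -> deg2 u /\ ends u = [set a; b] by move/XI; rewrite inE => /andP[? /eqP].
have [_ ex] := XE x xX.
have a2 : ~~ deg2 a by apply: (@ends_deg x); rewrite ex !inE eqxx.
have b2 : ~~ deg2 b by apply: (@ends_deg x); rewrite ex !inE eqxx orbT.
have [y] : exists y, y \notin X :|: [set a; b].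
  by apply: ex_outside; apply: leq_trans (leq_card_setU _ _).1 _; rewrite cards2 ab addn2 !ltnS.
rewrite !inE !negb_or => /and3P[yX ya yb].
apply: (sep2_le4 hmin) => //; split.
  split=> //; try by [exists x|exists y; rewrite yX ya].
    by apply/negP=> /XE[]; rewrite (negbTE a2).
  by apply/negP=> /XE[]; rewrite (negbTE b2).
move=> u v uX auv; case: (boolP (deg2 v)) => v2; first by rewrite (clX u).
by have := ends_adj v2 auv; have [_ ->] := XE u uX; rewrite !inE => ->; rewrite orbT.
Qed.

Lemma between_nadj a b c : a != b -> c \in between [set a; b] -> ~~ adj a b.
Proof.
rewrite inE => ab /andP[c2 /eqP e]; have [a' [b' [_ _ _ nab e']]] := endsP c2.
apply: contra nab => aab; have E : [set a; b] = [set a'; b'] by rewrite -e -e'.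
have := is_pairP aab E; rewrite /is_pair => /orP[]/andP[/eqP ea /eqP eb]; rewrite -ea -eb //.
by rewrite adj_sym.
Qed.

(** The two components have at most four vertices together, so [between_small] leaves at most two in
    their union, and these are [c] and [c']. *)
Lemma comp2_pair a b c c' : a != b -> c \in between [set a; b] -> c' \in between [set a; b] -> c != c' ->
  forall x, x \in comp2 c -> (x == c) || (x == c').
Proof.
move=> ab cI cI' cc'; have c2 : deg2 c by move: cI; rewrite inE => /andP[].
have c2' : deg2 c' by move: cI'; rewrite inE => /andP[].
have [_ X2 _] : small a b (comp2 c :|: comp2 c').
  apply: between_small => //.
  - by apply/subsetP=> x /setUP[]; apply: comp2_between.
  - by exists c; rewrite inE comp2_refl.
  - by move=> u v /setUP[] uX v2 auv; rewrite inE (comp2_closed _ uX) ?orbT.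
  - by apply: leq_trans (leq_card_setU _ _).1 _; apply: (leq_add (comp2_card c2) (comp2_card c2')).
have E : [set c; c'] = comp2 c :|: comp2 c'.
  apply/eqP; rewrite eqEcard cards2 cc' X2 andbT; apply/subsetP=> x /set2P[]->.
    by rewrite inE comp2_refl.
  by rewrite inE (comp2_refl c2') orbT.
by move=> x xc; have : x \in [set c; c'] by [rewrite E inE xc]; rewrite !inE.
Qed.

(** By [comp2_pair] the three vertices are closed under adjacency among vertices of degree 2, so
    [between_small] applies to them and allows only two. *)
Lemma between_three a b x1 x2 x3 : a != b -> x1 \in between [set a; b] -> x2 \in between [set a; b] ->
  x3 \in between [set a; b] -> x1 != x2 -> x1 != x3 -> x2 != x3 -> False.
Proof.
move=> ab i1 i2 i3 n12 n13 n23.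
have X3 : small a b [set x in [:: x1; x2; x3]].
  apply: between_small => //; last exact: leq_trans (card_seqset [:: x1; x2; x3]) (isT : 3 <= 4).
  - by apply/subsetP=> x; rewrite inE !in_cons orbF => /or3P[]/eqP->.
  - by exists x1; rewrite !inE eqxx.
  - move=> u v uX v2 auv.
    have step w w' : w \in between [set a; b] -> w' \in between [set a; b] -> w != w' -> adj w v ->
        (v == w) || (v == w').
      by move=> wi wi' nw awv; apply: (comp2_pair ab wi wi' nw); rewrite !inE v2 awv orbT.
    move: uX auv; rewrite inE !in_cons orbF => /or3P[]/eqP->.
    + by move/(step _ _ i1 i2 n12); rewrite !inE => /orP[]->; rewrite ?orbT.
    + by move/(step _ _ i2 i3 n23); rewrite !inE => /orP[]->; rewrite ?orbT.
    + rewrite eq_sym in n13; by move/(step _ _ i3 i1 n13); rewrite !inE => /orP[]->; rewrite ?orbT.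
case: X3 => _ + _; have -> // : #|[set x in [:: x1; x2; x3]]| = 3.
have -> : [set x in [:: x1; x2; x3]] = x1 |: [set x2; x3] by apply/setP=> x; rewrite !inE.
by rewrite cardsU1 cards2 n23 !inE negb_or n12 n13.
Qed.

Lemma between_card a b : a != b -> #|between [set a; b]| <= 2.
Proof.
move=> ab; rewrite leqNgt; apply/negP=> /card_gt2P[x1 [x2 [x3 [[i1 i2 i3] [n1 n2 n3]]]]].
by apply: (between_three ab i1 i2 i3); rewrite // eq_sym.
Qed.

Lemma between_eq a b c d : a != b -> c \in between [set a; b] -> d \in between [set a; b] -> c != d ->
  between [set a; b] = [set c; d].
Proof.
move=> ab ci di cd; apply/esym/eqP; rewrite eqEcard cards2 cd between_card // andbT.
by apply/subsetP=> x /set2P[]->.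
Qed.
End Suppress.


Lemma conn_star (V : finType) (e : rel V) (C : {set V}) z : symmetric e ->
  (forall u, u \in C -> u != z -> e u z) -> z \in C -> conn e C.
Proof.
move=> e_sym star zC X hX.
have toz u : u \in C -> u \in X = (z \in X).
  move=> uC; case: (eqVneq u z) => [->//|uz]; have euz := star u uC uz.
  by apply/idP/idP => h; [apply: (hX u)|apply: (hX z)] => //; rewrite e_sym.
by move=> x y xC yC; rewrite !toz.
Qed.

(** Descend while one branch contains all vertices. At the last node each branch misses a vertex, so
    it has nothing outside its tree edge, since two vertices do not separate [H]; the bag of that
    node is everything. *)
Lemma rep_3connected (H : sgraph) (W S : {set H}) :
  (forall S' : {set H}, #|S'| <= 2 -> connected_outside S') ->
  rep (@adj H) W S -> W = setT -> #|H| <= 6.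
Proof.
move=> con; elim=> {W S} [S S2 e|W S W1 S1 W2 S2 r1 IH1 r2 IH2 cS _ eW _ _ _ WT].
  by rewrite -cardsT -e (leq_trans S2).
have small (Wi Si : {set H}) : rep (@adj H) Wi Si -> Wi <> setT -> Wi \subset Si.
  move=> ri nT; apply/subsetP=> x xW; apply: contraT => xS.
  have [y yW] : exists y, y \notin Wi.
    by apply: contrapT => no; apply: nT; apply/setP=> y; rewrite inE; apply: contraT => yW; case: no; exists y.
  have yS : y \notin Si by apply: contra yW => /(rep_sub ri).
  have /setDP[] : y \in Wi :\: Si; last by rewrite (negbTE yW).
  apply: (connect_inv _ _ (con Si (rep_card ri) x y xS yS)); last by rewrite inE xS.
  move=> u v /setDP[uW uS] /and3P[_ vS auv]; rewrite inE vS /=.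
  by apply: contraT => vW; have := rep_sep ri uW uS vW; rewrite auv.
case: (pselect (W1 = setT)) => [/IH1//|/(small _ _ r1) sub1].
case: (pselect (W2 = setT)) => [/IH2//|/(small _ _ r2) sub2].
have sub : W \subset S1 :|: S2 :|: S.
  apply/subsetP=> x; rewrite eW !inE => /or3P[/(subsetP sub1)->|/(subsetP sub2)->|->]; by rewrite ?orbT.
rewrite -cardsT -WT; apply: leq_trans (subset_leq_card sub) _.
apply: leq_trans (leq_card_setU _ _).1 _; apply: (@leq_add _ _ 4 2) => //.
apply: leq_trans (leq_card_setU _ _).1 _.
exact: leq_add (rep_card r1) (rep_card r2).
Qed.

(** * The graph obtained by suppressing the vertices of degree 2 *)

Section Core.
Variable G : sgraph.

Definition core_adj : rel {x : G | ~~ deg2 x} := fun u v => (u != v) &&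
  (adj (val u) (val v) || (between [set val u; val v] != set0)).

Lemma core_sym : symmetric core_adj.
Proof. by move=> u v; rewrite /core_adj eq_sym adj_sym setUC. Qed.

Lemma core_irr : irreflexive core_adj.
Proof. by move=> u; rewrite /core_adj eqxx. Qed.

Definition core := SGraph core_sym core_irr.

Hypothesis hmin : minor_minimal_mmw_ge3 G.

(** A component of the core minus [S], with the vertices of degree 2 attached to it, is separated by
    [S] in [G]. By [sep2_two] one of the two sides would have only vertices of degree 2, but both
    contain a core vertex. *)
Lemma core_connected (S : {set core}) : #|S| <= 2 -> connected_outside S.
Proof.
move=> S2 x y xS yS; apply: contraT => nxy; exfalso.
pose r (u v : core) := [&& u \notin S, v \notin S & adj u v].
pose X := [set z | connect r x z].
have XS u : u \in X -> u \notin S.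
  rewrite inE => uX; suff : u \in ~: S by rewrite inE.
  apply: (connect_inv _ _ uX); last by rewrite inE.
  by move=> p q _ /and3P[_ qS _]; rewrite inE.
have Xstep u v : u \in X -> v \notin S -> adj u v -> v \in X.
  move=> uX vS auv; have uS := XS u uX.
  rewrite inE in uX; rewrite inE; apply: connect_trans uX (connect1 _); by rewrite /r uS vS.
pose Z := [set v : G | [exists z in X, (v == val z) || deg2 v && (val z \in ends v)]].
have inZ v z : z \in X -> (v == val z) || deg2 v && (val z \in ends v) -> v \in Z.
  by move=> zX h; rewrite inE; apply/exists_inP; exists z.
pose S' := [set val s | s in S].
have S'2 : #|S'| <= 2 by apply: leq_trans (leq_imset_card _ _) S2.
have ZS u : u \in Z -> u \notin S'.
  rewrite inE => /exists_inP[z zX h]; apply/imsetP=> -[s sS e].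
  case/orP: h => [/eqP ez|/andP[u2 _]]; last by have := valP s; rewrite /= -e u2.
  by have := XS z zX; have -> : z = s by [apply: val_inj; rewrite -ez -e]; rewrite sS.
have cl u v : u \in Z -> adj u v -> (v \in Z) || (v \in S').
  rewrite inE => /exists_inP[z zX h] auv.
  case: (boolP (v \in S')) => vS; rewrite ?orbT // orbF.
  case: (boolP (deg2 v)) => v2.
    apply: (inZ v z zX); rewrite v2 /=; case/orP: h => [/eqP ez|/andP[u2 zE]].
      by rewrite (ends_adj (valP z)) ?orbT // -ez adj_sym.
    by rewrite -(ends_eq hmin u2 v2 auv) zE orbT.
  pose w : core := exist (fun x => ~~ deg2 x) v v2.
  have wS : w \notin S by apply: contra vS => wS; apply/imsetP; exists w.
  case: (eqVneq z w) => [zw|zw]; first by apply: (inZ v z zX); rewrite zw eqxx.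
  apply: (inZ v w); last by rewrite eqxx.
  apply: (Xstep z) => //=; rewrite /core_adj zw /=.
  case/orP: h => [/eqP ez|/andP[u2 zE]]; first by rewrite -ez auv.
  apply/orP; right; apply/set0Pn; exists u; rewrite inE u2 /= eq_sym eqEcard ends_card // cards2.
  have -> : val z != v by rewrite -[v]/(val w) (inj_eq val_inj).
  rewrite andbT; apply/subsetP=> t /set2P[]-> //; exact: ends_adj.
have xZ : val x \in Z by apply: (inZ _ x); rewrite ?eqxx // inE.
have yZ : val y \notin Z.
  rewrite inE; apply/exists_inP=> -[z zX /orP[/eqP e|/andP[y2]]]; last by have := valP y; rewrite /= y2.
  have ez : y = z by apply: val_inj.
  by move: zX; rewrite -ez inE; apply/negP.
have yS' : val y \notin S' by rewrite (mem_imset _ _ val_inj).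
case: (leqP #|S'| 1) => [S1|S'3]; first exact: (no_cut1 hmin S1 xZ yZ yS' ZS cl).
have /cards2P[a [b [ab eS]]] : #|S'| == 2 by rewrite eqn_leq S'2.
rewrite eS in ZS cl yS'.
have s2 : sep2 a b Z.
  split.
    split=> //; try by apply/negP=> /ZS; rewrite !inE eqxx ?orbT.
      by exists (val x).
    by exists (val y); rewrite yZ; move: yS'; rewrite !inE negb_or.
  by move=> u v uZ auv; have := cl u v uZ auv; rewrite !inE.
case: (sep2_two hmin s2) => [[_ _ /(_ _ xZ) d]|[_ _ /(_ (val y))]].
  by have := valP x; rewrite /= /deg2 d.
have -> : val y \in coside a b Z by rewrite in_set yZ; move: yS'; rewrite !inE negb_or.
move/(_ isT) => d.
by have := valP y; rewrite /= /deg2 d.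
Qed.

(** With at most two core vertices [between_card] leaves at most four vertices in all. With three,
    [G] is a triangle of pieces of at most four vertices; two of them are joined in series and the
    third is glued to the result. *)
Lemma core_ge4 : 3 < #|core|.
Proof.
pose D := [set x : G | ~~ deg2 x].
have cD : #|core| = #|D| by rewrite card_sig cardsE.
rewrite cD ltnNge; apply/negP=> D3.
have endsD c : ends c \subset D by apply/subsetP=> x /ends_deg; rewrite inE.
case: (leqP #|D| 2) => [D2|D3'].
  have [y] : exists y, y \notin D by apply: ex_outside; rewrite // (leq_trans D2).
  rewrite inE negbK => y2.
  have eD c : deg2 c -> ends c = D by move=> c2; apply/eqP; rewrite eqEcard endsD ends_card.
  have [a [b [ab _ _ _ e]]] := endsP hmin y2; rewrite eD // in e.
  have [z] : exists z, z \notin D :|: between [set a; b].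
    apply: ex_outside => //; apply: leq_trans (leq_card_setU _ _).1 _.
    by apply: (@leq_add _ _ 2 4) => //; apply: leq_trans (between_card hmin ab) _.
  by rewrite !inE negb_or negbK => /andP[z2]; rewrite z2 eD // e eqxx.
have {D3 D3'} /eqP D3 : #|D| == 3 by rewrite eqn_leq D3.
have /card_gt2P[a [b [c [[aD bD cD'] [ab bc ca]]]]] : 2 < #|D| by rewrite D3.
have eD : D = [set x in [:: a; b; c]].
  apply/esym/eqP; rewrite eqEcard D3; apply/andP; split.
    by apply/subsetP=> x; rewrite inE !in_cons orbF => /or3P[]/eqP->.
  have -> : [set x in [:: a; b; c]] = a |: [set b; c] by apply/setP=> x; rewrite !inE.
  by rewrite cardsU1 cards2 bc !inE negb_or ab [a == c]eq_sym ca.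
have inD x : ~~ deg2 x = [|| x == a, x == b | x == c].
  by have /setP/(_ x) := eD; rewrite !inE.
have [a2 b2 c2] : [/\ ~~ deg2 a, ~~ deg2 b & ~~ deg2 c] by rewrite !inD !eqxx !orbT.
have ba : b != a by rewrite eq_sym.
have cb : c != b by rewrite eq_sym.
have ac : a != c by rewrite eq_sym.
pose W (p q : G) := [set p; q] :|: between [set p; q].
have inW p q x : (x \in W p q) = [|| x == p, x == q | deg2 x && (ends x == [set p; q])] by rewrite !inE -orbA.
have rW p q : p != q -> ~~ deg2 p -> ~~ deg2 q -> rep (@adj G) (W p q) [set p; q].
  move=> pq p2 q2; apply: rep_small.
  - by move=> x xS; rewrite inE xS.
  - by rewrite cards2 pq.
  - move=> u v; rewrite inW !inE => uW nu vW; apply/negP=> auv; case/negP: vW.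
    move: uW; rewrite orbA (negbTE nu) /= => /andP[u2 /eqP eu].
    case: (boolP (deg2 v)) => v2; first by rewrite -(ends_eq hmin u2 v2 auv) eu eqxx !orbT.
    by have := ends_adj v2 auv; rewrite eu !inE => ->.
  - apply: leq_trans (subset_leq_card _) (leq_trans (between_card hmin pq) _) => //.
    by rewrite setDUl setDv set0U subsetDl.
have endcase x : deg2 x -> [\/ ends x = [set a; b], ends x = [set b; c] | ends x = [set a; c]].
  move=> x2; have [p [q [pq p2 q2 _ ->]]] := endsP hmin x2.
  move: p2 q2 pq; rewrite !inD => /or3P[]/eqP-> /or3P[]/eqP->; rewrite ?eqxx // => _;
    by [apply: Or31|apply: Or32|apply: Or33|apply: Or31; rewrite setUC|apply: Or32; rewrite setUC|apply: Or33; rewrite setUC].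
have nE1 : [set a; b] == [set b; c] = false.
  by apply/eqP=> /setP/(_ a); rewrite !inE eqxx (negbTE ab) (negbTE ac).
have nE2 : [set a; b] == [set a; c] = false.
  by apply/eqP=> /setP/(_ b); rewrite !inE eqxx (negbTE ba) (negbTE bc).
have nE3 : [set b; c] == [set a; c] = false.
  by apply/eqP=> /setP/(_ b); rewrite !inE eqxx (negbTE ba) (negbTE bc).
have nE1' : [set b; c] == [set a; b] = false by rewrite eq_sym.
have nE2' : [set a; c] == [set a; b] = false by rewrite eq_sym.
have nE3' : [set a; c] == [set b; c] = false by rewrite eq_sym.
have nE := (nE1, nE2, nE3, nE1', nE2', nE3').
have d2E (x y : G) : deg2 x -> ~~ deg2 y -> (x == y) = false.
  by move=> x2; apply: contraNF => /eqP <-.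
have rS : rep (@adj G) (W a b :|: W b c) [set a; c].
  apply: (rep_series (rW a b ab a2 b2) (rW b c bc b2 c2)).
  - move=> u v uW nu vW; rewrite in_setU !inW in uW; rewrite in_setU !inW in vW.
    rewrite !inE negb_or in nu; case/andP: nu => ua uc.
    apply/negP=> auv; case/negP: vW; rewrite (negbTE ua) (negbTE uc) /= in uW.
    case: (boolP (deg2 v)) => v2; last by move: (v2); rewrite inD => /or3P[]->; rewrite ?orbT.
    case: (boolP (deg2 u)) => u2 /=.
      rewrite u2 (d2E u b) //= in uW; rewrite -(ends_eq hmin u2 v2 auv).
      by case/orP: uW => ->; rewrite ?orbT.
    rewrite (negbTE u2) /= !orbF in uW; have {uW} /eqP ub : u == b by case/orP: uW.
    have : b \in ends v by apply: ends_adj; rewrite // -ub adj_sym.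
    case: (endcase v v2) => ->; rewrite ?eqxx ?orbT //.
    by rewrite !inE (negbTE ba) (negbTE bc).
  - by move=> x; rewrite inE.
  - move=> x; rewrite !inW; case: (boolP (deg2 x)) => x2.
      rewrite !d2E //= => /eqP e1 /eqP e2; by have := nE1; rewrite -e1 -e2 eqxx.
    rewrite /= !orbF => h1 h2; apply/eqP; move: h1 h2; case: (eqVneq x b) => //= _; rewrite !orbF => /eqP->.
    by rewrite (negbTE ac).
  - by rewrite inW (negbTE ab) (negbTE ac) (negbTE a2).
  - by rewrite inW (negbTE ca) (negbTE cb) (negbTE c2).
apply: (not_rep hmin); apply: (rep_union rS (rW a c ac a2 c2)) (@sep_setT _ _ _) _ _ => x.
  rewrite in_setT in_setU !inW; apply/esym; case: (boolP (deg2 x)) => x2 /=.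
    by case: (endcase x x2) => ->; rewrite eqxx !orbT.
  by move: (x2); rewrite inD => /or3P[]->; rewrite ?orbT.
rewrite in_setU !inW !inE; case: (boolP (deg2 x)) => x2 /=.
  by rewrite !d2E //=; case: (endcase x x2) => ->; rewrite ?nE ?eqxx.
by rewrite !orbF andbb => _.
Qed.

Definition anchor (u : G) := odflt u [pick x | ~~ deg2 x && adj u x].

Lemma anchorP u : deg2 u -> ~~ deg2 (anchor u) && adj u (anchor u).
Proof.
move=> u2; rewrite /anchor; case: pickP => [x //|no]; exfalso.
by case: (deg2_cases hmin u2) => [[a [b [[_ a2 _ _] nu _]]]|[a [d [b [[_ a2 _ _] _ nu _ _]]]]];
  have := no a; rewrite a2 nu eqxx.
Qed.

Lemma core_le6 : (exists c : G, deg2 c) -> #|core| <= 6.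
Proof.
case=> c c2; have /andP[p2 acp] := anchorP c2; set p := anchor c in p2 acp.
have apc : adj p c by rewrite adj_sym.
have r := contract_rep hmin apc.
(* Each vertex of degree 2 joins the end at which it is anchored. The vertex [c] is dropped, and its
   other edge is inherited by [p]. *)
pose beta (v : core) : {set G} := [set u | (u != c) && ((u == val v) || (deg2 u && (anchor u == val v)))].
have vc (v : core) : val v != c by apply: contraTneq c2 => <-; apply: (valP v).
have own (v : core) : val v \in beta v by rewrite inE vc eqxx.
have ctr_adj u v : u != c -> v != c -> adj u v -> ctr p c u v.
  move=> uc vc' auv; apply/and4P; split=> //; last by rewrite auv.
  by apply: contraTneq auv => ->; rewrite adj_irr.
have anch u a d : deg2 u -> ~~ deg2 a -> deg2 d -> nbr2 u a d -> anchor u = a.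
  move=> u2 a2 d2 nu; have /andP[h1] := anchorP u2; rewrite nu => /orP[/eqP//|/eqP e].
  by rewrite e d2 in h1.
have edge (v w : core) : core_adj v w -> touch (ctr p c) (beta v) (beta w).
  case/andP=> vw /orP[auv|/set0Pn[u]].
    by exists (val v), (val w); split; rewrite ?own //; apply: ctr_adj.
  rewrite inE => /andP[u2 /eqP eu].
  have tC (v' w' : core) : touch (ctr p c) (beta v') (beta w') -> touch (ctr p c) (beta w') (beta v').
    by case=> s [t [h1 h2 h3]]; exists t, s; split=> //; rewrite ctr_sym.
  case: (deg2_cases hmin u2) => [[a [b [[ab a2 b2 _] nu e]]]|[a [d [b [[ab a2 b2 _] d2 nu nd [e ed]]]]]].
    have nvw : nbr2 u (val v) (val w).
      by move=> t; rewrite nu; have /setP/(_ t) : [set a; b] = [set val v; val w] by [rewrite -e -eu]; rewrite !inE.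
    have half (v' w' : core) : val v' != val w' -> nbr2 u (val v') (val w') -> anchor u = val v' ->
        touch (ctr p c) (beta v') (beta w').
      move=> vw' nu' au; case: (eqVneq u c) => [uc|uc].
        exists (val v'), (val w'); split; rewrite ?own //; apply/and4P; split=> //.
        by rewrite /p -uc au eqxx nu' eqxx !orbT.
      exists u, (val w'); split; rewrite ?own //; first by rewrite inE uc u2 au eqxx orbT.
      by apply: ctr_adj; rewrite // nu' eqxx orbT.
    have /andP[_] := anchorP u2; rewrite nvw => /orP[]/eqP au; first exact: half.
    by apply/tC/half => //; [rewrite eq_sym|apply: nbr2C].
  (* The two vertices of a chain are anchored at different ends, so the middle edge, or what the
     contraction leaves of it, joins the two branch sets. *)
  have half (v' w' : core) : val v' = a -> val w' = b -> touch (ctr p c) (beta v') (beta w').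
    move=> ea eb; have au := anch u a d u2 a2 d2 nu; have ad := anch d b u d2 b2 u2 nd.
    have aud : adj u d by rewrite nu eqxx orbT.
    have ud : u != d by apply: contraTneq aud => ->; rewrite adj_irr.
    case: (eqVneq u c) => [uc|uc].
      have dc : d != c by rewrite -uc eq_sym.
      exists a, d; split; first by rewrite -ea own.
        by rewrite inE dc d2 ad eb eqxx orbT.
      apply/and4P; split=> //; first by rewrite -ea.
        by apply: contraTneq d2 => <-.
      by rewrite /p -uc au eqxx aud orbT.
    case: (eqVneq d c) => [dc|dc].
      exists u, b; split; last first.
      + apply/and4P; split=> //; first by rewrite -eb.
          by apply: contraTneq u2 => ->.
        by rewrite /p -dc ad eqxx [adj d u]adj_sym aud !orbT.
      + by rewrite -eb own.
      + by rewrite inE uc u2 au ea eqxx orbT.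
    exists u, d; split; [by rewrite inE uc u2 au ea eqxx orbT|by rewrite inE dc d2 ad eb eqxx orbT|].
    exact: ctr_adj.
  have /set2P ev : val v \in [set a; b] by rewrite -e eu !inE eqxx.
  have /set2P ew : val w \in [set a; b] by rewrite -e eu !inE eqxx orbT.
  case: ev ew => ev [] ew; try by case/eqP: vw; apply: val_inj; rewrite ev ew.
    exact: half.
  by apply/tC/half.
have rc : rep (@adj core) (trace beta [set~ c]) (trace beta set0).
  apply: (rep_push (beta := beta)) r => [v w x|v|//].
  - rewrite !inE => /andP[_ hv] /andP[_ hw]; apply: val_inj.
    case/orP: hv => [/eqP xv|/andP[x2 /eqP<-]]; case/orP: hw => [/eqP xw|/andP[x2' /eqP<-]] //.
    + by rewrite -xv.
    + by have := valP v; rewrite /= -xv x2'.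
    + by have := valP w; rewrite /= -xw x2.
  - apply: (@conn_star _ _ _ (val v) (@ctr_sym G p c)) (own v) => u.
    rewrite inE => /andP[uc /orP[->//|/andP[u2 /eqP <-]]] _.
    have /andP[h1 h2] := anchorP u2; apply: ctr_adj => //.
    by apply: contraTneq c2 => <-.
apply: (rep_3connected (@core_connected) rc); apply/setP=> v; rewrite [in RHS]inE.
by apply/traceP; exists (val v); rewrite ?own // !inE.
Qed.
End Core.

(** * The core and its subdivision *)

Section Iso.
Variable G : sgraph.
Hypothesis hmin : minor_minimal_mmw_ge3 G.
Let H := core G.
Implicit Types (E : {set H}) (c d u v : G) (x y z : H).

Definition inner E : {set G} := between (val @: E).

Definition kind E : subdivision :=
  if inner E == set0 then Keep else if #|inner E| == 1 then Sub1 else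
  if [exists c in inner E, exists d in inner E, adj c d] then Sub2 else Sub11.

Definition eset c : {set H} := [set x | val x \in ends c].

(* In the 11-case the two new vertices are matched with the two ends in the
   order of the enumerations. *)
Definition tag c : option H :=
  match kind (eset c) with
  | Sub2 => [pick x | adj c (val x)]
  | Sub11 => nth None [seq Some x | x <- enum (eset c)] (index c (enum (inner (eset c))))
  | _ => None
  end.

Definition newv c := (eset c, tag c).

Lemma val_eset c : val @: eset c = ends c.
Proof.
apply/setP=> v; apply/imsetP/idP => [[x]|ve]; first by rewrite inE => xe ->.
by exists (exist (fun v => ~~ deg2 v) v (ends_deg ve)); rewrite 1?in_set.
Qed.

Lemma inner_eset c : deg2 c -> c \in inner (eset c).
Proof. by rewrite inE val_eset eqxx andbT. Qed.

Lemma eset_inner c E : c \in inner E -> deg2 c /\ eset c = E.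
Proof.
rewrite inE => /andP[c2 /eqP e]; split=> //; apply: (imset_inj (f := val) val_inj).
by rewrite val_eset.
Qed.

Lemma eset_pair c a b : deg2 c -> ends c = [set a; b] -> a != b ->
  exists x y, [/\ x != y, val x = a, val y = b, eset c = [set x; y] & val @: eset c = [set a; b]].
Proof.
move=> c2 e ab.
have a2 : ~~ deg2 a by apply: (@ends_deg _ c); rewrite e !inE eqxx.
have b2 : ~~ deg2 b by apply: (@ends_deg _ c); rewrite e !inE eqxx orbT.
exists (exist (fun v => ~~ deg2 v) a a2), (exist (fun v => ~~ deg2 v) b b2); split=> //.
  by apply/setP=> z; rewrite [LHS]in_set e !inE -!val_eqE.
by rewrite val_eset.
Qed.

Definition one_case c := exists x y, [/\ x != y, eset c = [set x; y],
  nbr2 c (val x) (val y), inner (eset c) = [set c] & kind (eset c) = Sub1].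
Definition two_case c := exists x y d, [/\ [/\ x != y, eset c = [set x; y], c != d & adj c d],
  nbr2 c (val x) d, nbr2 d (val y) c, inner (eset c) = [set c; d] & kind (eset c) = Sub2].
Definition square_case c := exists x y d, [/\ [/\ x != y, eset c = [set x; y], c != d & ~~ adj c d],
  nbr2 c (val x) (val y), nbr2 d (val x) (val y), inner (eset c) = [set c; d] & kind (eset c) = Sub11].

(** A second vertex with the same ends either continues the chain of [c] or lies on a parallel path;
    [between_eq] excludes a third. *)
Lemma inner_cases c : deg2 c -> [\/ one_case c, two_case c | square_case c].
Proof.
move=> c2; have cI := inner_eset c2.
have n0 : inner (eset c) == set0 = false by apply/negbTE/set0Pn; exists c.
case: (deg2_cases hmin c2) => [[a [b [[ab a2 b2 _] nc e]]]|[a [d [b [[ab a2 b2 _] d2 nc nd [e ed]]]]]].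
  have [x [y [xy xa yb ex ev]]] := eset_pair c2 e ab.
  have iE : inner (eset c) = between [set a; b] by rewrite /inner ev.
  have nbr t : deg2 t -> adj c t = false.
    by move=> t2; rewrite nc; apply/negP=> /orP[]/eqP te; move: a2 b2; rewrite -te t2.
  case: (boolP [exists d in inner (eset c), d != c]) => [/exists_inP[d dI dc]|/exists_inPn no].
    have cd : c != d by rewrite eq_sym.
    have iE2 : inner (eset c) = [set c; d].
      by rewrite iE (between_eq hmin ab (c := c) (d := d)) // -iE.
    have [d2 ed] := eset_inner dI.
    have ncd := nbr d d2.
    have dends : ends d = [set a; b] by rewrite -val_eset ed.
    have nd : nbr2 d (val x) (val y).
      (* If [d] were in a chain of two, its partner would again lie between the same ends, but [c]
         is not adjacent to [d] and there is no third vertex. *)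
      case: (deg2_cases hmin d2) => [[a' [b' [_ nd e']]]|[a' [d' [b' [_ d2' nd _ _]]]]].
        by move=> v; rewrite nd xa yb; have /setP/(_ v) : [set a'; b'] = [set a; b] by [rewrite -e' -dends]; rewrite !inE.
      have add : adj d d' by rewrite nd eqxx orbT.
      have : d' \in inner (eset c).
        by rewrite inE d2' -(ends_eq hmin d2 d2' add) ev dends eqxx.
      rewrite iE2 => /set2P[] de; first by rewrite -de adj_sym add in ncd.
      by rewrite de adj_irr in add.
    apply: Or33; exists x, y, d; split=> //; rewrite ?xa ?yb ?ncd //.
    rewrite /kind n0 iE2 cards2 cd /=; case: ifP => // /exists_inP[p /set2P pE /exists_inP[q /set2P qE apq]].
    by case: pE apq => ->; case: qE => ->; rewrite ?adj_irr ?ncd // adj_sym ncd.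
  have iE1 : inner (eset c) = [set c].
    apply/setP=> t; rewrite [in RHS]inE; apply/idP/eqP => [tI|->//].
    by have := no t tI; rewrite negbK => /eqP.
  by apply: Or31; exists x, y; split; rewrite ?xa ?yb // /kind n0 iE1 cards1.
have [x [y [xy xa yb ex ev]]] := eset_pair c2 e ab.
have acd : adj c d by rewrite nc eqxx orbT.
have cd : c != d by apply: contraTneq acd => ->; rewrite adj_irr.
have dI : d \in inner (eset c) by rewrite inE d2 ev ed eqxx.
have iE : inner (eset c) = [set c; d].
  have iE : inner (eset c) = between [set a; b] by rewrite /inner ev.
  by rewrite iE (between_eq hmin ab (c := c) (d := d)) // -iE.
apply: Or32; exists x, y, d; split; rewrite ?xa ?yb //.
rewrite /kind n0 iE cards2 cd /=; case: ifP => // /exists_inP[].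
by exists c; [rewrite !inE eqxx|apply/exists_inP; exists d; rewrite ?inE ?eqxx ?orbT].
Qed.

Lemma pick_nbr c x d : deg2 d -> nbr2 c (val x) d -> [pick z : H | adj c (val z)] = Some x.
Proof.
move=> d2 nc; case: pickP => [z|/(_ x)]; last by rewrite nc eqxx.
rewrite nc => /orP[/eqP/val_inj->//|/eqP e]; by have := valP z; rewrite /= e d2.
Qed.

Lemma tag_square E c : kind E = Sub11 -> c \in inner E ->
  tag c = nth None [seq Some x | x <- enum E] (index c (enum (inner E))).
Proof. by move=> kE /eset_inner[_ e]; rewrite /tag e kE. Qed.

Lemma newv_valid c : deg2 c -> new_vertex kind (newv c).
Proof.
move=> c2; have cI := inner_eset c2.
have edge x y : x != y -> eset c = [set x; y] -> eset c \in edges H.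
  move=> xy e; apply/imsetP; exists (x, y) => //; rewrite inE /= /core_adj xy /=.
  by apply/orP; right; apply/set0Pn; exists c; move: cI; rewrite /inner e imsetU1 imset_set1.
rewrite /new_vertex /=.
case: (inner_cases c2) => [[x [y [xy e nc i k]]]|[x [y [d [[xy e cd acd] nc nd i k]]]]|[x [y [d [[xy e cd ncd] nc nd i k]]]]].
- by rewrite (edge x y) // /tag k.
- have d2 : deg2 d by have [] : deg2 d /\ eset d = eset c by apply: eset_inner; rewrite i !inE eqxx orbT.
  by rewrite (edge x y) // /tag k (pick_nbr d2 nc) e !inE eqxx.
- rewrite (edge x y) // k (tag_square k cI).
  have lt : index c (enum (inner (eset c))) < size (enum (eset c)).
    have : index c (enum (inner (eset c))) < size (enum (inner (eset c))) by rewrite index_mem mem_enum.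
    by rewrite -!cardE i e !cards2 cd xy.
  rewrite (nth_map x) // -(mem_enum (mem (eset c))); exact: mem_nth.
Qed.

(** The two vertices of a 2-subdivision are told apart by the end they are adjacent to, those of an
    11-subdivision by their positions in the enumeration. *)
Lemma newv_inj c d : deg2 c -> deg2 d -> newv c = newv d -> c = d.
Proof.
move=> c2 d2 [eE et]; have dI : d \in inner (eset c) by rewrite eE inner_eset.
have cI := inner_eset c2.
case: (inner_cases c2) => [[x [y [xy e nc i k]]]|[x [y [d' [[xy e cd acd] nc nd i k]]]]|[x [y [d' [[xy e cd ncd] nc nd i k]]]]].
- by move: dI; rewrite i => /set1P.
- move: dI; rewrite i => /set2P[//|dd]; rewrite -dd in nc nd.
  move: et; rewrite /tag -eE k (pick_nbr d2 nc) (pick_nbr c2 nd) => -[exy]; by rewrite exy eqxx in xy.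
- have lt t : t \in inner (eset c) -> index t (enum (inner (eset c))) < size (enum (eset c)).
    move=> tI; have : index t (enum (inner (eset c))) < size (enum (inner (eset c))) by rewrite index_mem mem_enum.
    by rewrite -!cardE i e !cards2 cd xy.
  move: et; rewrite (tag_square k cI) (tag_square k dI) !(nth_map x) ?lt // => -[] /eqP.
  rewrite nth_uniq ?enum_uniq ?lt // => /eqP ei.
  have cs : c \in enum (inner (eset c)) by rewrite mem_enum.
  have ds : d \in enum (inner (eset c)) by rewrite mem_enum.
  by rewrite -(nth_index c cs) -(nth_index c ds) ei.
Qed.

Lemma newv_surj n : new_vertex kind n -> exists2 c, deg2 c & newv c = n.
Proof.
case: n => E o /andP[/= EH ho].
have [c cI] : exists c, c \in inner E.
  by apply/set0Pn; apply: contraTneq ho => i; rewrite /kind i eqxx.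
have [c2 eE] := eset_inner cI; rewrite -eE in ho *.
case: (inner_cases c2) => [[x [y [xy e nc i k]]]|[x [y [d [[xy e cd acd] nc nd i k]]]]|[x [y [d [[xy e cd ncd] nc nd i k]]]]];
  rewrite k in ho.
- by exists c => //; rewrite /newv /tag k; case: o ho.
- have [d2 ed] : deg2 d /\ eset d = eset c by apply: eset_inner; rewrite i !inE eqxx orbT.
  case: o ho => // z; rewrite e => /set2P[]->; [exists c|exists d] => //.
    by rewrite /newv /tag k (pick_nbr d2 nc) e.
  by rewrite /newv /tag ed k (pick_nbr c2 nd) e.
- case: o ho => // z zE; pose j := index z (enum (eset c)).
  have zs : z \in enum (eset c) by rewrite mem_enum.
  have jl : j < size (enum (inner (eset c))).
    have : j < size (enum (eset c)) by rewrite index_mem.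
    by rewrite -!cardE i e !cards2 cd xy.
  pose c' := nth c (enum (inner (eset c))) j.
  have c'I : c' \in inner (eset c) by have : c' \in enum (inner (eset c)); [apply: mem_nth|rewrite mem_enum].
  have [c2' e'] := eset_inner c'I; exists c' => //; rewrite /newv e' (tag_square k c'I).
  by rewrite index_uniq ?enum_uniq // (nth_map x) ?index_mem // nth_index.
Qed.

Lemma adj_old_new x c : deg2 c -> old_new_adj kind x (newv c) = adj (val x) c.
Proof.
move=> c2; rewrite adj_sym /old_new_adj /=.
case: (inner_cases c2) => [[y [z [yz e nc i k]]]|[y [z [d [[yz e cd acd] nc nd i k]]]]|[y [z [d [[yz e cd ncd] nc nd i k]]]]]; rewrite k.
- by rewrite e nc !inE -!val_eqE.
- have [d2 ed] : deg2 d /\ eset d = eset c by apply: eset_inner; rewrite i !inE eqxx orbT.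
  rewrite /tag k (pick_nbr d2 nc) nc; apply/eqP/orP => [[->]|[/eqP/val_inj->//|/eqP xd]]; first by left.
  by have := valP x; rewrite /= xd d2.
- by rewrite e nc !inE -!val_eqE.
Qed.

Lemma adj_new_new c d : deg2 c -> deg2 d -> new_new_adj kind (newv c) (newv d) = adj c d.
Proof.
move=> c2 d2; rewrite /new_new_adj /=.
have [e1|ne] := eqVneq (eset c) (eset d); last first.
  transitivity false; [by case: (kind _)|apply/esym/negP=> acd]; case/eqP: ne.
  by rewrite /eset (ends_eq hmin c2 d2 acd).
have dI : d \in inner (eset c) by rewrite e1 inner_eset.
case: (inner_cases c2) => [[y [z [yz e nc i k]]]|[y [z [d' [[yz e cd acd] nc nd i k]]]]|[y [z [d' [[yz e cd ncd] nc nd i k]]]]]; rewrite k.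
- by move: dI; rewrite i => /set1P->; rewrite adj_irr.
- move: (dI); rewrite i => /set2P[->|dd]; first by rewrite eqxx adj_irr.
  rewrite dd acd; apply/eqP=> et; case/eqP: cd; rewrite -dd.
  by apply: newv_inj => //; rewrite /newv e1 et dd.
- by move: dI; rewrite i => /set2P[->|->]; rewrite ?adj_irr // (negbTE ncd).
Qed.

(** By [between_nadj] core vertices joined through a vertex of degree 2 are not adjacent in [G],
    which agrees with the removal of a subdivided edge. *)
Lemma adj_old_old x y : adj x y && kept kind [set x; y] = adj (val x) (val y).
Proof.
have iE : inner [set x; y] = between [set val x; val y] by rewrite /inner imsetU1 imset_set1.
rewrite /= /core_adj /kept /kind iE; case: (eqVneq x y) => [->|xy]; first by rewrite adj_irr.
have vxy : val x != val y by rewrite (inj_eq val_inj).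
have [i0|/set0Pn[c cI]] := eqVneq (between [set val x; val y]) set0; first by rewrite orbF andbT.
rewrite orbT /= (negbTE (between_nadj hmin vxy cI)); by case: (#|_| == 1) => //; case: [exists _ in _, _].
Qed.

Variable x0 : H.

(** The value at [x0] only fills an impossible branch: a vertex of degree 2 gives a valid new vertex
    by [newv_valid]. *)
Definition subdiv_map v : good_subdivide kind :=
  match insub v : option H with
  | Some x => inl x
  | None => match insub (newv v) : option {n | new_vertex kind n} with
            | Some n => inr n
            | None => inl x0
            end
  end.

Lemma subdiv_map_old x : subdiv_map (val x) = inl x.
Proof. by rewrite /subdiv_map valK. Qed.

Lemma subdiv_map_new c : deg2 c -> exists2 n, subdiv_map c = inr n & val n = newv c.
Proof.
move=> c2; have nv := newv_valid c2; exists (exist _ (newv c) nv) => //.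
by rewrite /subdiv_map insubN ?negbK // insubT.
Qed.

Lemma vertexP v : (exists x, v = val x) \/ deg2 v.
Proof.
case: (boolP (deg2 v)) => v2; [by right|left].
by exists (exist (fun v => ~~ deg2 v) v v2).
Qed.

Lemma subdiv_map_bij : bijective subdiv_map.
Proof.
apply: inj_card_bij => [u v|].
  case: (vertexP u) => [[x ->]|u2]; case: (vertexP v) => [[y ->]|v2]; rewrite ?subdiv_map_old.
  - by case=> ->.
  - by have [n -> _] := subdiv_map_new v2.
  - by have [n -> _] := subdiv_map_new u2.
  - have [n -> en] := subdiv_map_new u2; have [m -> em] := subdiv_map_new v2 => -[nm].
    by apply: newv_inj => //; rewrite -en -em nm.
apply: leq_trans (leq_image_card subdiv_map _); apply: subset_leq_card; apply/subsetP=> -[x|n] _.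
  by apply/imageP; exists (val x); rewrite ?subdiv_map_old.
have [c c2 e] := newv_surj (valP n).
have [m em ev] := subdiv_map_new c2; apply/imageP; exists c => //; rewrite em; congr inr.
by apply: val_inj; rewrite ev.
Qed.

Lemma subdiv_iso : isomorphic G (good_subdivide kind).
Proof.
exists subdiv_map; first exact: subdiv_map_bij.
move=> u v; case: (vertexP u) => [[x ->]|u2]; case: (vertexP v) => [[y ->]|v2]; rewrite ?subdiv_map_old.
- exact: adj_old_old.
- by have [n -> en] := subdiv_map_new v2; rewrite /= en adj_old_new.
- by have [n -> en] := subdiv_map_new u2; rewrite /= en adj_old_new // adj_sym.
- have [n -> en] := subdiv_map_new u2; have [m -> em] := subdiv_map_new v2.
  by rewrite /= en em adj_new_new.
Qed.
End Iso.

(** [G] has enough vertices, so it fails to be 3-connected because of a separator. By [no_cut1] this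
    has two vertices, and the small side given by [sep2_two] consists of vertices of degree 2. *)
Lemma ex_deg2 (G : sgraph) : minor_minimal_mmw_ge3 G -> ~ k_connected 3 G -> exists c : G, deg2 c.
Proof.
move=> hmin n3; apply: contrapT => no; apply: n3; split; first exact: leq_trans (card_ge7 hmin).
move=> S S2 x y xS yS; apply: contraT => nxy; exfalso.
pose r (u v : G) := [&& u \notin S, v \notin S & adj u v].
pose Z := [set z | connect r x z].
have ZS u : u \in Z -> u \notin S.
  rewrite inE => uZ; suff : u \in ~: S by rewrite inE.
  by apply: (connect_inv _ _ uZ); rewrite ?inE // => p q _ /and3P[_ qS _]; rewrite inE.
have cl u v : u \in Z -> adj u v -> (v \in Z) || (v \in S).
  move=> uZ auv; case vS: (v \in S); rewrite ?orbT // orbF; have uS := ZS u uZ.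
  rewrite inE in uZ; rewrite inE; apply: connect_trans uZ (connect1 _); by rewrite /r uS vS.
have xZ : x \in Z by rewrite inE.
have yZ : y \notin Z by rewrite inE.
case: (leqP #|S| 1) => [S1|S1]; first exact: (no_cut1 hmin S1 xZ yZ yS ZS cl).
have /cards2P[a [b [ab eS]]] : #|S| == 2 by rewrite eqn_leq S1 andbT.
rewrite eS in ZS cl yS.
have s2 : sep2 a b Z.
  split; last by move=> u v uZ auv; have := cl u v uZ auv; rewrite !inE.
  split=> //; try by apply/negP=> /ZS; rewrite !inE eqxx ?orbT.
    by exists x.
  by exists y; rewrite yZ; move: yS; rewrite !inE negb_or.
case: (sep2_two hmin s2) => [[_ _ /(_ _ xZ) d]|[_ _ /(_ y)]].
  by apply: no; exists x; rewrite /deg2 d.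
have -> : y \in coside a b Z by rewrite in_set yZ; move: yS; rewrite !inE negb_or.
by move/(_ isT) => d; apply: no; exists y; rewrite /deg2 d.
Qed.

Theorem lemma3p8 (G : sgraph) :
  ~ k_connected 3 G ->
  minor_minimal_mmw_ge3 G ->
  exists (H : sgraph) (k : {set H} -> subdivision),
    [/\ k_connected 3 H,
        [\/ #|H| = 4, #|H| = 5 | #|H| = 6]
      & isomorphic G (good_subdivide k)].
Proof.
move=> n3 hmin; have ge4 := core_ge4 hmin.
have le6 := core_le6 hmin (ex_deg2 hmin n3).
have /card_gt0P[x0 _] : 0 < #|core G| by apply: leq_trans ge4.
exists (core G), (@kind G); split; last exact: subdiv_iso hmin x0.
  by split; [apply: leq_trans ge4|move=> S S2; apply: (core_connected hmin)].
move: ge4 le6; case: #|core G| => [|[|[|[|[|[|[|n]]]]]]] // _ _;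
  by [apply: Or31|apply: Or32|apply: Or33].
Qed.
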